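(* Let $N\ge 1$ and let $(u,v)\in L^3_{loc}(\mathbb{R}^N)\times L^3_{loc}(\mathbb{R}^N)$ be a distributional solution (with no sign assumption on $u,v$) of $$\begin{cases}-\Delta u=u-u^3-\Lambda uv^2 & \text{in }\mathbb{R}^N\\ -\Delta v=v-v^3-\Lambda u^2v & \text{in }\mathbb{R}^N.\end{cases}$$ Then: (i) If $\Lambda>0$, then $u$ and $v$ are smooth and satisfy $|u|\le 1$ and $|v|\le 1$ in $\mathbb{R}^N$. (ii) If $\Lambda\ge 1$, then $u^2+v^2\le 1$ in $\mathbb{R}^N$. (iii) If $\Lambda\in(0,1)$, then $u^2+v^2\le \frac{2}{\Lambda+1}$ in $\mathbb{R}^N$.
   Context: $u$ and $v$ are real-valued, and $\Lambda$ is a real parameter. Functions in $L^3_{loc}$ are identified when equal almost everywhere; ''smooth'' means that there is a smooth representative, and pointwise statements refer to it. *)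

(* Defs.v *)
From HB Require Import structures.
From mathcomp Require Import all_boot all_order all_algebra.
From mathcomp Require Import all_classical all_reals all_analysis.

Set Implicit Arguments.
Unset Strict Implicit.
Unset Printing Implicit Defensive.

Import Order.TTheory GRing.Theory Num.Theory.
Import numFieldNormedType.Exports.

Local Open Scope classical_set_scope.
Local Open Scope ring_scope.

(* R^N is 'rV[R]_N, whose topology is that of MathComp-Analysis. The library   *)
(* has no sigma-algebra on row vectors: we use the one generated by the        *)
(* coordinates, i.e. the product sigma-algebra (for T := R, the Borel sets),   *)
(* exactly as the library does for n.-tuple T.                                 *)

Definition rV_display : measure_display -> measure_display.
Proof. exact. Qed.

Section measurable_rV.
Context {d} {T : sigmaRingType d} (n : nat).

Let coors : 'I_n -> 'rV[T]_n -> T := fun i x => x ord0 i.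

Let rV_set0 : g_sigma_preimage coors set0.
Proof. exact: sigma_algebra0. Qed.

Let rV_setC A : g_sigma_preimage coors A -> g_sigma_preimage coors (~` A).
Proof. exact: sigma_algebraC. Qed.

Let rV_bigcup (F : (set 'rV[T]_n)^nat) :
  (forall i, g_sigma_preimage coors (F i)) ->
  g_sigma_preimage coors (\bigcup_i (F i)).
Proof. exact: sigma_algebra_bigcup. Qed.

HB.instance Definition _ := @isMeasurable.Build (rV_display d)
  'rV[T]_n (g_sigma_preimage coors) rV_set0 rV_setC rV_bigcup.

Lemma measurable_coord_rV (i : 'I_n) :
  measurable_fun [set: 'rV[T]_n] (fun x : 'rV[T]_n => x ord0 i).
Proof.
move=> _ Y mY; rewrite setTI; apply: sub_sigma_algebra => /=.
rewrite -bigcup_seq/=; exists i => /=; first by rewrite mem_index_enum.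
by exists Y => //; rewrite setTI.
Qed.

End measurable_rV.

Lemma measurable_fun_rV d1 d2 (T1 : measurableType d1) (T2 : measurableType d2)
    n (f : T1 -> 'rV[T2]_n) :
  (forall i, measurable_fun [set: T1] (fun x => f x ord0 i)) ->
  measurable_fun [set: T1] f.
Proof.
move=> mf _ A mA; rewrite setTI.
suff : image_set_system setT f measurable A.
  by rewrite /image_set_system /= setTI.
move: A mA; apply: smallest_sub.
  by apply: sigma_algebra_image; exact: sigma_algebra_measurable.
move=> A; rewrite -bigcup_seq => -[i _ [B mB <-]].
rewrite /image_set_system /= !setTI -comp_preimage.
by rewrite -[X in measurable X]setTI; exact: mf.
Qed.

Definition cons_rV (T : Type) n (p : T * 'rV[T]_n) : 'rV[T]_n.+1 :=
  row_mx (const_mx p.1 : 'rV[T]_1) p.2.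

Lemma measurable_cons_rV d (T : measurableType d) n :
  measurable_fun [set: T * 'rV[T]_n] (@cons_rV T n).
Proof.
apply: measurable_fun_rV => i.
case: (@splitP 1 n i) => [j ij|k ik].
  rewrite (_ : (fun _ => _) = fst) //; apply/funext => -[a x].
  have -> : i = @lshift 1 n j by exact: val_inj.
  by apply: (etrans (row_mxEl _ _ _ _)); rewrite mxE.
rewrite (_ : (fun _ => _) = (fun y : 'rV[T]_n => y ord0 k) \o snd).
  by apply: measurableT_comp => //; exact: measurable_coord_rV.
apply/funext => -[a x].
have -> : i = @rshift 1 n k by exact: val_inj.
by apply: (etrans (row_mxEr _ _ _ _)).
Qed.

Definition uncons_rV (T : Type) n (x : 'rV[T]_n.+1) : T * 'rV[T]_n :=
  (x ord0 ord0, \row_j x ord0 (lift ord0 j)).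

Lemma cons_rVK (T : Type) n : cancel (@cons_rV T n) (@uncons_rV T n).
Proof.
move=> [a x]; congr pair.
  have -> : ord0 = @lshift 1 n ord0 by exact: val_inj.
  by apply: (etrans (row_mxEl _ _ _ _)); rewrite mxE.
apply/rowP => j; rewrite mxE.
have -> : lift ord0 j = @rshift 1 n j by exact: val_inj.
by apply: (etrans (row_mxEr _ _ _ _)).
Qed.

Lemma measurable_uncons_rV d (T : measurableType d) n :
  measurable_fun [set: 'rV[T]_n.+1] (@uncons_rV T n).
Proof.
apply/measurable_fun_pairP; split; first exact: measurable_coord_rV.
apply: measurable_fun_rV => i.
rewrite (_ : (fun _ => _) = (fun x : 'rV[T]_n.+1 => x ord0 (lift ord0 i))).
  exact: measurable_coord_rV.
by apply/funext => x /=; rewrite mxE.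
Qed.

Section lebesgue_rV.
Context (R : realType).
Local Open Scope ereal_scope.

Section step.
Context (n : nat) (mu : {sigma_finite_measure set 'rV[R]_n -> \bar R}).

Let T := measurableTypeR R.
Let leb : {sigma_finite_measure set T -> \bar R} := @lebesgue_measure R.

Definition lebesgue_cons : set 'rV[R]_n.+1 -> \bar R :=
  pushforward (leb \x mu)%E (@cons_rV R n).

Let mcons : measurable_fun [set: (T * 'rV[R]_n)%type] (@cons_rV R n).
Proof. exact: measurable_cons_rV. Qed.

Let lebesgue_cons0 : lebesgue_cons set0 = 0.
Proof. by rewrite /lebesgue_cons /pushforward preimage_set0 measure0. Qed.

Let lebesgue_cons_ge0 A : 0 <= lebesgue_cons A.
Proof. exact: measure_ge0. Qed.

Let lebesgue_cons_sigma_additive : semi_sigma_additive lebesgue_cons.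
Proof.
move=> F mF tF mUF; rewrite /lebesgue_cons /pushforward preimage_bigcup.
apply: measure_semi_sigma_additive.
- by move=> k; rewrite -[X in measurable X]setTI; exact: mcons.
- apply/trivIsetP => /= i j _ _ ij; rewrite -preimage_setI.
  by move/trivIsetP : tF => /(_ _ _ _ _ ij) ->//; rewrite preimage_set0.
- by rewrite -preimage_bigcup -[X in measurable X]setTI; exact: mcons.
Qed.

HB.instance Definition _ := isMeasure.Build _ _ _ lebesgue_cons
  lebesgue_cons0 lebesgue_cons_ge0 lebesgue_cons_sigma_additive.

Let lebesgue_cons_sigma_finite : sigma_finite setT lebesgue_cons.
Proof.
have /sigma_finiteP[F [TF ndF Foo]] := sigma_finiteT leb.
have /sigma_finiteP[G [TG ndG Goo]] := sigma_finiteT mu.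
exists (fun k => @uncons_rV R n @^-1` (F k `*` G k)).
  rewrite predeqE => x; split=> // _.
  have [i _ Fi] : (\bigcup_k F k) (uncons_rV x).1 by rewrite -TF.
  have [j _ Gj] : (\bigcup_k G k) (uncons_rV x).2 by rewrite -TG.
  exists (maxn i j) => //; split.
  - by move: Fi; exact/subsetPset/ndF/leq_maxl.
  - by move: Gj; exact/subsetPset/ndG/leq_maxr.
move=> k; have [? ?] := Foo k; have [? ?] := Goo k; split.
  rewrite -[X in measurable X]setTI.
  by apply: (@measurable_uncons_rV _ T n) => //; exact: measurableX.
rewrite /lebesgue_cons /pushforward -comp_preimage.
rewrite (_ : _ \o _ = id); last by apply/funext; exact: cons_rVK.
rewrite preimage_id product_measure1E//.
by rewrite lte_mul_pinfty// ge0_fin_numE.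
Qed.

HB.instance Definition _ := Measure_isSigmaFinite.Build _ _ _ lebesgue_cons
  lebesgue_cons_sigma_finite.

End step.

(* N-dimensional Lebesgue measure, as the N-fold product of lebesgue_measure *)
Fixpoint lebesgue_rV (n : nat) : {sigma_finite_measure set 'rV[R]_n -> \bar R} :=
  match n with
  | 0 => \d_(0%R : 'rV[R]_0)
  | m.+1 => lebesgue_cons (lebesgue_rV m)
  end.

End lebesgue_rV.

Section pde.
Context {R : realType} {N : nat}.
Implicit Types (u v f phi : 'rV[R]_N -> R).

Definition e_ (i : 'I_N) : 'rV[R]_N := delta_mx ord0 i.

(* D^s f for a sequence s = [:: i_1; ...; i_k] of coordinates:                 *)
(* d/dx_{i_1} (... (d/dx_{i_k} f)).                                            *)
Definition iter_partial (s : seq 'I_N) f : 'rV[R]_N -> R :=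
  foldr (fun i g => 'D_(e_ i) g) f s.

(* 'D_v f is a total operator, hence the explicit derivability requirement *)
Definition smooth f : Prop :=
  forall s : seq 'I_N, continuous (iter_partial s f) /\
    forall (i : 'I_N) x, derivable (iter_partial s f) x (e_ i).

Definition laplacian f : 'rV[R]_N -> R :=
  fun x => \sum_(i < N) iter_partial [:: i; i] f x.

Definition test_function phi : Prop :=
  smooth phi /\ compact (closure [set x | phi x != 0]).

(* An element of L^3_loc is an almost-everywhere class, and every such class   *)
(* has a Borel representative; the functions below are such representatives.   *)
Definition L3loc u : Prop :=
  measurable_fun [set: 'rV[R]_N] u /\
  forall K : set 'rV[R]_N, compact K ->
    (lebesgue_rV R N).-integrable K (fun x => (`|u x| ^+ 3)%:E).

(* - Laplacian u = f in the sense of distributions, for u, f in L^1_loc *)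
Definition neg_laplacian_eq u f : Prop :=
  forall phi, test_function phi ->
    - (\int[lebesgue_rV R N]_x (u x * laplacian phi x)) =
    \int[lebesgue_rV R N]_x (f x * phi x).

Definition distributional_solution (Lambda : R) u v : Prop :=
  neg_laplacian_eq u (fun x => u x - u x ^+ 3 - Lambda * u x * v x ^+ 2) /\
  neg_laplacian_eq v (fun x => v x - v x ^+ 3 - Lambda * u x ^+ 2 * v x).

Definition smooth_representative u U : Prop :=
  smooth U /\ {ae lebesgue_rV R N, forall x, u x = U x}.

End pde.

(* Main.v *)
(* The Laplacian is replaced by the second difference operator, applied to      *)
(* mollifications of the solution, for which it equals the mollified right-hand *)
(* side up to O(h^3).                                                           *)
(*                                                                              *)
(* Bound by 1.  Where u > 1 one has Laplacian u >= u^3 - u, since Lambda > 0.   *)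
(* With the convex truncation j(s) = w^2 / (1 + w), w = (s - 1)^+, Kato's       *)
(* inequality gives Laplacian j(u) >= 4 j(u) + j(u)^3.  Testing the cubic term  *)
(* with psi^3, where psi is a cutoff at scale L, Young's inequality bounds the  *)
(* integral of j(u) on boxes of side L by a power of L; testing with psi^3      *)
(* again gains a factor L^-2 each time, so j(u) = 0 almost everywhere.  The     *)
(* same holds for -u, v and -v.                                                 *)
(*                                                                              *)
(* Regularity.  If |u| <= M and |Laplacian u| <= K, comparing u with its        *)
(* reflection in a hyperplane by the maximum principle gives a Lipschitz bound  *)
(* with constant 2 M + K.  It is uniform on mollifications, hence provides a    *)
(* Lipschitz representative; it also applies to difference quotients, which     *)
(* bounds the iterated difference quotients of every order.                     *)
(*                                                                              *)
(* Sum of squares.  s = u^2 + v^2 satisfies Laplacian s >= 2 (k s^2 - s) with   *)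
(* k = 1 if Lambda >= 1 and k = (1 + Lambda) / 2 otherwise; the maximum         *)
(* principle applied to s - e |x - x0|^2, e -> 0, gives s <= 1 / k.             *)

Require Import Defs.
From HB Require Import structures.
From mathcomp Require Import all_boot all_order all_algebra.
From mathcomp Require Import all_classical all_reals all_analysis.
From mathcomp Require Import measurable_realfun ring lra.

Set Implicit Arguments.
Unset Strict Implicit.
Unset Printing Implicit Defensive.

Import Order.TTheory GRing.Theory Num.Theory.
Import numFieldNormedType.Exports.

Local Open Scope classical_set_scope.
Local Open Scope ring_scope.

(** The equation enters only through [weak_lap]: tested on a translated mollifier, it says that the
    mollification of [u] has as Laplacian the mollification of [g]. Taylor remainders of order
    [h ^+ 3] sit on the smooth kernel, so pointwise arguments work with second differences, and [h]
    then tends to zero by [ler_linear_eps]. Estimates uniform in the mollification scale survive its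
    removal because translations are continuous in local L1 ([locint_tcont], [mol_L1]).

    Bound by 1. Where [u] exceeds 1 the coupling term has the sign of [u], so [u] is a subsolution
    of the scalar equation. Its convex truncation [w] satisfies in the weak sense Laplacian w >= 4 w
    + w^3 ([kato], [djtr_source]). The cubic term bounds the mass of [w] on a cube of side L by a
    power of L, with no growth assumption on [u]. The linear term bounds the mass at scale L by L^-2
    times the mass at scale 2 L, up to a constant. Iterating the second bound beats any power, so
    [w] vanishes ([geometric_decay], [subsolution_le1]). Oddness of the system gives the lower
    bounds.

    Regularity. Solutions and right-hand sides are now bounded. Comparing a mollification with its
    mirror image gives a gradient bound free of the mollification scale ([odd_difference_bound]),
    hence a Lipschitz representative ([lipschitz_representative]). Difference quotients solve
    equations of the same type, and the nonlinearity is polynomial, so each bound of order k yields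
    one of order k + 1 ([elliptic_gain], [all_Dk_system]). Bounds on iterated quotients of all
    orders force actual derivatives to exist ([second_difference_cauchy], [smooth_of_all_Dk]).

    Sum of squares. Laplacian (U^2 + W^2) is at least twice U Laplacian U + W Laplacian W, which by
    algebra is at least k s^2 - s for s = U^2 + W^2. This is positive once s > 1/k. As s is bounded,
    a small quadratic penalty produces a maximum, where that sign is contradictory
    ([sum_sqr_bound]). *)

(** * Translation invariance of Lebesgue measure on the line *)

Section lebesgue_translation.
Context (R : realType).
Local Notation T := (measurableTypeR R).
Local Notation leb := (@lebesgue_measure R).
Local Open Scope ereal_scope.

Lemma measurable_shift (a : R) : measurable_fun setT (fun t : T => (t + a)%R : T).
Proof. by apply: measurable_funD => //; exact: measurable_cst. Qed.

Let shiftm (a : R) : {mfun T >-> T} :=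
  HB.pack (fun t : T => (t + a)%R : T)
    (isMeasurableFun.Build _ _ _ _ _ (measurable_shift a)).

(** Uniqueness of Lebesgue measure reduces the claim to half-open intervals, whose length a shift
    preserves. *)
Lemma lebesgue_pushforward_shift (a : R) (A : set T) : measurable A ->
  pushforward leb (fun t : T => (t + a)%R : T) A = leb A.
Proof.
move=> mA; apply/esym.
rewrite (@lebesgue_measure_unique R (pushforward leb (shiftm a)))//.
move=> X [[x y] /= _ <-]; rewrite /pushforward.
have -> : (fun t : T => (t + a)%R : T) @^-1` `]x, y]%classic
    = `](x - a)%R, (y - a)%R]%classic.
  apply/seteqP; split => t /=; rewrite !in_itv/=.
    by rewrite -ltrBlDr -lerBrDr.
  by rewrite ltrBlDr lerBrDr.
rewrite !lebesgue_measure_itv/= !lte_fin ltrD2r.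
by case: ifP => // _; rewrite -!EFinB; congr (_%:E); ring.
Qed.

Lemma ge0_integral_shift (a : R) (f : T -> \bar R) :
  measurable_fun setT f -> (forall t, 0 <= f t) ->
  \int[leb]_t f (t + a)%R = \int[leb]_t f t.
Proof.
move=> mf f0.
have := @ge0_integral_pushforward _ _ T T R _ (measurable_shift a) leb setT f
  measurableT mf (fun y _ => f0 y).
rewrite preimage_setT => <-.
apply: eq_measure_integral => [? ?|? A mA _].
  exact: measurable_shift.
exact: lebesgue_pushforward_shift.
Qed.

End lebesgue_translation.

(** * Tonelli, translation invariance and volume of cubes in N dimensions *)

Section lebesgue_rV_translation.
Context (R : realType).
Local Notation T := (measurableTypeR R).
Local Notation leb := (@lebesgue_measure R).
Local Open Scope ereal_scope.

Let mcons n : measurable_fun [set: (T * 'rV[R]_n)%type] (@cons_rV R n).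
Proof. exact: measurable_cons_rV. Qed.

Lemma ge0_integral_cons n (f : 'rV[R]_n.+1 -> \bar R) :
  measurable_fun setT f -> (forall x, 0 <= f x) ->
  \int[lebesgue_rV R n.+1]_x f x =
  \int[leb]_t \int[lebesgue_rV R n]_x f (cons_rV (t, x)).
Proof.
move=> mf f0.
pose lebs : {sigma_finite_measure set T -> \bar R} := leb.
pose m : {measure set _ -> \bar R} := (lebs \x lebesgue_rV R n)%E.
have := @ge0_integral_pushforward _ _ _ _ _ _
  (@mcons n) m setT f measurableT mf
  (fun y _ => f0 y).
have mfc : measurable_fun [set: (T * 'rV[R]_n)%type] (f \o @cons_rV R n).
  by apply: measurableT_comp => //; exact: (@mcons n).
rewrite preimage_setT /m (@fubini_tonelli1 _ _ T _ R lebs (lebesgue_rV R n) _ mfc (fun=> f0 _)) => <-.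
by apply: eq_measure_integral => [|? A mA _]; [exact: mcons|].
Qed.

Lemma cons_rVD n (t a : R) (x z : 'rV[R]_n) :
  cons_rV ((t + a)%R, (x + z)%R) = (cons_rV (t, x) + cons_rV (a, z))%R.
Proof.
apply: (etrans _ (esym (@add_row_mx _ 1 1 n _ _ _ _))); congr row_mx.
by apply/rowP => i; rewrite !mxE.
Qed.

Lemma uncons_rVK n (z : 'rV[R]_n.+1) : cons_rV (uncons_rV z) = z.
Proof.
apply/rowP => i; rewrite /cons_rV /uncons_rV /=.
case: (@splitP 1 n i) => [j ij|k ik].
  have -> : i = @lshift 1 n j by exact: val_inj.
  apply: (etrans (row_mxEl _ _ _ _)); rewrite mxE; congr (z _ _).
  by apply: val_inj; rewrite /= (ord1 j).
have -> : i = @rshift 1 n k by exact: val_inj.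
apply: (etrans (row_mxEr _ _ _ _)); rewrite mxE; congr (z _ _).
exact: val_inj.
Qed.

Lemma measurable_addrV n (z : 'rV[R]_n) :
  measurable_fun setT (fun x : 'rV[R]_n => (x + z)%R : 'rV[R]_n).
Proof.
apply: measurable_fun_rV => i.
rewrite (_ : (fun _ => _) = (fun x : 'rV[R]_n => (x ord0 i + z ord0 i)%R)).
  by apply: measurable_funD => //; exact: (@measurable_coord_rV _ R n i).
by apply/funext => x; rewrite mxE.
Qed.

(** Induction on the dimension: [ge0_integral_cons] splits off the first coordinate, which the
    one-dimensional statement shifts. *)
Lemma ge0_integral_rV_shift n (z : 'rV[R]_n) (f : 'rV[R]_n -> \bar R) :
  measurable_fun setT f -> (forall x, 0 <= f x) ->
  \int[lebesgue_rV R n]_x f (x + z)%R = \int[lebesgue_rV R n]_x f x.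
Proof.
elim: n z f => [|n IH] z f mf f0.
  by apply: eq_integral => x _; congr f; apply/rowP => -[].
have mfz : measurable_fun setT (fun x : 'rV[R]_n.+1 => f (x + z)%R).
  by apply: measurableT_comp => //; exact: measurable_addrV.
rewrite !ge0_integral_cons//.
have mfc : measurable_fun [set: (T * 'rV[R]_n)%type]
    (fun p : T * 'rV[R]_n => f (cons_rV p)).
  by apply: measurableT_comp => //; exact: (@mcons n).
rewrite -[RHS](ge0_integral_shift (uncons_rV z).1).
- apply: eq_integral => t _.
  rewrite -[RHS](IH (uncons_rV z).2)//.
  + apply: eq_integral => x _; congr f.
    by rewrite cons_rVD -surjective_pairing uncons_rVK.
  + exact: (measurableT_comp mfc (measurable_pair1 _)).
- apply: (@measurable_fun_fubini_tonelli_F _ _ _ _ _ (lebesgue_rV R n)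
    (fun p : T * 'rV[R]_n => f (cons_rV p))) => //.
- by move=> t; apply: integral_ge0 => x _.
Qed.

Definition box n (r : R) : set 'rV[R]_n :=
  [set x | forall i, (`|x ord0 i| <= r)%R].

Lemma measurable_box n r : measurable (@box n r : set 'rV[R]_n).
Proof.
rewrite (_ : box r = \bigcap_(i in [set: 'I_n])
    ((fun x : 'rV[R]_n => x ord0 i) @^-1` `[- r, r]%classic)%R).
  apply: fin_bigcap_measurable => // i _; rewrite -[X in measurable X]setTI.
  by apply: measurable_coord_rV => //; exact: measurable_itv.
apply/seteqP; split=> x /=.
  by move=> h i _; rewrite /= in_itv/= -ler_norml.
by move=> h i; rewrite ler_norml; have := h i I; rewrite /= in_itv.
Qed.

Lemma lebesgue_rV_box n (r : R) : (0 <= r)%R ->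
  lebesgue_rV R n (box r) = ((2 * r) ^+ n)%:E.
Proof.
move=> r0; elim: n => [|n IH].
  by rewrite expr0 /= diracE mem_set// => -[].
rewrite /= /lebesgue_cons /pushforward.
have -> : @cons_rV R n @^-1` (@box n.+1 r) =
    `[(- r)%R, r]%classic `*` (@box n r).
  apply/seteqP; split => [[t x]|[t x]] /=.
    move=> h; split => /=.
      rewrite in_itv/= -ler_norml; have := h ord0.
      have -> : ord0 = @lshift 1 n ord0 by exact: val_inj.
      by rewrite (_ : cons_rV _ _ _ = t)//; apply: (etrans (row_mxEl _ _ _ _)); rewrite mxE.
    move=> i; have := h (@rshift 1 n i).
    by rewrite (_ : cons_rV _ _ _ = x ord0 i)//; apply: (etrans (row_mxEr _ _ _ _)).
  rewrite in_itv/= -ler_norml => -[tr xr] i.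
  case: (@splitP 1 n i) => [j ij|k ik].
    have -> : i = @lshift 1 n j by exact: val_inj.
    by rewrite (_ : cons_rV _ _ _ = t)//; apply: (etrans (row_mxEl _ _ _ _)); rewrite mxE.
  have -> : i = @rshift 1 n k by exact: val_inj.
  by rewrite (_ : cons_rV _ _ _ = x ord0 k)//; apply: (etrans (row_mxEr _ _ _ _)).
rewrite product_measure1E//=; last exact: measurable_box.
rewrite IH lebesgue_measure_itv/= lte_fin.
have [rr|] := ltP (- r)%R r.
  by rewrite -EFinB -EFinM exprS; congr (_%:E); ring.
move=> rr.
have -> : r = 0%R by apply/eqP; rewrite eq_le r0 andbT; clear -rr; lra.
by rewrite mul0e mulr0 exprS mul0r.
Qed.

End lebesgue_rV_translation.

(** * Real-valued integrals, indicators of cubes, local integrability *)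

Section integral_rV.
Context {R : realType} {N : nat}.
Local Notation V := 'rV[R]_N.
Local Notation mu := (lebesgue_rV R N).
Implicit Types (f g u k : V -> R) (x z : V).

Definition itg f := mu.-integrable setT (EFin \o f).
Definition intR f : R := \int[mu]_x f x.
Definition bx (r : R) : V -> R := \1_(box r).
Definition mfun_rV f := measurable_fun [set: V] f.

Lemma itg_mfun f : itg f -> mfun_rV f.
Proof. by move=> /integrableP[/measurable_EFinP]. Qed.

Lemma itgD f g : itg f -> itg g -> itg (fun x => f x + g x).
Proof. by move=> If Ig; have := integrableD measurableT If Ig. Qed.

Lemma itgB f g : itg f -> itg g -> itg (fun x => f x - g x).
Proof. by move=> If Ig; have := integrableB measurableT If Ig. Qed.

Lemma itgZ a f : itg f -> itg (fun x => a * f x).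
Proof. by move=> If; have := integrableZl measurableT a If. Qed.

Lemma itg_norm f : itg f -> itg (fun x => `|f x|).
Proof. by move=> If; have := integrable_norm If. Qed.

Lemma le_itg f g : mfun_rV f -> (forall x, `|f x| <= g x) -> itg g -> itg f.
Proof.
move=> mf fg; apply: le_integrable => //; first exact/measurable_EFinP.
by move=> x _ /=; rewrite lee_fin (le_trans (fg x))// ler_norm.
Qed.

Lemma itg0 : itg (fun=> 0).
Proof. exact: integrable0. Qed.

Lemma itg_sum (I : Type) (s : seq I) (F : I -> V -> R) :
  (forall i, itg (F i)) -> itg (fun x => \sum_(i <- s) F i x).
Proof.
move=> IF; elim: s => [|i s IH].
  by under [X in itg X]funext do rewrite big_nil; exact: itg0.
by under [X in itg X]funext do rewrite big_cons; exact: itgD.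
Qed.

Lemma intRD f g : itg f -> itg g ->
  intR (fun x => f x + g x) = intR f + intR g.
Proof. exact: RintegralD. Qed.

Lemma intRB f g : itg f -> itg g ->
  intR (fun x => f x - g x) = intR f - intR g.
Proof. exact: RintegralB. Qed.

Lemma intRZ a f : itg f -> intR (fun x => a * f x) = a * intR f.
Proof. exact: RintegralZl. Qed.

Lemma intR0 : intR (fun=> 0) = 0.
Proof. by rewrite /intR /Rintegral integral0. Qed.

Lemma intR_sum (I : Type) (s : seq I) (F : I -> V -> R) :
  (forall i, itg (F i)) ->
  intR (fun x => \sum_(i <- s) F i x) = \sum_(i <- s) intR (F i).
Proof.
move=> IF; elim: s => [|i s IH].
  by under [X in intR X]funext do rewrite big_nil; rewrite big_nil intR0.
under [X in intR X]funext do rewrite big_cons.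
by rewrite intRD// ?big_cons ?IH//; exact: itg_sum.
Qed.

Lemma le_intR f g : itg f -> itg g -> (forall x, f x <= g x) -> intR f <= intR g.
Proof. by move=> If Ig fg; exact: le_Rintegral. Qed.

Lemma intR_ge0 f : (forall x, 0 <= f x) -> 0 <= intR f.
Proof. by move=> f0; exact: Rintegral_ge0. Qed.

Lemma le_norm_intR f : itg f -> `|intR f| <= intR (fun x => `|f x|).
Proof. exact: le_normr_Rintegral. Qed.

Lemma EFin_intR f : itg f -> (intR f)%:E = (\int[mu]_x (f x)%:E)%E.
Proof. by move=> If; rewrite fineK//; exact: integrable_fin_num If. Qed.

Lemma mfun_shift z f : mfun_rV f -> mfun_rV (fun x => f (x + z)).
Proof. by move=> mf; apply: (measurableT_comp mf); exact: measurable_addrV. Qed.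

Lemma itg_shift z f : itg f -> itg (fun x => f (x + z)).
Proof.
move=> /integrableP[/measurable_EFinP mf foo]; apply/integrableP; split.
  by apply/measurable_EFinP; exact: mfun_shift.
rewrite (ge0_integral_rV_shift z (f := fun x => `|(f x)%:E|%E))//.
by apply: measurableT_comp => //; exact/measurable_EFinP.
Qed.

Lemma intR_shift z f : mfun_rV f -> intR (fun x => f (x + z)) = intR f.
Proof.
move=> mf; have mE : measurable_fun setT (EFin \o f) by exact/measurable_EFinP.
rewrite /intR /Rintegral [in LHS]integralE [in RHS]integralE.
rewrite -(@ge0_integral_rV_shift R N z _ (measurable_funepos mE) (funepos_ge0 _)).
rewrite -(@ge0_integral_rV_shift R N z _ (measurable_funeneg mE) (funeneg_ge0 _)).
by congr (fine (_ - _)); apply: eq_integral => x _; rewrite ?funeposE ?funenegE.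
Qed.

Lemma mfun_bx r : mfun_rV (bx r).
Proof. by apply: measurable_indic; exact: measurable_box. Qed.

Lemma bx_ge0 r x : 0 <= bx r x.
Proof. by rewrite /bx indicE. Qed.

Lemma bx1 r x : (forall i, `|x ord0 i| <= r) -> bx r x = 1.
Proof. by move=> h; rewrite /bx indicE mem_set. Qed.

Lemma bx_le1 r x : bx r x <= 1.
Proof. by rewrite /bx indicE lern1 leq_b1. Qed.

Variant bx_spec r x : bool -> R -> Type :=
  | bx_in of (forall i, `|x ord0 i| <= r) : bx_spec r x true 1
  | bx_out of (~ forall i, `|x ord0 i| <= r) : bx_spec r x false 0.

Lemma bxP r x : bx_spec r x (x \in box r) (bx r x).
Proof.
rewrite /bx indicE; have [h|h] := boolP (x \in box r).
  by constructor; rewrite inE in h.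
by constructor; apply/asboolPn; rewrite notin_setE in h; exact/asboolPn.
Qed.

Lemma le_bx r s x : r <= s -> bx r x <= bx s x.
Proof.
move=> rs; case: (bxP r x) => [h|_]; last exact: bx_ge0.
by rewrite bx1// => i; rewrite (le_trans (h i)).
Qed.

Lemma bx_shift r s x z : (forall i, `|z ord0 i| <= s) ->
  bx r x <= bx (r + s) (x + z).
Proof.
move=> zs; case: (bxP r x) => [h|_]; last exact: bx_ge0.
by rewrite bx1// => i; rewrite mxE (le_trans (ler_normD _ _))// lerD.
Qed.

Lemma itg_bx r : itg (bx r).
Proof.
apply/integrableP; split; first by apply/measurable_EFinP; exact: mfun_bx.
rewrite (eq_integral (fun x => (\1_(box r) x : R)%:E)); last first.
  by move=> t _ /=; rewrite ger0_norm ?bx_ge0.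
rewrite integral_indic//; last exact: measurable_box.
rewrite setIT.
apply: (@le_lt_trans _ _ (mu (box `|r|))).
  apply: le_measure; rewrite ?inE; try exact: measurable_box.
  by move=> x h i; rewrite (le_trans (h i))// ler_norm.
by rewrite lebesgue_rV_box// ltry.
Qed.

Lemma intR_bx r : 0 <= r -> intR (bx r) = (2 * r) ^+ N.
Proof.
move=> r0; rewrite /intR /Rintegral integral_indic//; last exact: measurable_box.
by rewrite setIT; exact: (congr1 fine (@lebesgue_rV_box R N r r0)).
Qed.

(** Local L1, tested on cubes rather than on compact sets, so that localisation is multiplication by
    the explicit function [bx r]. *)
Definition locint u := mfun_rV u /\ forall r, itg (fun x => u x * bx r x).

Lemma locint_mul u k C r : locint u -> mfun_rV k ->
  (forall x, `|k x| <= C * bx r x) -> itg (fun x => u x * k x).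
Proof.
move=> [mu_ Iu] mk kC.
apply: (le_itg (g := fun x => `|C| * `|u x * bx r x|)).
- exact: measurable_funM.
- move=> x; rewrite !normrM mulrCA ler_wpM2l// [`|bx r x|]ger0_norm ?bx_ge0//.
  by rewrite (le_trans (kC x))// ler_wpM2r ?bx_ge0// ler_norm.
- exact/itgZ/itg_norm/Iu.
Qed.

Lemma le_locint u g : mfun_rV u -> (forall x, `|u x| <= g x) -> locint g -> locint u.
Proof.
move=> mu_ ug [mg Ig]; split=> // r; apply: (le_itg _ _ (Ig r)).
  by apply: measurable_funM => //; exact: mfun_bx.
by move=> x; rewrite normrM [`|bx r x|]ger0_norm ?bx_ge0// ler_wpM2r ?bx_ge0.
Qed.

Lemma locintD f g : locint f -> locint g -> locint (fun x => f x + g x).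
Proof.
move=> [mf If] [mg Ig]; split=> [|r]; first exact: measurable_funD.
by under [X in itg X]funext do rewrite mulrDl; exact: itgD.
Qed.

Lemma locintZ a f : locint f -> locint (fun x => a * f x).
Proof.
move=> [mf If]; split=> [|r].
  by apply: measurable_funM => //; exact: measurable_cst.
by under [X in itg X]funext do rewrite -mulrA; exact: itgZ.
Qed.

Lemma locintB f g : locint f -> locint g -> locint (fun x => f x - g x).
Proof.
move=> lf lg; have := locintD lf (locintZ (-1) lg).
by congr locint; apply/funext => x; rewrite mulN1r.
Qed.

Lemma locint_norm f : locint f -> locint (fun x => `|f x|).
Proof.
move=> [mf If]; split=> [|r]; first exact: measurableT_comp.
have := itg_norm (If r); congr itg; apply/funext => x.
by rewrite normrM [`|bx r x|]ger0_norm ?bx_ge0.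
Qed.

Lemma locint_bounded M f : mfun_rV f -> (forall x, `|f x| <= M) -> locint f.
Proof.
move=> mf fM; split=> // r; apply: (le_itg (g := fun x => M * bx r x)).
- by apply: measurable_funM => //; exact: mfun_bx.
- by move=> x; rewrite normrM [`|bx r x|]ger0_norm ?bx_ge0// ler_wpM2r ?bx_ge0.
- exact/itgZ/itg_bx.
Qed.

Lemma locint_shift z f : locint f -> locint (fun x => f (x + z)).
Proof.
move=> [mf If]; split=> [|r]; first exact: mfun_shift.
have [s zs] : exists s, forall i, `|z ord0 i| <= s.
  by exists (\sum_i `|z ord0 i|) => i; rewrite (bigD1 i)//= lerDl sumr_ge0.
apply: (le_itg _ _ (itg_shift z (itg_norm (If (r + s))))).
  by apply: measurable_funM; [exact: mfun_shift|exact: mfun_bx].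
move=> x; rewrite !normrM ler_wpM2l// !ger0_norm ?bx_ge0//.
exact: bx_shift.
Qed.

End integral_rV.
Arguments intR {R N} f.
Arguments bx {R N} r.

(** * Continuity of translations in local L1 *)

Section translation_continuity.
Context {R : realType} {N : nat}.
Local Notation V := 'rV[R]_N.
Local Notation mu := (lebesgue_rV R N).
Implicit Types (f g u k : V -> R) (x z : V) (r e C : R).

Lemma intR_cvg (F : nat -> V -> R) f g : (forall n, mfun_rV (F n)) ->
  (forall x, F n x @[n --> \oo] --> f x) -> itg g ->
  (forall n x, `|F n x| <= g x) ->
  itg f /\ intR (F n) @[n --> \oo] --> intR f.
Proof.
move=> mF Ff Ig Fg.
have mf : mfun_rV f by apply: (measurable_fun_cvg mF) => x _; exact: Ff.
have mFE n : measurable_fun setT (EFin \o F n) by apply/measurable_EFinP; exact: mF.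
have mfE : measurable_fun setT (EFin \o f) by apply/measurable_EFinP.
have FfE : {ae mu, forall x, setT x -> (EFin \o F n) x @[n --> \oo] --> (EFin \o f) x}.
  by apply: aeW => x _; apply/fine_cvgP; split; [by apply: nearW|]; apply: Ff.
have FgE : {ae mu, forall x n, setT x -> (`|(EFin \o F n) x| <= (EFin \o g) x)%E}.
  by apply: aeW => x n _ /=; rewrite lee_fin.
have [If _ cF] := dominated_convergence measurableT mFE mfE FfE Ig FgE.
split=> //; rewrite /intR /Rintegral.
by apply: fine_cvg; rewrite fineK//; exact: integrable_fin_num If.
Qed.

Definition tcont f := forall r e, 0 < e -> exists2 d, 0 < d &
  forall z, (forall i, `|z ord0 i| <= d) ->
    intR (fun x => `|f (x + z) - f x| * bx r x) <= e.

Lemma itg_diff f g r : locint f -> locint g ->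
  itg (fun x => `|f x - g x| * bx r x).
Proof. by move=> lf lg; have [_ /(_ r)] := locint_norm (locintB lf lg). Qed.

Lemma tcontD f g : locint f -> locint g -> tcont f -> tcont g ->
  tcont (fun x => f x + g x).
Proof.
move=> lf lg cf cg r e e0; have e20 : 0 < e / 2 by rewrite divr_gt0.
have [d d0 hd] := cf r _ e20; have [d' d'0 hd'] := cg r _ e20.
exists (Num.min d d'); first by rewrite lt_min d0.
move=> z zd; have [zd1 zd2] : (forall i, `|z ord0 i| <= d) /\ (forall i, `|z ord0 i| <= d').
  by split=> i; have := zd i; rewrite le_min => /andP[].
rewrite (splitr e) (le_trans _ (lerD (hd _ zd1) (hd' _ zd2)))// -intRD.
- apply: le_intR.
  + by apply: itg_diff; [exact/(@locint_shift _ _ z (fun x => f x + g x))/locintD|exact: locintD].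
  + by apply: itgD; apply: itg_diff => //; exact: locint_shift.
  + move=> x; rewrite -mulrDl ler_wpM2r ?bx_ge0//.
    by rewrite opprD addrACA ler_normD.
- by apply: itg_diff => //; exact: locint_shift.
- by apply: itg_diff => //; exact: locint_shift.
Qed.

Lemma tcontZ a f : locint f -> tcont f -> tcont (fun x => a * f x).
Proof.
move=> lf cf r e e0; have ea0 : 0 < e / (`|a| + 1).
  by rewrite divr_gt0// ltr_wpDl.
have [d d0 hd] := cf r _ ea0; exists d => // z /hd {}hd.
rewrite (_ : (fun x => _) = (fun x => `|a| * (`|f (x + z) - f x| * bx r x))).
  rewrite intRZ; last by apply: itg_diff => //; exact: locint_shift.
  rewrite (le_trans (ler_wpM2l _ hd))// mulrC mulrAC ler_pdivrMr ?ltr_wpDl//.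
  by rewrite ler_pM2l// lerDl.
by apply/funext => x; rewrite -mulrBr normrM mulrA.
Qed.

(** The usual three-epsilon argument: shift the approximant, and pay the approximation error
    twice. *)
Lemma tcont_approx f : locint f ->
  (forall r e, 0 < e -> exists g, [/\ locint g, tcont g &
    intR (fun x => `|f x - g x| * bx r x) <= e]) -> tcont f.
Proof.
move=> lf H r e e0; have e30 : 0 < e / 3 by rewrite divr_gt0.
(* The cube is enlarged by 1 because a shift with coordinates at most 1 carries [box r] into
   [box (r + 1)]. *)
have [g [lg cg gfe]] := H (r + 1) _ e30; have [d d0 hd] := cg r _ e30.
exists (Num.min d 1); first by rewrite lt_min d0 ltr01.
move=> z zd; have [zd1 zd2] : (forall i, `|z ord0 i| <= d) /\ (forall i, `|z ord0 i| <= 1).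
  by split=> i; have := zd i; rewrite le_min => /andP[].
have I1 s : itg (fun x => `|f x - g x| * bx s x) by exact: itg_diff.
have I2 : itg (fun x => `|g (x + z) - g x| * bx r x).
  by apply: itg_diff => //; exact: locint_shift.
have I3 := itg_shift z (I1 (r + 1)).
have fr : intR (fun x => `|f x - g x| * bx r x) <= e / 3.
  apply: le_trans gfe; apply: le_intR => // x.
  by rewrite ler_wpM2l// le_bx// lerDl.
have -> : e = e / 3 + e / 3 + e / 3 by field.
apply: le_trans (lerD (lerD gfe (hd _ zd1)) fr).
rewrite -[X in X + _ + _](intR_shift z); last exact: itg_mfun (I1 _).
rewrite -intRD// -intRD//; last exact: itgD.
apply: le_intR.
- by apply: itg_diff => //; exact: locint_shift.
- by apply: itgD => //; exact: itgD.
move=> x; apply: (@le_trans _ _ ((`|f (x + z) - g (x + z)| + `|g (x + z) - g x|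
    + `|f x - g x|) * bx r x)).
  rewrite ler_wpM2r ?bx_ge0// [`|f x - g x|]distrC.
  rewrite (le_trans _ (lerD (ler_normD _ _) (lexx _)))//.
  rewrite (le_trans _ (ler_normD _ _))//.
  by rewrite le_eqVlt; apply/orP; left; apply/eqP; congr (`|_|); ring.
rewrite !mulrDl !lerD// ler_wpM2l//; exact: bx_shift.
Qed.

Lemma tcont_lim (F : nat -> V -> R) f (C : R) : (forall n, mfun_rV (F n)) ->
  (forall n x, `|F n x| <= C) -> (forall n, tcont (F n)) ->
  (forall x, F n x @[n --> \oo] --> f x) -> tcont f.
Proof.
move=> mF FC cF Ff.
have mf : mfun_rV f by apply: (measurable_fun_cvg mF) => x _; exact: Ff.
have fC x : `|f x| <= C.
  have cn : `|F n x| @[n --> \oo] --> `|f x| by apply: cvg_norm; exact: Ff.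
  rewrite -(cvg_lim _ cn)//; apply: limr_le; first by apply/cvg_ex; eexists; exact: cn.
  by apply: nearW => n.
have lf : locint f by exact: locint_bounded fC.
have lF n : locint (F n) by exact: locint_bounded (FC n).
apply: tcont_approx => // r e e0.
have [|x||n x|_] := @intR_cvg (fun n x => `|f x - F n x| * bx r x) (fun=> 0)
    (fun x => (C + C) * bx r x).
- by move=> n; exact: itg_mfun (itg_diff _ lf (lF n)).
- have c1 : f x - F n x @[n --> \oo] --> (0 : R).
    by rewrite -(subrr (f x)); apply: cvgB; [exact: cvg_cst|exact: Ff].
  have c2 : `|f x - F n x| @[n --> \oo] --> (0 : R).
    by rewrite -(normr0 R); exact: cvg_norm.
  by rewrite -[X in _ --> X](mul0r (bx r x)); exact: cvgMr_tmp.
- by apply: itgZ; exact: itg_bx.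
- rewrite normrM normr_id [`|bx r x|]ger0_norm ?bx_ge0// ler_wpM2r ?bx_ge0//.
  by rewrite (le_trans (ler_normB _ _))// lerD.
rewrite intR0 => /cvgrPdist_le /(_ _ e0)[n _ /(_ n (leqnn n))].
rewrite sub0r normrN => h; exists (F n); split => //.
by rewrite (le_trans (ler_norm _)).
Qed.

Lemma tcont_lip f C : mfun_rV f ->
  (forall x z d, (forall i, `|z ord0 i| <= d) -> `|f (x + z) - f x| <= C * d) ->
  tcont f.
Proof.
move=> mf fC r e e0.
pose c := `|C| * intR (@bx R N r) + 1.
have c0 : 0 < c by rewrite ltr_wpDl// mulr_ge0// intR_ge0// => x; exact: bx_ge0.
have d0 : 0 < e / c by rewrite divr_gt0.
exists (e / c) => // z zd.
apply: (@le_trans _ _ (intR (fun x => (`|C| * (e / c)) * bx r x))).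
  apply: le_intR; last 1 first.
  - move=> x; rewrite ler_wpM2r ?bx_ge0// (le_trans (fC _ _ _ zd))//.
    by rewrite ler_wpM2r ?ler_norm// ltW.
  - apply: (le_itg _ _ (itgZ (`|C| * (e / c)) (itg_bx r))).
      apply: measurable_funM; last exact: mfun_bx.
      by apply: measurableT_comp => //; apply: measurable_funB => //; exact: mfun_shift.
    move=> x; rewrite normrM normr_id [`|bx r x|]ger0_norm ?bx_ge0//.
    rewrite ler_wpM2r ?bx_ge0// (le_trans (fC _ _ _ zd))//.
    by rewrite ler_wpM2r ?ler_norm// ltW.
  - exact/itgZ/itg_bx.
rewrite intRZ; last exact: itg_bx.
rewrite mulrAC mulrCA ger_pMr// ler_pdivrMr// mul1r /c lerDl//.
Qed.

Lemma mfun_indic (A : set V) : measurable A -> mfun_rV (\1_A : V -> R).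
Proof. by move=> mA; exact: measurable_indic. Qed.

Lemma norm_indic_le1 (A : set V) x : `|\1_A x : R| <= 1.
Proof. by rewrite indicE normr_nat lern1 leq_b1. Qed.

Lemma locint_indic (A : set V) : measurable A -> locint (\1_A : V -> R).
Proof.
by move=> mA; exact: locint_bounded (mfun_indic mA) (norm_indic_le1 A).
Qed.

(* A sigma-algebra containing the boxes, hence all measurable sets. *)
Definition tcset : set (set V) :=
  [set A | measurable A /\ tcont (\1_A : V -> R)].

(** The indicator of a union changes under a shift only if one of the two indicators does. *)
Lemma tcset_setU A B : tcset A -> tcset B -> tcset (A `|` B).
Proof.
move=> [mA cA] [mB cB]; split; first exact: measurableU.
have lAB := locintD (locint_indic mA) (locint_indic mB).
have cAB := tcontD (locint_indic mA) (locint_indic mB) cA cB.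
move=> r e e0; have [d d0 hd] := cA r _ (divr_gt0 e0 (ltr0n R 2)).
have [d' d'0 hd'] := cB r _ (divr_gt0 e0 (ltr0n R 2)).
exists (Num.min d d'); first by rewrite lt_min d0.
move=> z zd; have [zd1 zd2] : (forall i, `|z ord0 i| <= d) /\ (forall i, `|z ord0 i| <= d').
  by split=> i; have := zd i; rewrite le_min => /andP[].
rewrite (splitr e) (le_trans _ (lerD (hd _ zd1) (hd' _ zd2)))//.
have lA := locint_indic mA; have lB := locint_indic mB.
have lU := locint_indic (measurableU _ _ mA mB).
rewrite -intRD; try by apply: itg_diff => //; exact: locint_shift.
apply: le_intR.
- by apply: itg_diff => //; exact: locint_shift.
- by apply: itgD; apply: itg_diff => //; exact: locint_shift.
move=> x; rewrite -mulrDl ler_wpM2r ?bx_ge0// !indicE !in_setU.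
by do 4 case: (_ \in _) => //=; rewrite ?subrr ?subr0 ?sub0r ?normrN ?normr0 ?normr1 ?addr0 ?add0r// lerDl.
Qed.

Lemma tcset_sigma : sigma_algebra setT tcset.
Proof.
split.
- split=> //; apply: (@tcont_lip _ 0); first exact: mfun_indic.
  by move=> x z d _; rewrite !indicE !in_set0 subrr normr0 mul0r.
- move=> A [mA cA]; rewrite setTD; split; first exact: measurableC.
  move=> r e /(cA r)[d d0 hd]; exists d => // z /hd.
  congr (_ <= _); congr intR; apply/funext => x; congr (_ * _).
  rewrite !indicE !in_setC.
  by do 2 case: (_ \in _) => //=; rewrite ?subrr ?subr0 ?sub0r ?normrN.
- move=> F cF; have mF : measurable (\bigcup_k F k).
    by apply: bigcupT_measurable => k; have [] := cF k.
  have cU n : tcset (\big[setU/set0]_(k < n) F k).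
    elim: n => [|n IH]; last by rewrite big_ord_recr; exact: tcset_setU.
    rewrite big_ord0; split=> //; apply: (@tcont_lip _ 0); first exact: mfun_indic.
    by move=> x z d _; rewrite !indicE !in_set0 subrr normr0 mul0r.
  split=> //; apply: (@tcont_lim (fun n => \1_(\big[setU/set0]_(k < n) F k)) _ 1).
  + by move=> n; apply: mfun_indic; have [] := cU n.
  + by move=> n x; exact: norm_indic_le1.
  + by move=> n; have [] := cU n.
  move=> x; have [xF|xF] := pselect ((\bigcup_k F k) x).
    rewrite [X in _ --> X]indicE mem_set//; have [k _ Fkx] := xF.
    apply: cvg_near_cst; exists k.+1 => // n /= kn.
    rewrite indicE mem_set// -bigcup_mkord; exists k => //=.
  rewrite [X in _ --> X]indicE memNset//; apply: cvg_near_cst; apply: nearW => n.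
  rewrite indicE memNset// -bigcup_mkord => -[k _ Fkx].
  by apply: xF; exists k.
Qed.

(** The indicator of a half-space is the bounded pointwise limit of ramps of slope [n], which are
    Lipschitz. *)
Lemma tcset_coord (i : 'I_N) (a : R) : tcset [set x : V | a < x ord0 i].
Proof.
have mx (F : R -> R) : measurable_fun setT F -> mfun_rV (fun x : V => F (x ord0 i)).
  by move=> mF; apply: (measurableT_comp mF); exact: measurable_coord_rV.
have mA : measurable [set x : V | a < x ord0 i].
  rewrite (_ : [set _ | _] = (fun x : V => x ord0 i) @^-1` `]a, +oo[%classic).
    by rewrite -[X in measurable X]setTI; apply: measurable_coord_rV.
  by apply/seteqP; split => x /=; rewrite in_itv/= andbT.
split=> //.
pose F n (x : V) := Num.min 1 (Num.max 0 (n%:R * (x ord0 i - a))).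
have F01 n x : 0 <= F n x <= 1.
  by rewrite /F le_min ler01 le_max lexx/= ge_min lexx.
apply: (@tcont_lim F _ 1).
- move=> n; apply: (mx (fun t => Num.min 1 (Num.max 0 (n%:R * (t - a))))).
  apply: measurable_minr; first exact: measurable_cst.
  apply: measurable_maxr; first exact: measurable_cst.
  apply: measurable_funM; first exact: measurable_cst.
  by apply: measurable_funB; [exact: measurable_id|exact: measurable_cst].
- by move=> n x; have /andP[F0 F1] := F01 n x; rewrite ger0_norm.
- move=> n; apply: (@tcont_lip _ n%:R).
    apply: (mx (fun t => Num.min 1 (Num.max 0 (n%:R * (t - a))))).
    apply: measurable_minr; first exact: measurable_cst.
    apply: measurable_maxr; first exact: measurable_cst.
    apply: measurable_funM; first exact: measurable_cst.
    by apply: measurable_funB; [exact: measurable_id|exact: measurable_cst].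
  move=> x z d /(_ i) zd; rewrite /F !mxE.
  have : `|n%:R * (x ord0 i + z ord0 i - a) - n%:R * (x ord0 i - a)| <= n%:R * d.
    rewrite -mulrBr normrM ger0_norm// ler_wpM2l//.
    by rewrite (_ : _ - _ = z ord0 i)//; ring.
  set s := n%:R * (x ord0 i + z ord0 i - a); set t := n%:R * (x ord0 i - a).
  move: s t (n%:R * d) => s t c.
  rewrite !ler_norml => /andP[h1 h2].
  rewrite /Num.min /Num.max; do 2 case: (ltP 0 _) => ?; do ?case: (ltP 1 _) => ?; lra.
move=> x; rewrite [X in _ --> X]indicE; have [ax|xa] := ltP a (x ord0 i).
  rewrite mem_set//.
  have xa0 : 0 < x ord0 i - a by rewrite subr_gt0.
  apply: cvg_near_cst.
  exists (Num.trunc (x ord0 i - a)^-1).+1 => // n /= hn.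
  rewrite /F; apply/min_idPl; rewrite le_max; apply/orP; right.
  rewrite -ler_pdivrMr// mul1r (le_trans (ltW (truncnS_gt _)))//.
  by rewrite ler_nat.
rewrite memNset/=; last by rewrite leNgt in xa; exact/negP.
apply: cvg_near_cst; apply: nearW => n; rewrite /F.
have : n%:R * (x ord0 i - a) <= 0 by rewrite mulr_ge0_le0// subr_le0.
by move=> h; rewrite (max_idPl h); apply/min_idPr.
Qed.

(** Minimality is used twice: the sigma-algebra on vectors is generated by the coordinates, and that
    of the line by open rays. *)
Lemma tcset_measurable (A : set V) : measurable A -> tcset A.
Proof.
move: A; apply: smallest_sub; first exact: tcset_sigma.
move=> A; rewrite -bigcup_seq => -[i _ [B mB <-]]; rewrite setTI.
suff : [set B | tcset ((fun x : V => x ord0 i) @^-1` B)] B by [].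
have mB' : measurable (B : set R) by [].
move: mB'; rewrite [X in X B -> _](RGenOInfty.measurableE R).
move: B {mB}; apply: smallest_sub.
  have [t0 tC tU] := tcset_sigma; split => /=.
  - by rewrite preimage_set0.
  - by move=> B tB; rewrite setTD preimage_setC -setTD; exact: tC.
  - by move=> F tF; rewrite preimage_bigcup; exact: tU.
move=> _ [a ->] /=.
rewrite (_ : _ @^-1` _ = [set x : V | a < x ord0 i]); first exact: tcset_coord.
by apply/seteqP; split => x /=; rewrite in_itv/= andbT.
Qed.

Lemma tcont_sum (I : Type) (s : seq I) (F : I -> V -> R) :
  (forall i, locint (F i)) -> (forall i, tcont (F i)) ->
  locint (fun x => \sum_(i <- s) F i x) /\ tcont (fun x => \sum_(i <- s) F i x).
Proof.
move=> lF cF; elim: s => [|i s [lIH cIH]].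
  rewrite (_ : (fun x => _) = \1_(set0 : set V)); last first.
    by apply/funext => x; rewrite big_nil indicE in_set0.
  by split; [exact: locint_indic|have [] := tcset_measurable (@measurable0 _ V)].
rewrite (_ : (fun x => _) = fun x => F i x + \sum_(j <- s) F j x); last first.
  by apply/funext => x; rewrite big_cons.
by split; [exact: locintD|exact: tcontD].
Qed.

Import HBSimple.

Lemma tcont_sfun (h : {sfun V >-> R}) :
  tcont h /\ exists M, forall x, `|h x| <= M.
Proof.
pose s : seq R := finmap.enum_fset (fset_set (range h)).
have hE : (h : V -> R) = fun x => \sum_(y <- s) (y * \1_(h @^-1` [set y]) x).
  by apply/funext => x; rewrite fimfunE fsbig_finite//; exact: fimfunP.
have mh (y : R) : measurable (h @^-1` [set y]) by exact: measurable_sfunP.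
split.
  rewrite hE.
  have [||//] := @tcont_sum _ s (fun y x => y * \1_(h @^-1` [set y]) x).
    by move=> y; apply: locintZ; exact: locint_indic.
  move=> y; apply: tcontZ; first exact: locint_indic.
  by have [] := tcset_measurable (mh y).
exists (\sum_(y <- s) `|y|) => x; rewrite hE.
rewrite (le_trans (ler_norm_sum _ _ _))// ler_sum// => y _.
by rewrite normrM ler_piMr// norm_indic_le1.
Qed.

(** The approximant is a simple function. Its boundedness matters again in [kato], where it replaces
    a source that is merely locally integrable. *)
Lemma locint_approx u r e : locint u -> 0 < e ->
  exists g M, [/\ mfun_rV g, tcont g, forall x, `|g x| <= M &
    intR (fun x => `|u x - g x| * bx r x) <= e].
Proof.
move=> [mu_ Iu] e0.
have [h [hI _ hcvg]] := approximation_sfun_integrable measurableT (Iu r).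
have [n hn] : exists n, (\int[mu]_z `|(u z * bx r z)%:E - (h n z)%:E| <= e%:E)%E.
  move/fine_cvgP : hcvg => [[m _ hfin] /cvgrPdist_le /(_ _ e0)[k _ hk]].
  exists (maxn m k); have := hk _ (leq_maxr m k); have := hfin _ (leq_maxl m k).
  move=> /= fin; rewrite sub0r normrN => le_e.
  by rewrite -[leLHS]fineK// lee_fin (le_trans (ler_norm _)).
have mh : mfun_rV (h n) by exact: measurable_funP.
have [ch [M hM]] := tcont_sfun (h n).
exists (h n), M; split => //.
have Id : itg (fun x => `|u x * bx r x - h n x|).
  by apply/itg_norm/itgB; [exact: Iu|exact: hI].
rewrite -lee_fin; apply: le_trans hn; rewrite [leRHS](_ : _ = (intR (fun x => `|u x * bx r x - h n x|))%:E); last first.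
  by rewrite EFin_intR.
rewrite lee_fin; apply: le_intR => //.
  by apply: itg_diff => //; exact: locint_bounded hM.
by move=> x; case: (bxP r x) => _; rewrite ?mulr1 ?mulr0.
Qed.

Lemma locint_tcont u : locint u -> tcont u.
Proof.
move=> lu; apply: tcont_approx => // r e e0.
have [g [M [mg cg gM ug]]] := locint_approx r lu e0.
by exists g; split => //; exact: locint_bounded gM.
Qed.

End translation_continuity.

(** * Smooth functions on the line and the standard bump *)

Section smooth_functions_of_one_variable.
Context {R : realType}.
Implicit Types (f g : R -> R) (t s h : R).

(** A chain of functions linked by [is_derive], so that closure under sums, products and affine
    changes is a plain induction on the order. *)
Fixpoint Cn n f : Prop :=
  if n is n'.+1 then exists2 g, (forall t, is_derive t 1 f (g t)) & Cn n' g
  else True.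

Definition smooth1 f := forall n, Cn n f.

Lemma smooth1_derive f : smooth1 f ->
  exists2 g, (forall t, is_derive t 1 f (g t)) & smooth1 g.
Proof.
move=> sf; have [g fg _] := sf 1%N; exists g => // n.
have [g' fg' Cg'] := sf n.+1; rewrite (_ : g = g')//.
by apply/funext => t; rewrite -(@derive_val _ _ _ _ _ _ _ (fg t)) (@derive_val _ _ _ _ _ _ _ (fg' t)).
Qed.

Lemma Cn_le n f : Cn n.+1 f -> Cn n f.
Proof.
elim: n f => //= n IH f [g fg Cg]; exists g => //.
exact: IH.
Qed.

Lemma CnD n f g : Cn n f -> Cn n g -> Cn n (fun t => f t + g t).
Proof.
elim: n f g => //= n IH f g [f' ff' Cf'] [g' gg' Cg'].
exists (fun t => f' t + g' t); last exact: IH.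
by move=> t; exact: (@is_deriveD _ _ _ f g t 1 _ _ (ff' t) (gg' t)).
Qed.

Lemma CnM n f g : Cn n f -> Cn n g -> Cn n (fun t => f t * g t).
Proof.
elim: n f g => // n IH f g Cf Cg.
have [f' ff' Cf'] := Cf; have [g' gg' Cg'] := Cg.
exists (fun t => f t * g' t + g t * f' t).
  by move=> t; exact: (@is_deriveM _ _ f g t 1 _ _ (ff' t) (gg' t)).
by apply: CnD; apply: IH => //; exact: Cn_le.
Qed.

Lemma Cn_cst n a : Cn n (fun=> a).
Proof.
elim: n a => //= n IH a; exists (fun=> 0) => //.
by move=> t; exact: is_derive_cst.
Qed.

Lemma is_derive_affine f (f' : R) a c t : is_derive (a * t + c) 1 f f' ->
  is_derive t 1 (fun t => f (a * t + c)) (a * f').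
Proof.
move=> ff'; rewrite [a * f']mulrC.
apply: (@is_derive1_comp _ f (fun t => a * t + c) t _ _ ff').
have h1 : is_derive t (1 : R) (fun t : R => a * t) a.
  have := @is_deriveZ _ _ _ (@id R) a t 1 1 (is_derive_id _ _).
  by rewrite /GRing.scale/= mulr1.
have := @is_deriveD _ _ _ (fun t : R => a * t) (cst c) t 1 _ _ h1 (is_derive_cst _ _ _).
by rewrite addr0.
Qed.

Lemma Cn_affine n f a c : Cn n f -> Cn n (fun t => f (a * t + c)).
Proof.
elim: n f => //= n IH f [g fg Cg].
exists (fun t => a * g (a * t + c)) => [t|]; first exact: is_derive_affine.
by apply: CnM; [exact: Cn_cst|exact: IH].
Qed.

(* These functions form a class stable under differentiation. *)
Definition eta (P : {poly R}) t : R :=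
  if 0 < t then P.[t^-1] * expR (- t^-1) else 0.

(** For [s >= 1] the polynomial is at most a constant times [s ^+ n], while the exponential series
    contains the term of degree [n.+1]. *)
Lemma horner_le_expR (P : {poly R}) :
  exists C, forall s, 1 <= s -> `|P.[s]| * expR (- s) <= C / s.
Proof.
pose n := size P; pose c := \sum_(i < n) `|P`_i|.
exists (c * n.+1`!%:R) => s s1; have s0 : 0 < s by exact: lt_le_trans s1.
have Pc : `|P.[s]| <= c * s ^+ n.
  rewrite horner_coef (le_trans (ler_norm_sum _ _ _))// /c mulr_suml.
  apply: ler_sum => i _; rewrite normrM ler_wpM2l// ger0_norm ?exprn_ge0 ?(ltW s0)//.
  by apply: ler_weXn2l => //; exact: ltnW.
have c0 : 0 <= c by rewrite sumr_ge0.
have := expR_ge1Dxn n (ltW s0) => es.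
have {}es : s ^+ n.+1 / n.+1`!%:R <= expR s by rewrite (le_trans _ es)// lerDr.
rewrite expRN ler_pdivrMr ?expR_gt0// (le_trans Pc)//.
rewrite -!mulrA ler_wpM2l// mulrA.
have f0 : 0 < n.+1`!%:R :> R by rewrite ltr0n fact_gt0.
rewrite (le_trans _ (ler_wpM2l _ es))//; last first.
  by rewrite divr_ge0// ltW.
rewrite le_eqVlt; apply/orP; left; apply/eqP; rewrite exprS.
by field; rewrite !gt_eqF.
Qed.

Lemma is_derive0_sqr f C : f 0 = 0 -> (forall h, `|h| <= 1 -> `|f h| <= C * h ^+ 2) ->
  is_derive 0 (1 : R) f 0.
Proof.
move=> f0 fC.
have cf : (fun h => h^-1 *: ((f \o shift 0) (h *: (1 : R)) - f 0)) @ 0^' --> (0 : R).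
  apply/cvgrPdist_le => e e0 /=.
  have C0 : 0 < `|C| + 1 by rewrite ltr_wpDl.
  near=> h; rewrite sub0r normrN addr0 f0 subr0 /GRing.scale/= mulr1 normrM normfV.
  have h0 : h != 0 by near: h; exact: nbhs_dnbhs_neq.
  have h0' : 0 < `|h| by rewrite normr_gt0.
  have hd : `|h| < Num.min 1 (e / (`|C| + 1)).
    near: h; apply: dnbhs0_lt; by rewrite lt_min ltr01 divr_gt0.
  move: hd; rewrite lt_min => /andP[h1 he].
  rewrite ler_pdivrMl// (le_trans (fC _ (ltW h1)))//.
  rewrite -[h ^+ 2]ger0_norm ?sqr_ge0// normrX expr2 mulrA [leRHS]mulrC ler_wpM2r//.
  apply: (@le_trans _ _ ((`|C| + 1) * `|h|)).
    by rewrite ler_wpM2r// (le_trans (ler_norm _))// lerDl.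
  by rewrite mulrC -ler_pdivlMr// ltW.
split; first by apply/cvg_ex; exists 0.
exact: (cvg_lim _ cf).
Unshelve. all: by end_near.
Qed.

(** The derivative of P(1/t) exp(-1/t) is t^-2 (P - P')(1/t) exp(-1/t), again of the same form; at
    the origin the function is O(h^2). *)
Lemma is_derive_eta (P : {poly R}) t :
  is_derive t 1 (eta P) (eta ('X^2 * (P - P^`())) t).
Proof.
have [t0|t0|->] := ltgtP t 0.
- rewrite {2}/eta ltNge (ltW t0)/=.
  apply: (@near_eq_is_derive _ _ _ (cst 0)).
  near=> s; rewrite /eta ltNge (_ : s <= 0)//.
  by apply: ltW; near: s; exact: lt_nbhsl.
- rewrite {2}/eta t0.
  apply: (@near_eq_is_derive _ _ _ (fun s => P.[s^-1] * expR (- s^-1))).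
    near=> s; rewrite /eta (_ : 0 < s)//.
    by near: s; exact: lt_nbhsr.
  have tn0 : t != 0 by rewrite gt_eqF.
  have dV : is_derive t (1 : R) (fun y : R => y^-1) (- t ^- 2).
    by have := @is_deriveV R id t 1 1 tn0 (is_derive_id _ _); rewrite /GRing.scale/= mulr1.
  have d1 := @is_derive1_comp _ (horner P) (fun y : R => y^-1) t _ _ (is_derive_poly _ _) dV.
  have dN : is_derive t (1 : R) (fun y : R => - y^-1) (t ^- 2).
    by have := @is_deriveN _ _ _ (fun y : R => y^-1) t 1 _ dV; rewrite opprK.
  have d2 := @is_derive1_comp _ expR (fun y : R => - y^-1) t _ _ (is_derive_expR _) dN.
  have := @is_deriveM _ _ _ _ t 1 _ _ d1 d2.
  move=> dd; refine (@is_derive_eq _ _ _ _ _ _ _ _ dd _).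
  rewrite /GRing.scale/= hornerM hornerXn hornerD hornerN exprVn.
  by ring.
- rewrite {2}/eta ltxx.
  (* The extra factor ['X] turns the decay [C / s] at [s = h^-1] into the bound [C * h ^+ 2] for
     [eta P h]. *)
  have [C hC] := horner_le_expR ('X * P).
  apply: (@is_derive0_sqr _ C); first by rewrite /eta ltxx.
  move=> h h1; rewrite /eta; case: ifPn => h0; last first.
    have C0 : 0 <= C.
      by rewrite -[C]divr1 (le_trans _ (hC 1 (lexx _)))// mulr_ge0// expR_ge0.
    by rewrite normr0 mulr_ge0// sqr_ge0.
  rewrite ger0_norm// in h1; last exact: ltW.
  have := hC h^-1; rewrite invf_cp1// => /(_ h1).
  rewrite hornerM hornerX normrM invrK ger0_norm ?invr_ge0 ?(ltW h0)//.
  rewrite normrM [`|expR _|]ger0_norm ?expR_ge0// => hh.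
  rewrite expr2 mulrA; rewrite -ler_pdivrMr//; apply: le_trans hh.
  by rewrite mulrC mulrA.
Unshelve. all: by end_near.
Qed.

Lemma smooth1_eta P : smooth1 (eta P).
Proof.
move=> n; elim: n P => //= n IH P.
by exists (eta ('X^2 * (P - P^`()))) => // t; exact: is_derive_eta.
Qed.

Definition bump t : R := eta 1 (1 + t) * eta 1 (1 - t).

Lemma smooth1_bump : smooth1 bump.
Proof.
move=> n; apply: CnM.
  rewrite (_ : (fun t => _) = fun t => eta 1 (1 * t + 1)).
    by apply: Cn_affine; exact: smooth1_eta.
  by apply/funext => t; rewrite mul1r addrC.
rewrite (_ : (fun t => _) = fun t => eta 1 ((-1) * t + 1)).
  by apply: Cn_affine; exact: smooth1_eta.
by apply/funext => t; rewrite mulN1r addrC.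
Qed.

Lemma eta1_01 t : 0 <= eta 1 t <= 1.
Proof.
rewrite /eta; case: ifPn => t0; last by rewrite lexx ler01.
by rewrite hornerC mul1r expR_ge0/= expR_le1 oppr_le0 invr_ge0 ltW.
Qed.

Lemma bump_ge0 t : 0 <= bump t.
Proof. by rewrite mulr_ge0//; have /andP[] := eta1_01 (1 + t); have /andP[] := eta1_01 (1 - t). Qed.

Lemma bump_le1 t : bump t <= 1.
Proof.
have /andP[a0 a1] := eta1_01 (1 + t); have /andP[b0 b1] := eta1_01 (1 - t).
by rewrite mulr_ile1.
Qed.

Lemma bump_eq0 t : 1 <= `|t| -> bump t = 0.
Proof.
rewrite ler_normr /bump /eta => /orP[] t1.
  by rewrite [0 < 1 - t]ltNge subr_le0 t1 mulr0.
by rewrite ltNge -lerBrDl sub0r lerNr t1 mul0r.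
Qed.

(** For [|t| <= 1/2] both factors of [bump t] have exponent at least -2. *)
Definition bump_c : R := expR (- 4).

Lemma bump_c_gt0 : 0 < bump_c. Proof. exact: expR_gt0. Qed.

Lemma bump_ge t : `|t| <= 2^-1 -> bump_c <= bump t.
Proof.
rewrite ler_norml => /andP[t1 t2]; rewrite /bump /eta.
have h1 : 2^-1 <= 1 + t by lra.
have h2 : 2^-1 <= 1 - t by lra.
have h3 : 0 < 1 + t by lra.
have h4 : 0 < 1 - t by lra.
rewrite h3 h4 !hornerC !mul1r -expRD /bump_c ler_expR.
have i1 : (1 + t)^-1 <= 2 by rewrite invf_ple// posrE.
have i2 : (1 - t)^-1 <= 2 by rewrite invf_ple// posrE.
lra.
Qed.

End smooth_functions_of_one_variable.

(** * Bounds and second-order Taylor estimates for compactly supported functions *)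

Section bumps.
Context {R : realType}.
Implicit Types (f g b : R -> R) (t s h r M : R).

Lemma is_derive_continuous f g :
  (forall t, is_derive t (1 : R) f (g t)) -> continuous f.
Proof.
move=> fg t; apply/differentiable_continuous/derivable1_diffP.
by have [] := fg t.
Qed.

Lemma MVT_point f g : (forall t, is_derive t (1 : R) f (g t)) ->
  forall s t, exists2 c, `|c - s| <= `|t - s| & f t - f s = g c * (t - s).
Proof.
move=> fg s t; have cf := is_derive_continuous fg.
have [st|ts] := leP s t.
  have [c] := MVT_segment st (fun x _ => fg x) (continuous_subspaceT cf).
  rewrite in_itv/= => /andP[sc ct] fE; exists c => //.
  by rewrite !ger0_norm ?subr_ge0// lerD2r.
have [c] := MVT_segment (ltW ts) (fun x _ => fg x) (continuous_subspaceT cf).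
rewrite in_itv/= => /andP[tc cs] fE; exists c.
  by rewrite !ler0_norm ?subr_le0 ?(ltW ts)// !opprB lerD2l lerN2.
by rewrite -[LHS]opprB fE -mulrN opprB.
Qed.

Lemma compact_support_bounded f r : continuous f ->
  (forall t, r <= `|t| -> f t = 0) -> exists2 M, 0 <= M & forall t, `|f t| <= M.
Proof.
move=> cf fr.
have rr : - `|r| <= `|r| by rewrite lerNl (le_trans _ (normr_ge0 _))// oppr_le0.
have cn : {within `[- `|r|, `|r|], continuous (fun t => `|f t|)}.
  by apply: continuous_subspaceT => t; apply: cvg_norm; exact: cf.
have [c _ hc] := EVT_max rr cn; exists `|f c| => // t.
have [tr|rt] := leP `|t| `|r|; first by apply: hc; rewrite in_itv/= -ler_norml.
by rewrite fr ?normr0// (le_trans (ler_norm _))// ltW.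
Qed.

(** All that is later needed of a cutoff. [b2] stands for its second derivative, and no first
    derivative appears. A single [M], at least 1 so that its powers increase, serves every
    estimate. *)
Record is_bump b b2 r M : Prop := IsBump {
  bump_M : 1 <= M ;
  bump_mfun : measurable_fun setT b ;
  bump_mfun2 : measurable_fun setT b2 ;
  bump_bound : forall t, `|b t| <= M ;
  bump_bound2 : forall t, `|b2 t| <= M ;
  bump_out : forall t, r <= `|t| -> b t = 0 ;
  bump_out2 : forall t, r <= `|t| -> b2 t = 0 ;
  bump_lip : forall s t, `|b t - b s| <= M * `|t - s| ;
  bump_taylor : forall t h,
    `|b (t + h) + b (t - h) - 2 * b t - h ^+ 2 * b2 t| <= M * `|h| ^+ 3 }.

Lemma derive_support f g r : (forall t, is_derive t (1 : R) f (g t)) ->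
  (forall t, r <= `|t| -> f t = 0) -> forall t, r + 1 <= `|t| -> g t = 0.
Proof.
move=> fg fr t rt.
have d0 : is_derive t (1 : R) f 0.
  apply: (@near_eq_is_derive _ _ _ (cst (0 : R))).
  near=> s; rewrite fr//.
  have : `|t - s| < 1 by near: s; exact: (@nbhsx_ballx _ R t 1).
  move=> ts; have := ler_normD (t - s) s; rewrite subrK; lra.
by rewrite -(@derive_val _ _ _ _ _ _ _ (fg t)) (@derive_val _ _ _ _ _ _ _ d0).
Unshelve. all: by end_near.
Qed.

(** The remainder, as a function [G] of the step, vanishes at 0 and has a derivative of quadratic
    size; the mean value theorem supplies the third power. *)
Lemma second_difference f f1 f2 f3 M :
  (forall t, is_derive t (1 : R) f (f1 t)) ->
  (forall t, is_derive t (1 : R) f1 (f2 t)) ->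
  (forall t, is_derive t (1 : R) f2 (f3 t)) ->
  (forall t, `|f3 t| <= M) -> forall t h,
  `|f (t + h) + f (t - h) - 2 * f t - h ^+ 2 * f2 t| <= 2 * M * `|h| ^+ 3.
Proof.
move=> d1 d2 d3 fM t h.
have T1 s : `|f1 (t + s) - f1 t - s * f2 t| <= M * `|s| ^+ 2.
  have [c cs] := MVT_point d2 t (t + s).
  rewrite (_ : t + s - t = s) in cs *; last by ring.
  move=> ->; have [c' _ E] := MVT_point d3 t c.
  rewrite mulrC -mulrBr E !normrM mulrCA expr2 ler_pM// ?mulr_ge0//.
  by rewrite mulrC ler_pM.
pose G s := f (t + s) + f (t - s) - 2 * f t - s ^+ 2 * f2 t.
pose G1 s := f1 (t + s) - f1 (t - s) - 2 * s * f2 t.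
have dG s : is_derive s (1 : R) G (G1 s).
  have e1 : is_derive s (1 : R) (fun s => f (1 * s + t)) (1 * f1 (1 * s + t)).
    exact: is_derive_affine.
  have e2 : is_derive s (1 : R) (fun s => f ((-1) * s + t)) ((-1) * f1 ((-1) * s + t)).
    exact: is_derive_affine.
  have e3 : is_derive s (1 : R) (fun s : R => s ^+ 2) (2 * s).
    have := @is_deriveX _ _ (@id R) 2 s 1 1 (is_derive_id _ _).
    by rewrite /GRing.scale/= mulr1 expr1.
  have e4 := @is_deriveM _ _ _ (cst (f2 t)) s 1 _ _ e3 (is_derive_cst _ _ _).
  have e5 := @is_deriveB _ _ _ _ _ s 1 _ _
    (@is_deriveB _ _ _ _ _ s 1 _ _ (@is_deriveD _ _ _ _ _ s 1 _ _ e1 e2)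
      (is_derive_cst (2 * f t) s 1)) e4.
  have GE : G = (fun s => f (1 * s + t)) + (fun s => f ((-1) * s + t)) - cst (2 * f t)
      - (fun s => s ^+ 2) * cst (f2 t).
    apply/funext => x; rewrite /G !fctE/= mul1r mulN1r ![_ + t]addrC.
    by rewrite mulrC.
  rewrite GE; refine (@is_derive_eq _ _ _ _ _ _ _ _ e5 _).
  rewrite /G1 /GRing.scale/= !mul1r !mulN1r ![_ + t]addrC.
  by ring.
have [c ch] := MVT_point dG 0 h; rewrite !subr0 in ch *.
have -> : G 0 = 0 by rewrite /G addr0 subr0 expr0n/= mul0r; ring.
rewrite subr0 -/(G h) => ->; rewrite normrM exprSr mulrA ler_wpM2r//.
(* Two first-order Taylor remainders of [f1], at [c] and at [- c]; hence the factor 2 in the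
   bound. *)
have -> : G1 c = (f1 (t + c) - f1 t - c * f2 t) - (f1 (t + - c) - f1 t - (- c) * f2 t).
  by rewrite /G1; ring.
have T1c := T1 (- c); rewrite normrN in T1c.
rewrite (le_trans (ler_normB _ _))// (le_trans (lerD (T1 c) T1c))//.
have M0 : 0 <= M by rewrite (le_trans _ (fM 0)).
have ch2 : `|c| ^+ 2 <= `|h| ^+ 2 by rewrite ler_pXn2r// nnegrE.
by have := ler_wpM2l M0 ch2; lra.
Qed.

Lemma smooth1_is_bump f f1 f2 r : smooth1 f ->
  (forall t, is_derive t (1 : R) f (f1 t)) ->
  (forall t, is_derive t (1 : R) f1 (f2 t)) ->
  (forall t, r <= `|t| -> f t = 0) -> exists M, is_bump f f2 (r + 2) M.
Proof.
move=> sf d1 d2 fr.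
have uniq g g1 g2 : (forall t, is_derive t (1 : R) g (g1 t)) ->
    (forall t, is_derive t (1 : R) g (g2 t)) -> g1 = g2.
  move=> h1 h2; apply/funext => t.
  by rewrite -(@derive_val _ _ _ _ _ _ _ (h1 t)) (@derive_val _ _ _ _ _ _ _ (h2 t)).
have [f1' d1' sf1] := smooth1_derive sf.
rewrite -(uniq _ _ _ d1 d1') in sf1 * => {f1' d1'}.
have [f2' d2' sf2] := smooth1_derive sf1.
rewrite -(uniq _ _ _ d2 d2') in sf2 * => {f2' d2'}.
have [f3 d3 sf3] := smooth1_derive sf2.
have [f4 d4 _] := smooth1_derive sf3.
have f1r := derive_support d1 fr; have f2r := derive_support d2 f1r.
have f3r := derive_support d3 f2r.
have c0 := is_derive_continuous d1; have c1 := is_derive_continuous d2.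
have c2 := is_derive_continuous d3; have c3 := is_derive_continuous d4.
have [M0 M00 hM0] := compact_support_bounded c0 fr.
have [M1 M10 hM1] := compact_support_bounded c1 f1r.
have [M2 M20 hM2] := compact_support_bounded c2 f2r.
have [M3 M30 hM3] := compact_support_bounded c3 f3r.
exists (1 + M0 + M1 + M2 + 2 * M3); split.
- lra.
- exact: continuous_measurable_fun.
- exact: continuous_measurable_fun.
- by move=> t; have := hM0 t; lra.
- by move=> t; have := hM2 t; lra.
- by move=> t rt; apply: fr; lra.
- by move=> t rt; apply: f2r; lra.
- move=> s t; have [c _ ->] := MVT_point d1 s t.
  by rewrite normrM ler_wpM2r//; have := hM1 c; lra.
- move=> t h; apply: (le_trans (second_difference d1 d2 d3 hM3 t h)).
  by rewrite ler_wpM2r ?exprn_ge0//; lra.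
Qed.

End bumps.

(** * Products of one-variable functions as test functions; second differences *)

Section tensor_products.
Context {R : realType} {N : nat}.
Local Notation V := 'rV[R]_N.
Implicit Types (x y z : V) (h r M : R) (i j : 'I_N) (f : V -> R).

Definition tensf (B : 'I_N -> R -> R) : V -> R := fun x => \prod_i B i (x ord0 i).
Definition updf (B : 'I_N -> R -> R) i (g : R -> R) : 'I_N -> R -> R :=
  fun j => if j == i then g else B j.

Lemma coordE x h i j : (x + h *: e_ i) ord0 j = x ord0 j + h * (j == i)%:R.
Proof. by rewrite !mxE eqxx. Qed.

Lemma tensf_upd B i g x :
  tensf (updf B i g) x = g (x ord0 i) * \prod_(j | j != i) B j (x ord0 j).
Proof.
rewrite /tensf (bigD1 i)//= /updf eqxx; congr (_ * _).
by apply: eq_bigr => j /negbTE ->.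
Qed.

Lemma tensf_shift B i h x : tensf B (x + h *: e_ i) =
  B i (x ord0 i + h) * \prod_(j | j != i) B j (x ord0 j).
Proof.
rewrite /tensf (bigD1 i)//= coordE eqxx mulr1; congr (_ * _).
by apply: eq_bigr => j /negbTE ji; rewrite coordE ji mulr0 addr0.
Qed.

Lemma tensfD1 B i x : tensf B x = B i (x ord0 i) * \prod_(j | j != i) B j (x ord0 j).
Proof. by rewrite /tensf (bigD1 i). Qed.

Lemma is_derive_tensf B i g x : (forall t, is_derive t (1 : R) (B i) (g t)) ->
  is_derive x (e_ i) (tensf B) (tensf (updf B i g) x).
Proof.
move=> dB; rewrite tensf_upd; set c := \prod_(j | _) _.
have d1 : is_derive (0 : R) (1 : R) (fun h => c * B i (1 * h + x ord0 i)) (c * g (x ord0 i)).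
  have d2 : is_derive (0 : R) (1 : R) (fun h => B i (1 * h + x ord0 i))
      (1 * g (1 * 0 + x ord0 i)) by exact: is_derive_affine.
  rewrite mul1r mulr0 add0r in d2.
  exact: (@is_deriveZ _ _ _ (fun h => B i (1 * h + x ord0 i)) c 0 1 _ d2).
have E : (fun h : R => tensf B (h *: e_ i + x)) = (fun h => c * B i (1 * h + x ord0 i)).
  by apply/funext => h; rewrite addrC tensf_shift mulrC mul1r addrC.
have [dd1 dd2] := d1.
split; first by apply/derivable1P; rewrite E.
rewrite mulrC -dd2 -E /derive.
set g1 := fun h => h^-1 *: _; set g2 := fun h => h^-1 *: _; suff -> : g1 = g2 by [].
by apply/funext => h; rewrite /g1 /g2 /= addr0 scale0r add0r [_%:A]mulr1.
Qed.

(** A partial derivative only replaces one factor by its derivative, so smoothness in N variables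
    reduces to one variable. *)
Lemma iter_partial_tensf s B : (forall i, smooth1 (B i)) ->
  exists2 B', (forall i, smooth1 (B' i)) & iter_partial s (tensf B) = tensf B'.
Proof.
move=> sB; elim: s => [|i s [B' sB' E]] /=; first by exists B.
have [g dg sg] := smooth1_derive (sB' i).
exists (updf B' i g).
  by move=> j; rewrite /updf; case: ifP => // _.
apply/funext => x; rewrite [iter_partial s _]E.
by have [_ ->] := is_derive_tensf x dg.
Qed.

Lemma iter_partial2_tensf i B g g' : 
  (forall t, is_derive t (1 : R) (B i) (g t)) ->
  (forall t, is_derive t (1 : R) g (g' t)) ->
  iter_partial [:: i; i] (tensf B) = tensf (updf B i g').
Proof.
move=> dB dg; rewrite /iter_partial/=.
have -> : (fun x => 'D_(e_ i) (tensf B) x) = tensf (updf B i g).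
  by apply/funext => x; by have [_ ->] := is_derive_tensf x dB.
apply/funext => x.
have dg' : forall t, is_derive t (1 : R) (updf B i g i) (g' t).
  by move=> t; rewrite /updf eqxx.
have [_ ->] := is_derive_tensf x dg'.
by rewrite !tensf_upd; congr (_ * _); apply: eq_bigr => j ji; rewrite /updf (negbTE ji).
Qed.

Lemma continuous_tensf B : (forall i, continuous (B i)) -> continuous (tensf B).
Proof.
move=> cB x; rewrite /tensf.
apply: (@cvg_big _ _ (@GRing.mul R) 1 xpredT (@mul_continuous R) _ (nbhs x)
  (index_enum _) (fun i (y : V) => B i (y ord0 i)) (fun i => B i (x ord0 i))
  (nbhs_filter x)) => i _.
by apply: (@continuous_comp _ _ _ (fun x : V => x ord0 i) (B i)); [exact: coord_continuous|exact: cB].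
Qed.

Lemma compact_box r : compact (box r : set V).
Proof.
rewrite (_ : box r = [set v : V | forall i, `[- r, r]%classic (v ord0 i)]).
  by apply: (@rV_compact _ N (fun=> `[- r, r]%classic)) => i; exact: segment_compact.
by apply/seteqP; split => x /= h i; have := h i; rewrite /= ?in_itv/= ler_norml.
Qed.

Lemma closed_box r : closed (box r : set V).
Proof.
rewrite (_ : box r = \bigcap_(i in setT) (fun x : V => x ord0 i) @^-1` `[- r, r]%classic).
  apply: closed_bigI => i _; apply: closed_comp; last exact: interval_closed.
  by move=> x _; exact: coord_continuous.
apply/seteqP; split => x /=.
  by move=> h i _ /=; have := h i; rewrite /= ?in_itv/= ler_norml.
by move=> h i; have := h i I; rewrite /= in_itv/= ler_norml.
Qed.

Lemma test_function_tensf B r : (forall i, smooth1 (B i)) ->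
  (forall i t, r <= `|t| -> B i t = 0) -> test_function (tensf B).
Proof.
move=> sB Br; split.
  move=> s; have [B' sB' ->] := iter_partial_tensf s sB; split.
    apply: continuous_tensf => i; have [g dg _] := smooth1_derive (sB' i).
    exact: is_derive_continuous dg.
  move=> i x; have [g dg _] := smooth1_derive (sB' i).
  by have [] := is_derive_tensf x dg.
apply: (subclosed_compact _ (@compact_box r)); first exact: closed_closure.
rewrite [X in _ `<=` X](_ : _ = closure (box r)); last first.
  by apply/closure_id; exact: closed_box.
apply: closureS => x /= /eqP tx0 i.
rewrite leNgt; apply/negP => /ltW ri; apply: tx0.
by rewrite (tensfD1 _ i) Br// mul0r.
Qed.

Lemma laplacian_tensf B B2 : (forall i, exists2 g,
    (forall t, is_derive t (1 : R) (B i) (g t)) &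
    (forall t, is_derive t (1 : R) g (B2 i t))) ->
  laplacian (tensf B) = fun x => \sum_i tensf (updf B i (B2 i)) x.
Proof.
move=> dB; apply/funext => x; apply: eq_bigr => i _.
have [g d1 d2] := dB i.
by rewrite (iter_partial2_tensf d1 d2).
Qed.

Definition tens b : V -> R := tensf (fun=> b).
Definition tens2 b b2 : V -> R := fun x => \sum_i tensf (updf (fun=> b) i b2) x.

(* Second differences stand in for second derivatives throughout: they apply to *)
(* mollified functions without having to differentiate under the integral sign. *)
Definition sdiff h i f x : R := f (x + h *: e_ i) + f (x - h *: e_ i) - 2 * f x.
Definition dlap h f x : R := \sum_i sdiff h i f x.

Lemma normr_prod_le (P : pred 'I_N) (F : 'I_N -> R) M : 1 <= M ->
  (forall i, `|F i| <= M) -> `|\prod_(i | P i) F i| <= M ^+ N.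
Proof.
move=> M1 FM; have M0 : 0 <= M by exact: le_trans M1.
rewrite normr_prod (le_trans (y := \prod_(i | P i) M))//.
  by apply: ler_prod => i _; rewrite normr_ge0 FM.
rewrite prodr_const; apply: ler_weXn2l => //.
by rewrite -[X in (_ <= X)%N]card_ord max_card.
Qed.

(** Telescoping: the factors are exchanged one at a time. *)
Lemma prod_lip (s : seq 'I_N) (F G : 'I_N -> R) M : 1 <= M ->
  (forall i, `|F i| <= M) -> (forall i, `|G i| <= M) ->
  `|\prod_(i <- s) F i - \prod_(i <- s) G i| <=
    M ^+ size s * \sum_(i <- s) `|F i - G i|.
Proof.
move=> M1 FM GM; have M0 : 0 <= M by exact: le_trans M1.
elim: s => [|i s IH]; first by rewrite !big_nil subrr normr0 mulr0.
rewrite !big_cons /=.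
have -> : F i * \prod_(j <- s) F j - G i * \prod_(j <- s) G j =
  (F i - G i) * \prod_(j <- s) F j + G i * (\prod_(j <- s) F j - \prod_(j <- s) G j).
  by ring.
rewrite (le_trans (ler_normD _ _))// !normrM mulrDr; apply: lerD.
  rewrite mulrC ler_wpM2r// normr_prod.
  rewrite (le_trans (y := M ^+ size s))//; last first.
    by apply: ler_weXn2l.
  elim: (s) => [|j s' IH']; first by rewrite big_nil expr0.
  by rewrite big_cons /= exprS ler_pM// -normr_prod.
rewrite exprS -mulrA ler_pM//.
Qed.

Section with_bump.
Variables (b b2 : R -> R) (r M : R).
Hypothesis bb : is_bump b b2 r M.

Let M1 : 1 <= M := bump_M bb.
Let M0 : 0 <= M. Proof. exact: le_trans (bump_M bb). Qed.

Lemma mfun_tensf B : (forall i, measurable_fun setT (B i)) -> mfun_rV (tensf B).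
Proof.
move=> mB; rewrite /mfun_rV /tensf; elim: (index_enum _) => [|i s IH].
  rewrite (_ : (fun x => _) = fun=> 1); first exact: measurable_cst.
  by apply/funext => x; rewrite big_nil.
rewrite (_ : (fun x => _) = fun x : V => B i (x ord0 i) * \prod_(j <- s) B j (x ord0 j)).
  apply: measurable_funM => //; apply: (measurableT_comp (mB i)).
  exact: measurable_coord_rV.
by apply/funext => x; rewrite big_cons.
Qed.

Lemma mfun_tens : mfun_rV (tens b).
Proof. by apply: mfun_tensf => i; exact: bump_mfun bb. Qed.

Lemma mfun_tens2 : mfun_rV (tens2 b b2).
Proof.
rewrite /mfun_rV /tens2; elim: (index_enum _) => [|i s IH].
  rewrite (_ : (fun x => _) = fun=> 0); first exact: measurable_cst.
  by apply/funext => x; rewrite big_nil.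
rewrite (_ : (fun x => _) = fun x : V => tensf (updf (fun=> b) i b2) x +
    \sum_(j <- s) tensf (updf (fun=> b) j b2) x).
  apply: measurable_funD => //; apply: mfun_tensf => j; rewrite /updf.
  by case: ifP => _; [exact: bump_mfun2 bb|exact: bump_mfun bb].
by apply/funext => x; rewrite big_cons.
Qed.

Lemma not_in_box x s : ~ (forall i, `|x ord0 i| <= s) -> exists i, s < `|x ord0 i|.
Proof.
move=> /existsNP[i /negP]; rewrite -ltNge => h; by exists i.
Qed.

Lemma tens_bound x : `|tens b x| <= M ^+ N * bx r x.
Proof.
case: (bxP r x) => [_|/not_in_box[i ri]].
  by rewrite mulr1 normr_prod_le// => i; exact: bump_bound bb _.
by rewrite /tens (tensfD1 _ i) (bump_out bb) ?mul0r ?normr0 ?mulr0// ltW.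
Qed.

Lemma tens2_bound x : `|tens2 b b2 x| <= (N%:R * M ^+ N) * bx r x.
Proof.
case: (bxP r x) => [_|/not_in_box[i ri]].
  rewrite mulr1 (le_trans (ler_norm_sum _ _ _))//.
  rewrite (le_trans (y := \sum_(i < N) M ^+ N))//; last first.
    by rewrite sumr_const card_ord mulr_natl.
  apply: ler_sum => i _; apply: normr_prod_le => // j; rewrite /updf.
  by case: ifP => _; [exact: bump_bound2 bb _|exact: bump_bound bb _].
rewrite mulr0 /tens2 big1 ?normr0// => j _.
rewrite (tensfD1 _ i) /updf; case: ifP => _.
  by rewrite (bump_out2 bb) ?mul0r// ltW.
by rewrite (bump_out bb) ?mul0r// ltW.
Qed.

(** In each direction the second difference acts on one factor only. The radius grows by 1 because a
    step [|h| <= 1] from outside [box (r + 1)] stays outside the support. *)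
Lemma tens_taylor h x : `|h| <= 1 ->
  `|dlap h (tens b) x - h ^+ 2 * tens2 b b2 x| <=
  (N%:R * M ^+ N.+1) * `|h| ^+ 3 * bx (r + 1) x.
Proof.
move=> h1; rewrite /dlap /tens2 mulr_sumr -sumrB.
have E i : sdiff h i (tens b) x - h ^+ 2 * tensf (updf (fun=> b) i b2) x =
    (b (x ord0 i + h) + b (x ord0 i - h) - 2 * b (x ord0 i) - h ^+ 2 * b2 (x ord0 i))
    * \prod_(j | j != i) b (x ord0 j).
  rewrite /sdiff /tens -scaleNr !tensf_shift tensf_upd (tensfD1 _ i).
  by ring.
case: (bxP (r + 1) x) => [_|/not_in_box[k rk]].
  rewrite mulr1 (le_trans (ler_norm_sum _ _ _))//.
  rewrite (le_trans (y := \sum_(i < N) M ^+ N.+1 * `|h| ^+ 3))//; last first.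
    by rewrite sumr_const card_ord -mulrA mulr_natl.
  apply: ler_sum => i _; rewrite E normrM [M ^+ N.+1]exprS [leRHS]mulrAC.
  apply: ler_pM => //; first exact: bump_taylor bb _ _.
  by apply: normr_prod_le => // j; exact: bump_bound bb _.
rewrite mulr0 big1 ?normr0// => i _; rewrite E.
have [->|ki] := eqVneq i k; last first.
  rewrite (bigD1 k)/=; last by rewrite eq_sym.
  have rk' : r <= `|x ord0 k| by lra.
  by rewrite (bump_out bb rk') mul0r mulr0.
have r1 : r <= `|x ord0 k + h|.
  have := ler_normD (x ord0 k + h) (- h); rewrite addrK normrN; lra.
have r2 : r <= `|x ord0 k - h|.
  have := ler_normD (x ord0 k - h) h; rewrite subrK; lra.
have r3 : r <= `|x ord0 k| by lra.
rewrite (bump_out bb r1) (bump_out bb r2) (bump_out bb r3) (bump_out2 bb r3).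
by rewrite !mulr0 addr0 !subr0 mul0r.
Qed.

Lemma tens_lip x z s : (forall i, `|z ord0 i| <= s) ->
  `|tens b (x + z) - tens b x| <=
    (M ^+ N * M) * (\sum_i `|z ord0 i|) * bx (r + s) x.
Proof.
move=> zs; case: (bxP (r + s) x) => [_|/not_in_box[i ri]].
  rewrite mulr1 /tens /tensf.
  have := @prod_lip (index_enum _) (fun i => b ((x + z) ord0 i))
    (fun i => b (x ord0 i)) M M1 (fun i => bump_bound bb _) (fun i => bump_bound bb _).
  have -> : size (index_enum 'I_N) = N by rewrite /index_enum unlock -enumT size_enum_ord.
  move=> h; apply: (le_trans h); rewrite -mulrA ler_wpM2l ?exprn_ge0//.
  rewrite mulr_sumr; apply: ler_sum => i _.
  apply: (le_trans (bump_lip bb _ _)).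
  by rewrite mxE [_ + _ - _]addrAC subrr add0r.
have s0 : 0 <= s by exact: le_trans (zs i).
have r1 : r <= `|x ord0 i| by lra.
have r2 : r <= `|(x + z) ord0 i|.
  have := ler_normD ((x + z) ord0 i) (- z ord0 i).
  rewrite [in X in X <= _]mxE addrK normrN; have := zs i; lra.
by rewrite /tens !(tensfD1 _ i) (bump_out bb r1) (bump_out bb r2) !mul0r subrr normr0 mulr0.
Qed.

End with_bump.

End tensor_products.

(** * Mollifiers and regularity of mollified functions *)

Section mollification.
Context {R : realType} {N : nat}.
Local Notation V := 'rV[R]_N.
Local Notation mu := (lebesgue_rV R N).
Implicit Types (f g u k : V -> R) (x y z : V) (r e M C h s : R) (i : 'I_N).

Definition bump1 : R -> R := fun t => 'D_1 bump t.
Definition bump2 : R -> R := fun t => 'D_1 bump1 t.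
Definition be e t : R := bump (e^-1 * t).
Definition be2 e t : R := e^-1 ^+ 2 * bump2 (e^-1 * t).

Lemma is_derive_bump t : is_derive t (1 : R) bump (bump1 t).
Proof.
have [g dg _] := smooth1_derive (@smooth1_bump R).
by have [? _] := dg t; split.
Qed.

Lemma is_derive_bump1 t : is_derive t (1 : R) bump1 (bump2 t).
Proof.
have [g dg sg] := smooth1_derive (@smooth1_bump R).
have -> : bump1 = g by apply/funext => s; have [_ <-] := dg s.
have [g' dg' _] := smooth1_derive sg; have [? _] := dg' t; split => //.
rewrite /bump2 (_ : bump1 = g)//.
by apply/funext => s; have [_ <-] := dg s.
Qed.

Lemma is_derive_be_affine e c : exists2 g : R -> R,
  (forall t, is_derive t (1 : R) (fun t => bump (e^-1 * t + c)) (g t)) &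
  (forall t, is_derive t (1 : R) g (e^-1 ^+ 2 * bump2 (e^-1 * t + c))).
Proof.
exists (fun t => e^-1 * bump1 (e^-1 * t + c)) => s.
  by apply: is_derive_affine; exact: is_derive_bump.
rewrite expr2 -mulrA.
apply: (@is_deriveZ _ _ _ (fun t => bump1 (e^-1 * t + c)) _ s 1).
by apply: is_derive_affine; exact: is_derive_bump1.
Qed.

Lemma be_out e t : 0 < e -> e <= `|t| -> be e t = 0.
Proof.
move=> e0 et; rewrite /be bump_eq0// normrM ger0_norm ?invr_ge0 ?(ltW e0)//.
by rewrite ler_pdivlMl// mulr1.
Qed.

Lemma be_bump e : 0 < e -> exists M, is_bump (be e) (be2 e) (e + 2) M.
Proof.
move=> e0; have [g d1 d2] := is_derive_be_affine e 0.
have E : (fun t => bump (e^-1 * t + 0)) = be e by apply/funext => t; rewrite addr0.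
rewrite E in d1.
have d2' t : is_derive t (1 : R) g (be2 e t) by rewrite /be2 -[e^-1 * t]addr0; exact: d2.
have sb : smooth1 (be e).
  by rewrite -E => n; apply: Cn_affine; exact: smooth1_bump.
exact: (smooth1_is_bump sb d1 d2' (fun t => @be_out e t e0)).
Qed.

Definition rho e : V -> R := tens (be e).
Definition rho2 e : V -> R := tens2 (be e) (be2 e).
Definition mass e : R := intR (rho e).

Lemma rho_ge0 e x : 0 <= rho e x.
Proof. by apply: prodr_ge0 => i _; exact: bump_ge0. Qed.

Lemma rho_le1 e x : rho e x <= 1.
Proof.
apply: (@le_trans _ _ (\prod_(i < N) 1)); last by rewrite big1_eq.
by apply: ler_prod => i _; rewrite bump_ge0 bump_le1.
Qed.

Lemma rho_out e x : 0 < e -> rho e x != 0 -> forall i, `|x ord0 i| <= e.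
Proof.
move=> e0 /eqP rx i; rewrite leNgt; apply/negP => /ltW ei; apply: rx.
by rewrite /rho /tens (tensfD1 _ i) be_out ?mul0r.
Qed.

Lemma rho_bound e : 0 < e -> exists2 C, 0 <= C & forall x, `|rho e x| <= C * bx e x.
Proof.
move=> e0; exists 1 => // x; rewrite mul1r.
have [->|rx] := eqVneq (rho e x) 0; first by rewrite normr0 bx_ge0.
by rewrite bx1 ?ger0_norm ?rho_ge0 ?rho_le1//; exact: rho_out.
Qed.

Lemma mfun_rho e : 0 < e -> mfun_rV (rho e).
Proof. by move=> e0; have [M bM] := be_bump e0; exact: mfun_tens bM. Qed.

Lemma itg_rho e : 0 < e -> itg (rho e).
Proof.
move=> e0; have [C C0 rC] := rho_bound e0.
by apply: (le_itg (mfun_rho e0) rC); apply: itgZ; exact: itg_bx.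
Qed.

Lemma rho_lower e x : 0 < e -> bump_c ^+ N * bx (e / 2) x <= rho e x.
Proof.
move=> e0; case: (bxP (e / 2) x) => [h|_]; last by rewrite mulr0 rho_ge0.
rewrite mulr1 /rho /tens /tensf -[X in _ ^+ X]card_ord -prodr_const.
apply: ler_prod => i _; rewrite ltW ?bump_c_gt0//= bump_ge//.
rewrite normrM ger0_norm ?invr_ge0 ?(ltW e0)//.
by rewrite ler_pdivrMl.
Qed.

Lemma mass_gt0 e : 0 < e -> 0 < mass e.
Proof.
move=> e0; apply: (@lt_le_trans _ _ (intR (fun x : V => bump_c ^+ N * bx (e / 2) x))).
  rewrite intRZ; last exact: itg_bx.
  rewrite intR_bx ?divr_ge0// ?(ltW e0)// mulr_gt0// exprn_gt0 ?bump_c_gt0//.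
  by rewrite mulrC divfK.
apply: le_intR; [by apply: itgZ; exact: itg_bx|exact: itg_rho|].
by move=> x; exact: rho_lower.
Qed.

(** The kernel is translated but not reflected: [k (y - x)] is, as a function of [y], exactly the
    test function centred at [x]. *)
Definition conv k u x : R := intR (fun y => u y * k (y - x)).

Lemma itg_conv k u x C r : locint u -> mfun_rV k ->
  (forall y, `|k y| <= C * bx r y) -> itg (fun y => u y * k (y - x)).
Proof.
move=> lu mk kC.
have := itg_shift (- x) (locint_mul (locint_shift x lu) mk kC).
by congr itg; apply/funext => y; rewrite subrK.
Qed.

Lemma conv_shift k u x : mfun_rV k -> mfun_rV u ->
  conv k u x = intR (fun z => u (x + z) * k z).
Proof.
move=> mk mu_; rewrite /conv -(intR_shift x).
  by congr intR; apply/funext => y; rewrite addrK addrC.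
by apply: measurable_funM => //; exact: mfun_shift.
Qed.

Lemma conv_le k u x C r s : locint u -> mfun_rV k ->
  (forall y, `|k y| <= C * bx r y) -> 0 <= C -> (forall i, `|x ord0 i| <= s) ->
  `|conv k u x| <= C * intR (fun y => `|u y| * bx (r + s) y).
Proof.
move=> lu mk kC C0 xs; have I := itg_conv x lu mk kC.
rewrite (le_trans (le_norm_intR I))// -intRZ; last exact: (locint_norm lu).2.
apply: le_intR => [||y].
- exact: itg_norm.
- by apply: itgZ; exact: (locint_norm lu).2.
- rewrite normrM mulrCA ler_wpM2l// (le_trans (kC _))// ler_wpM2l//.
  rewrite -[in leRHS](subrK x y); exact: bx_shift.
Qed.

Definition mol e u x := (mass e)^-1 * conv (rho e) u x.

Lemma mol_le M e u x : 0 < e -> mfun_rV u -> (forall y, `|u y| <= M) -> `|mol e u x| <= M.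
Proof.
move=> e0 mu_ uM; have [C C0 rC] := rho_bound e0.
have m0 := mass_gt0 e0.
rewrite normrM normfV (ger0_norm (ltW m0)) ler_pdivrMl//.
rewrite conv_shift//; last exact: mfun_rho.
have I : itg (fun z => u (x + z) * rho e z).
  have := locint_mul (locint_shift x (locint_bounded mu_ uM)) (mfun_rho e0) rC.
  by congr itg; apply/funext => z; rewrite addrC.
rewrite (le_trans (le_norm_intR I))// mulrC -intRZ; last exact: itg_rho.
apply: le_intR; [exact: itg_norm|by apply: itgZ; exact: itg_rho|].
by move=> z; rewrite normrM (ger0_norm (rho_ge0 _ _)) ler_wpM2r ?rho_ge0.
Qed.

(** The increment is carried by the kernel, whose Lipschitz bound is integrated against [u] on one
    large cube. *)
Lemma mol_lip e u s : 0 < e -> locint u -> exists2 C, 0 <= C &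
  forall x z, (forall i, `|x ord0 i| <= s) -> (forall i, `|z ord0 i| <= 1) ->
  `|mol e u (x + z) - mol e u x| <= C * \sum_i `|z ord0 i|.
Proof.
move=> e0 lu; have m0 := mass_gt0 e0; have [M bM] := be_bump e0.
have mr := mfun_rho e0; have [C C0 rC] := rho_bound e0.
have M0 : 0 <= M by exact: le_trans (bump_M bM).
pose D := (M ^+ N * M) * intR (fun y => `|u y| * bx (e + 2 + 1 + s) y).
have D0 : 0 <= D.
  rewrite mulr_ge0 ?mulr_ge0 ?exprn_ge0// intR_ge0// => y.
  by rewrite mulr_ge0 ?bx_ge0.
exists ((mass e)^-1 * D) => [|x z xs z1].
  by rewrite mulr_ge0// invr_ge0 ltW.
rewrite /mol -mulrBr normrM normfV (ger0_norm (ltW m0)) -mulrA.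
rewrite ler_wpM2l ?invr_ge0 ?(ltW m0)//.
have -> : conv (rho e) u (x + z) - conv (rho e) u x =
    conv (fun y => rho e (y - z) - rho e y) u x.
  rewrite /conv -intRB; try exact: itg_conv rC.
  by congr intR; apply/funext => y; rewrite -mulrBr opprD addrA.
rewrite /D mulrAC.
apply: conv_le => //.
- by apply: measurable_funB => //; exact: mfun_shift.
- move=> y; apply: (le_trans (tens_lip bM y _)) => [i|].
    by rewrite mxE normrN; exact: z1.
  by under eq_bigr do rewrite mxE normrN.
- by rewrite mulr_ge0 ?mulr_ge0 ?exprn_ge0 ?sumr_ge0.
Qed.

Lemma dlap_conv k u x h C r : locint u -> mfun_rV k ->
  (forall y, `|k y| <= C * bx r y) ->
  dlap h (conv k u) x = conv (dlap h k) u x.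
Proof.
move=> lu mk kC; rewrite /dlap.
have I z : itg (fun y => u y * k (y - z)) by exact: itg_conv kC.
rewrite /conv.
transitivity (intR (fun y => \sum_i (u y * k (y - (x + h *: e_ i)) +
    u y * k (y - (x - h *: e_ i)) - 2 * (u y * k (y - x))))).
  rewrite intR_sum; last first.
    by move=> i; apply: itgB; [exact: itgD|exact: itgZ].
  apply: eq_bigr => i _; rewrite /sdiff intRB; [|exact: itgD|exact: itgZ].
  by rewrite intRD// intRZ.
congr intR; apply/funext => y; rewrite mulr_sumr; apply: eq_bigr => i _.
rewrite /sdiff !opprD !opprK !addrA.
by move: (k _) (k _) (k _) => a b c; ring.
Qed.

(** By [dlap_conv] the second difference falls on the kernel, where [tens_taylor] applies; the
    constant is uniform for [x] in a cube. *)
Lemma mol_taylor e u s : 0 < e -> locint u -> exists2 C, 0 <= C &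
  forall x h, (forall i, `|x ord0 i| <= s) -> `|h| <= 1 ->
  `|dlap h (mol e u) x - h ^+ 2 * ((mass e)^-1 * conv (rho2 e) u x)| <= C * `|h| ^+ 3.
Proof.
move=> e0 lu; have m0 := mass_gt0 e0; have [M bM] := be_bump e0.
have mr := mfun_rho e0; have [C C0 rC] := rho_bound e0.
have M0 : 0 <= M by exact: le_trans (bump_M bM).
pose K := N%:R * M ^+ N.+1.
have K0 : 0 <= K by rewrite mulr_ge0 ?exprn_ge0.
pose D := K * intR (fun y => `|u y| * bx (e + 2 + 1 + s) y).
have D0 : 0 <= D.
  rewrite mulr_ge0 ?mulr_ge0 ?exprn_ge0// intR_ge0// => y.
  by rewrite mulr_ge0 ?bx_ge0.
exists ((mass e)^-1 * D) => [|x h xs h1].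
  by rewrite mulr_ge0// invr_ge0 ltW.
have -> : dlap h (mol e u) x = (mass e)^-1 * dlap h (conv (rho e) u) x.
  by rewrite /dlap mulr_sumr; apply: eq_bigr => i _; rewrite /sdiff /mol;
    move: (conv _ _ _) (conv _ _ _) (conv _ _ _) => a b c; ring.
rewrite [h ^+ 2 * _]mulrCA -mulrBr normrM normfV (ger0_norm (ltW m0)) -[leRHS]mulrA.
rewrite ler_wpM2l ?invr_ge0 ?(ltW m0)//.
rewrite (dlap_conv x h lu mr rC).
have mr2 : mfun_rV (rho2 e) := mfun_tens2 bM.
have r2C : forall y, `|rho2 e y| <= N%:R * M ^+ N * bx (e + 2) y := tens2_bound bM.
have md : mfun_rV (dlap h (rho e)).
  rewrite /dlap; elim: (index_enum _) => [|i t IH].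
    rewrite (_ : (fun x => _) = fun=> 0); first exact: measurable_cst.
    by apply/funext => y; rewrite big_nil.
  rewrite (_ : (fun x => _) = fun y => sdiff h i (rho e) y + \sum_(j <- t) sdiff h j (rho e) y).
    apply: measurable_funD => //; apply: measurable_funB.
      by apply: measurable_funD; exact: mfun_shift.
    by apply: measurable_funM => //; exact: measurable_cst.
  by apply/funext => y; rewrite big_cons.
have dK y : `|dlap h (rho e) y - h ^+ 2 * rho2 e y| <= (K * `|h| ^+ 3) * bx (e + 2 + 1) y.
  exact: (tens_taylor bM y h1).
have m3 : mfun_rV (fun y => dlap h (rho e) y - h ^+ 2 * rho2 e y).
  apply: measurable_funB => //; apply: measurable_funM => //; exact: measurable_cst.
have dB y : `|dlap h (rho e) y| <= (K * `|h| ^+ 3 + `|h| ^+ 2 * (N%:R * M ^+ N)) * bx (e + 2 + 1) y.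
  rewrite -[dlap h _ y](subrK (h ^+ 2 * rho2 e y)) (le_trans (ler_normD _ _))// mulrDl.
  rewrite lerD// normrM normrX -[leRHS]mulrA ler_wpM2l ?exprn_ge0// (le_trans (r2C _))//.
  by rewrite ler_wpM2l ?mulr_ge0 ?exprn_ge0// le_bx// lerDl.
have -> : conv (dlap h (rho e)) u x - h ^+ 2 * conv (rho2 e) u x =
    conv (fun y => dlap h (rho e) y - h ^+ 2 * rho2 e y) u x.
  rewrite /conv -intRZ; last exact: itg_conv r2C.
  rewrite -intRB; [|exact: itg_conv dB|by apply: itgZ; exact: itg_conv r2C].
  by congr intR; apply/funext => y; ring.
rewrite /D mulrAC; apply: conv_le => //.
by rewrite mulr_ge0 ?exprn_ge0.
Qed.

(** Tonelli gives measurability of the integral for nonnegative integrands, hence the split of [u]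
    into positive and negative parts. *)
Lemma mfun_mol e u : 0 < e -> locint u -> mfun_rV (mol e u).
Proof.
move=> e0 lu; have mr := mfun_rho e0; have [C C0 rC] := rho_bound e0.
apply: measurable_funM; first exact: measurable_cst.
have pos g : locint g -> (forall x, 0 <= g x) -> mfun_rV (conv (rho e) g).
  move=> lg g0.
  have mF : measurable_fun [set: V * V] (fun p : V * V => (g p.2 * rho e (p.2 - p.1))%:E).
    apply/measurable_EFinP; apply: measurable_funM.
      by apply: (measurableT_comp lg.1); exact: measurable_snd.
    apply: (measurableT_comp mr); apply: measurable_fun_rV => i.
    rewrite (_ : (fun _ => _) = fun p : V * V => p.2 ord0 i - p.1 ord0 i); last first.
      by apply/funext => p; rewrite !mxE.
    apply: measurable_funB.
      by apply: (measurableT_comp (@measurable_coord_rV _ R N i)); exact: measurable_snd.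
    by apply: (measurableT_comp (@measurable_coord_rV _ R N i)); exact: measurable_fst.
  have F0 (p : V * V) : (0 <= (g p.2 * rho e (p.2 - p.1))%:E)%E.
    by rewrite lee_fin mulr_ge0 ?rho_ge0.
  have := @measurable_fun_fubini_tonelli_F _ _ _ _ _ mu _ mF F0.
  rewrite /fubini_F => mG.
  exact: (measurableT_comp (fine_measurable measurableT) mG).
have mp : mfun_rV (fun x => Num.max (u x) 0).
  by apply: measurable_maxr; [exact: lu.1|exact: measurable_cst].
have mn : mfun_rV (fun x => Num.max (- u x) 0).
  apply: measurable_maxr; [|exact: measurable_cst].
  by apply: measurableT_comp => //; exact: lu.1.
have lp : locint (fun x => Num.max (u x) 0).
  apply: (le_locint mp _ (locint_norm lu)) => x.
  rewrite ger0_norm ?le_max ?lexx ?orbT// ge_max normr_ge0 andbT; exact: ler_norm.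
have ln : locint (fun x => Num.max (- u x) 0).
  apply: (le_locint mn _ (locint_norm lu)) => x.
  rewrite ger0_norm ?le_max ?lexx ?orbT// ge_max normr_ge0 andbT -normrN; exact: ler_norm.
have -> : conv (rho e) u = fun x => conv (rho e) (fun x => Num.max (u x) 0) x -
    conv (rho e) (fun x => Num.max (- u x) 0) x.
  apply/funext => x; rewrite /conv -intRB; try exact: itg_conv rC.
  congr intR; apply/funext => y; rewrite -mulrBl; congr (_ * _).
  by rewrite /Num.max; case: ltP => ?; case: ltP => ?; lra.
by apply: measurable_funB; apply: pos => // x; rewrite le_max lexx orbT.
Qed.

End mollification.

(** * Convergence of mollifications in local L1; the weak equation *)

Section mollifier_convergence.
Context {R : realType} {N : nat}.
Local Notation V := 'rV[R]_N.
Local Notation mu := (lebesgue_rV R N).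
Implicit Types (f g u k : V -> R) (x y z : V) (r e d M C h s : R) (i : 'I_N).

Lemma measurable_addrV2 : measurable_fun [set: V * V] (fun p : V * V => p.1 + p.2).
Proof.
apply: measurable_fun_rV => i.
rewrite (_ : (fun _ => _) = fun p : V * V => p.1 ord0 i + p.2 ord0 i); last first.
  by apply/funext => p; rewrite !mxE.
apply: measurable_funD.
  by apply: (measurableT_comp (@measurable_coord_rV _ R N i)); exact: measurable_fst.
by apply: (measurableT_comp (@measurable_coord_rV _ R N i)); exact: measurable_snd.
Qed.

Lemma locint_mol e u : 0 < e -> locint u -> locint (mol e u).
Proof.
move=> e0 lu; have mm := mfun_mol e0 lu; split => // r.
have [C C0 rC] := rho_bound (N := N) e0.
pose K := (@mass R N e)^-1 * (C * intR (fun y : V => `|u y| * bx (e + r) y)).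
apply: (le_itg (g := fun x => K * bx r x)).
- by apply: measurable_funM => //; exact: mfun_bx.
- move=> x; case: (bxP r x) => [h|_]; last by rewrite !mulr0 normr0.
  rewrite !mulr1 /mol /K normrM normfV (ger0_norm (ltW (mass_gt0 e0))).
  rewrite ler_wpM2l ?invr_ge0 ?(ltW (mass_gt0 e0))//.
  by apply: conv_le => //; exact: mfun_rho.
- by apply: itgZ; exact: itg_bx.
Qed.

(** The error is at most an average over small [z] of [|u (x + z) - u x|]; Tonelli integrates in [x]
    first, where [locint_tcont] makes it small. *)
Lemma mol_L1 u r eta : locint u -> 0 < eta -> exists2 d, 0 < d &
  forall e, 0 < e -> e <= d ->
    intR (fun x => `|mol e u x - u x| * bx r x) <= eta.
Proof.
move=> lu eta0; have [d d0 hd] := locint_tcont lu r eta0.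
exists d => // e e0 ed.
have m0 := mass_gt0 (N := N) e0; have [C C0 rC] := rho_bound (N := N) e0.
have mr := mfun_rho (N := N) e0; have mu_ := lu.1.
have Iux x : itg (fun z => u (x + z) * rho e z).
  have := locint_mul (locint_shift x lu) mr rC.
  by congr itg; apply/funext => z; rewrite addrC.
have Iuu x : itg (fun z => `|u (x + z) - u x| * rho e z).
  have := itg_norm (itgB (Iux x) (itgZ (u x) (itg_rho e0))).
  congr itg; apply/funext => z.
  by rewrite -mulrBl normrM (ger0_norm (rho_ge0 _ _)).
have pt x : `|mol e u x - u x| <= (@mass R N e)^-1 * intR (fun z => `|u (x + z) - u x| * rho e z).
  have -> : mol e u x - u x = (@mass R N e)^-1 * intR (fun z => (u (x + z) - u x) * rho e z).
    rewrite /mol conv_shift// (_ : (fun z => (_ - _) * _) =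
        fun z => u (x + z) * rho e z - u x * rho e z); last first.
      by apply/funext => z; rewrite mulrBl.
    rewrite intRB//; last by apply: itgZ; exact: itg_rho.
    rewrite intRZ; last exact: itg_rho.
    rewrite mulrBr [X in _ = _ - X]mulrCA -/(@mass R N e) mulVf ?mulr1//.
    by rewrite gt_eqF.
  rewrite normrM normfV (ger0_norm (ltW m0)) ler_wpM2l ?invr_ge0 ?(ltW m0)//.
  have I : itg (fun z => (u (x + z) - u x) * rho e z).
    have := itgB (Iux x) (itgZ (u x) (itg_rho e0)).
    by congr itg; apply/funext => z; rewrite -mulrBl.
  apply: (le_trans (le_norm_intR I)); rewrite le_eqVlt; apply/orP; left; apply/eqP.
  congr intR; apply/funext => z.
  by rewrite normrM (ger0_norm (rho_ge0 _ _)).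
have Iz z : itg (fun x => `|u (x + z) - u x| * bx r x).
  by apply: itg_diff => //; exact: locint_shift.
pose F (p : V * V) : \bar R :=
  ((@mass R N e)^-1 * (`|u (p.1 + p.2) - u p.1| * rho e p.2) * bx r p.1)%:E.
have mF : measurable_fun setT F.
  apply/measurable_EFinP; apply: measurable_funM; last first.
    by apply: (measurableT_comp (mfun_bx r)); exact: measurable_fst.
  apply: measurable_funM; first exact: measurable_cst.
  apply: measurable_funM; last first.
    by apply: (measurableT_comp mr); exact: measurable_snd.
  apply: measurableT_comp => //; apply: measurable_funB.
    by apply: (measurableT_comp mu_); exact: measurable_addrV2.
  by apply: (measurableT_comp mu_); exact: measurable_fst.
have F0 p : (0 <= F p)%E.
  by rewrite lee_fin mulr_ge0 ?bx_ge0// mulr_ge0 ?invr_ge0 ?(ltW m0)// mulr_ge0 ?rho_ge0.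
have Imol : itg (fun x => `|mol e u x - u x| * bx r x).
  by apply: itg_diff => //; exact: locint_mol.
rewrite -lee_fin EFin_intR//.
apply: (@le_trans _ _ (\int[mu]_x \int[mu]_z F (x, z))%E).
  apply: ge0_le_integral => //.
  - by move=> x _; rewrite lee_fin mulr_ge0 ?bx_ge0.
  - by apply/measurable_EFinP; exact: itg_mfun Imol.
  - exact: (@measurable_fun_fubini_tonelli_F _ _ _ _ _ mu F mF F0).
  - move=> x _; rewrite /F/=.
    have -> : (\int[mu]_z ((@mass R N e)^-1 * (`|u (x + z) - u x| * rho e z) * bx r x)%:E)%E =
        ((@mass R N e)^-1 * intR (fun z => `|u (x + z) - u x| * rho e z) * bx r x)%:E.
      rewrite -EFin_intR; last first.
        have := itgZ (bx r x) (itgZ (@mass R N e)^-1 (Iuu x)).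
        by congr itg; apply/funext => z; rewrite mulrC.
      congr (_%:E); rewrite -intRZ// mulrC -intRZ; last exact: itgZ.
      by congr intR; apply/funext => z; rewrite mulrC.
    by rewrite lee_fin ler_wpM2r ?bx_ge0.
rewrite (fubini_tonelli (m1 := mu) (m2 := mu) F mF F0).
apply: (@le_trans _ _ (\int[mu]_z ((@mass R N e)^-1 * eta * rho e z)%:E)%E).
  apply: ge0_le_integral => //.
  - by move=> z _; apply: integral_ge0.
  - exact: (@measurable_fun_fubini_tonelli_G _ _ _ _ _ mu F mF F0).
  - apply/measurable_EFinP; apply: measurable_funM => //; exact: measurable_cst.
  - move=> z _; rewrite /F/=.
    have -> : (\int[mu]_x ((@mass R N e)^-1 * (`|u (x + z) - u x| * rho e z) * bx r x)%:E)%E =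
        ((@mass R N e)^-1 * rho e z * intR (fun x => `|u (x + z) - u x| * bx r x))%:E.
      rewrite -EFin_intR; last first.
        have := itgZ ((@mass R N e)^-1 * rho e z) (Iz z).
        by congr itg; apply/funext => x; ring.
      congr (_%:E); rewrite -intRZ//.
      by congr intR; apply/funext => x; ring.
    rewrite lee_fin -[leLHS]mulrA -[leRHS]mulrA ler_wpM2l ?invr_ge0 ?(ltW m0)//.
    have [->|rz] := eqVneq (rho e z) 0; first by rewrite mulr0 mul0r.
    rewrite [leLHS]mulrC ler_wpM2r ?rho_ge0// hd// => i.
    by rewrite (le_trans (rho_out e0 rz i)).
rewrite -EFin_intR; last by apply: itgZ; exact: itg_rho.
rewrite intRZ; last exact: itg_rho.
by rewrite mulrAC -/(@mass R N e) mulVf ?mul1r// gt_eqF.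
Qed.

(* The distributional equation [Laplacian u = g], tested only on the translates *)
(* of the mollifiers.                                                          *)
Definition weak_lap u g := forall e x, 0 < e ->
  conv (rho2 e) u x = conv (rho e) g x.

(** A translated mollifier is still a product of affinely rescaled bumps, hence an admissible test
    function, with Laplacian the translate of [rho2 e]. *)
Lemma weak_lap_of_neg_laplacian u f : locint f -> neg_laplacian_eq u f ->
  weak_lap u (fun x => - f x).
Proof.
move=> lf H e x e0.
pose B := fun (i : 'I_N) (t : R) => bump (e^-1 * t + - (e^-1 * x ord0 i)).
pose B2 := fun (i : 'I_N) (t : R) => e^-1 ^+ 2 * bump2 (e^-1 * t + - (e^-1 * x ord0 i)).
have BE y : tensf B y = rho e (y - x).
  by apply: eq_bigr => i _; rewrite /B /be !mxE mulrBr.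
have B2E y : \sum_i tensf (updf B i (B2 i)) y = rho2 e (y - x).
  rewrite /rho2 /tens2.
  apply: eq_bigr => i _.
  rewrite [LHS]tensf_upd.
  rewrite [RHS]tensf_upd.
  have E j : B j (y ord0 j) = be e ((y - x) ord0 j) by rewrite /B /be !mxE mulrBr.
  have E2 : B2 i (y ord0 i) = be2 e ((y - x) ord0 i) by rewrite /B2 /be2 !mxE mulrBr.
  rewrite E2; congr (_ * _).
  by apply: eq_bigr => j _; exact: E.
have tf : test_function (tensf B).
  apply: (@test_function_tensf _ _ B (e + \sum_i `|x ord0 i|)).
    by move=> i n; apply: Cn_affine; exact: smooth1_bump.
  move=> i t ht; rewrite /B -mulrBr.
  have -> : bump (e^-1 * (t - x ord0 i)) = be e (t - x ord0 i) by [].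
  apply: be_out => //.
  have : `|x ord0 i| <= \sum_i `|x ord0 i|.
    by rewrite (bigD1 i)//= lerDl sumr_ge0.
  have := ler_normD (t - x ord0 i) (x ord0 i); rewrite subrK; lra.
have := H _ tf.
have -> : laplacian (tensf B) = fun y => rho2 e (y - x).
  rewrite (laplacian_tensf (B2 := B2)) => [|i].
    by apply/funext => y; exact: B2E.
  exact: is_derive_be_affine.
rewrite (_ : tensf B = fun y => rho e (y - x)); last by apply/funext.
rewrite /conv /intR => /(congr1 -%R); rewrite opprK => ->.
have [C C0 rC] := rho_bound (N := N) e0.
have If := itg_conv x lf (mfun_rho e0) rC.
have := intRZ (-1) If; rewrite mulN1r /intR => <-.
by congr Rintegral; apply/funext => y; rewrite mulN1r mulNr.
Qed.

End mollifier_convergence.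

(** * The convex truncation above level 1 *)

Section convex_truncation.
Context {R : realType}.
Implicit Types s t g : R.

(* [jtr s] is [w ^ 2 / (1 + w)] for [w] the positive part of [s - 1]: a convex *)
(* function with Lipschitz derivative [djtr], vanishing exactly for [s <= 1]. *)
Definition jtr s : R := Num.max s 1 - 2 + (Num.max s 1)^-1.
Definition djtr s : R := 1 - (Num.max s 1)^-1 ^+ 2.

Let mx s := Num.max s 1.
Let mx1 s : 1 <= mx s. Proof. by rewrite /mx le_max lexx orbT. Qed.
Let mx0 s : 0 < mx s. Proof. exact: lt_le_trans (mx1 s). Qed.
Let mxlip s t : `|mx s - mx t| <= `|s - t|.
Proof.
have h1 := ler_norm (s - t); have h2 := ler_norm (t - s); rewrite distrC in h2.
by rewrite /mx /Num.max; case: ltP => s1; case: ltP => t1; rewrite ler_norml; lra.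
Qed.
Let imx1 s : 0 < (mx s)^-1 <= 1.
Proof. by rewrite invr_gt0 mx0/= invf_le1. Qed.

Lemma djtr_ge0 s : 0 <= djtr s.
Proof. by rewrite /djtr -/(mx s); have /andP[? ?] := imx1 s; nra. Qed.

Lemma djtr_le1 s : djtr s <= 1.
Proof. by rewrite /djtr gerBl sqr_ge0. Qed.

Lemma jtr_ge0 s : 0 <= jtr s.
Proof.
have -> : jtr s = (mx s - 1) ^+ 2 / mx s by rewrite /jtr -/(mx s); field; rewrite gt_eqF.
by rewrite divr_ge0 ?sqr_ge0// ltW.
Qed.

(** In terms of [a = max s 1] and [c = max t 1] the Taylor remainder is exactly (c - a)^2 / (a^2
    c). *)
Lemma jtr_convex s t : jtr s + djtr s * (t - s) <= jtr t.
Proof.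
have h1 : djtr s * (t - s) <= djtr s * (mx t - mx s).
  rewrite /djtr /mx; have [s1|s1] := leP s 1.
    by rewrite invr1 expr1n subrr !mul0r.
  rewrite ler_wpM2l//; last by rewrite lerD2r le_max lexx.
  have := djtr_ge0 s; by rewrite /djtr (max_idPl (ltW s1)).
have : jtr t - jtr s - djtr s * (mx t - mx s) = (mx t - mx s) ^+ 2 / (mx s ^+ 2 * mx t).
  rewrite /jtr /djtr -!/(mx _); have := mx0 s; have := mx0 t; move: (mx s) (mx t) => a c c0 a0.
  by field; rewrite !gt_eqF.
have h2 : 0 <= (mx t - mx s) ^+ 2 / (mx s ^+ 2 * mx t).
  by rewrite divr_ge0 ?sqr_ge0// mulr_ge0 ?sqr_ge0// ltW.
lra.
Qed.

Lemma jtr_lip s t : `|jtr s - jtr t| <= `|s - t|.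
Proof.
have h1 := jtr_convex s t; have h2 := jtr_convex t s.
have a1 := djtr_ge0 s; have a2 := djtr_le1 s; have b1 := djtr_ge0 t; have b2 := djtr_le1 t.
rewrite ler_norml.
have c1 : djtr s * (s - t) <= `|s - t|.
  rewrite (le_trans (ler_norm _))// normrM (ger0_norm a1) ler_piMl//.
have c2 : djtr t * (t - s) <= `|s - t|.
  rewrite (le_trans (ler_norm _))// normrM (ger0_norm b1) distrC ler_piMl//.
lra.
Qed.

Lemma djtr_lip s t : `|djtr s - djtr t| <= 2 * `|s - t|.
Proof.
apply: (@le_trans _ _ (2 * `|mx s - mx t|)); last by rewrite ler_wpM2l// mxlip.
have -> : djtr s - djtr t = ((mx s)^-1 + (mx t)^-1) * ((mx s)^-1 * (mx t)^-1) * (mx s - mx t).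
  rewrite /djtr -!/(mx _); have := mx0 s; have := mx0 t; move: (mx s) (mx t) => a c c0 a0.
  by field; rewrite !gt_eqF.
have /andP[a0 a1] := imx1 s; have /andP[c0 c1] := imx1 t.
rewrite normrM ler_wpM2r// ger0_norm; last by rewrite !mulr_ge0 ?addr_ge0// ltW.
rewrite (le_trans (y := 2 * 1))//; last by rewrite mulr1.
rewrite ler_pM//; first by rewrite addr_ge0// ltW.
  by rewrite mulr_ge0// ltW.
  by lra.
by rewrite mulr_ile1// ltW.
Qed.

Lemma jtr_le s : jtr s <= `|s|.
Proof.
have := jtr_lip s 1; rewrite [jtr 1]/jtr maxxx invr1.
have := jtr_ge0 s; move=> h0; rewrite (_ : 1 - 2 + 1 = 0); last by ring.
rewrite subr0 ger0_norm// /jtr => h; have [s1|s1] := leP s 1.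
  by rewrite invr1 (_ : 1 - 2 + 1 = 0)//; ring.
rewrite (gtr0_norm (lt_trans ltr01 s1)).
have : s^-1 <= 1 by rewrite invf_le1// ?(ltW s1)// (lt_trans ltr01 s1).
lra.
Qed.

Lemma jtr_eq0 s : jtr s = 0 -> s <= 1.
Proof.
rewrite leNgt => j0; apply/negP => s1; move: j0; rewrite /jtr (max_idPl (ltW s1)).
have s0 : 0 < s by exact: lt_trans s1.
have -> : s - 2 + s^-1 = (s - 1) ^+ 2 / s by field; rewrite gt_eqF.
by move/eqP; rewrite mulf_eq0 invr_eq0 (gt_eqF s0) orbF sqrf_eq0 subr_eq0 gt_eqF.
Qed.

(** For [s > 1] one has j'(s) (s^3 - s) = j(s) (s + 1)^2, and (s + 1)^2 >= 4 + (s - 1)^2 >= 4 +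
    j(s)^2. The truncation was chosen for this identity. *)
Lemma djtr_source s g : (1 < s -> s ^+ 3 - s <= g) ->
  4 * jtr s + jtr s ^+ 3 <= djtr s * g.
Proof.
have [s1|s1] := leP s 1.
  move=> _; rewrite /jtr /djtr (max_idPr s1) invr1 expr1n subrr mul0r.
  by rewrite (_ : 1 - 2 + 1 = 0) ?expr0n ?mulr0 ?addr0//; ring.
move=> /(_ isT) sg; have d0 := djtr_ge0 s.
apply: (le_trans _ (ler_wpM2l d0 sg)).
have s0 : 0 < s by exact: lt_trans s1.
have j0 := jtr_ge0 s.
have jE : djtr s * (s ^+ 3 - s) = jtr s * (s + 1) ^+ 2.
  by rewrite /djtr /jtr (max_idPl (ltW s1)); field; rewrite gt_eqF.
have js : jtr s <= s - 1.
  rewrite /jtr (max_idPl (ltW s1)).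
  have : s^-1 <= 1 by rewrite invf_le1// ltW.
  lra.
rewrite jE [jtr s ^+ 3]exprS [4 * _]mulrC -mulrDr ler_wpM2l//.
have : jtr s ^+ 2 <= (s - 1) ^+ 2 by rewrite ler_pXn2r// nnegrE// subr_ge0 ltW.
nra.
Qed.

Lemma continuous_lip (f : R -> R) C : (forall s t, `|f s - f t| <= C * `|s - t|) ->
  continuous f.
Proof.
move=> fC t; apply/cvgrPdist_le => e e0.
have C0 : 0 < `|C| + 1 by rewrite ltr_wpDl.
near=> s; rewrite (le_trans (fC _ _))//.
apply: (@le_trans _ _ ((`|C| + 1) * `|t - s|)).
  by rewrite ler_wpM2r// (le_trans (ler_norm _))// lerDl.
rewrite -ler_pdivlMl// mulrC ltW//.
near: s; apply: (@nbhsx_ballx _ R t (e / (`|C| + 1))).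
by rewrite divr_gt0.
Unshelve. all: by end_near.
Qed.

Lemma measurable_jtr : measurable_fun setT jtr.
Proof.
apply: continuous_measurable_fun; apply: (@continuous_lip _ 1) => s t.
by rewrite mul1r jtr_lip.
Qed.

Lemma measurable_djtr : measurable_fun setT djtr.
Proof.
by apply: continuous_measurable_fun; apply: (@continuous_lip _ 2) => s t; exact: djtr_lip.
Qed.

End convex_truncation.

(** * Kato's inequality for mollified functions *)

Section kato.
Context {R : realType} {N : nat}.
Local Notation V := 'rV[R]_N.
Local Notation mu := (lebesgue_rV R N).
Implicit Types (f g u k : V -> R) (x y z : V) (r e d M C h s : R) (i : 'I_N).

(** The device by which every limit in a small parameter is taken, without limits appearing in the
    statements. *)
Lemma ler_linear_eps (a C : R) :
  (forall h, 0 < h -> h <= 1 -> a <= C * h) -> a <= 0.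
Proof.
move=> H; rewrite leNgt; apply/negP => a0.
have C0 : 0 < `|C| + 1 by rewrite ltr_wpDl.
pose h := Num.min 1 (a / (2 * (`|C| + 1))).
have h0 : 0 < h by rewrite lt_min ltr01 divr_gt0// mulr_gt0.
have h1 : h <= 1 by rewrite ge_min lexx.
have ha : h <= a / (2 * (`|C| + 1)) by rewrite ge_min lexx orbT.
have := H h h0 h1; apply/negP; rewrite -ltNge.
apply: (@le_lt_trans _ _ ((`|C| + 1) * (a / (2 * (`|C| + 1))))).
  rewrite (le_trans (y := (`|C| + 1) * h))//; last by rewrite ler_pM2l.
  by rewrite ler_wpM2r ?(ltW h0)//; have := ler_norm C; lra.
rewrite (_ : (`|C| + 1) * (a / (2 * (`|C| + 1))) = a / 2); last by field; rewrite gt_eqF.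
lra.
Qed.

Lemma locint_jtr u : locint u -> locint (fun x => jtr (u x)).
Proof.
move=> lu; apply: (le_locint _ _ (locint_norm lu)).
  by apply: (measurableT_comp measurable_jtr); exact: lu.1.
by move=> x; rewrite ger0_norm ?jtr_ge0// jtr_le.
Qed.

Lemma locint_djtr u g : locint u -> locint g -> locint (fun x => djtr (u x) * g x).
Proof.
move=> lu lg; apply: (le_locint _ _ (locint_norm lg)).
  by apply: measurable_funM; [apply: (measurableT_comp measurable_djtr); exact: lu.1|exact: lg.1].
by move=> x; rewrite normrM ger0_norm ?djtr_ge0// ler_piMl// djtr_le1.
Qed.

Section test.
Variables (b b2 : R -> R) (r M : R).
Hypothesis bb : is_bump b b2 r M.
Hypothesis b0 : forall t, 0 <= b t.

Let phi : V -> R := tens b.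
Let lphi : V -> R := tens2 b b2.

Let phi0 x : 0 <= phi x. Proof. by apply: prodr_ge0. Qed.
Let M0 : 0 <= M. Proof. exact: le_trans (bump_M bb). Qed.
Let mphi : mfun_rV phi. Proof. exact: mfun_tens bb. Qed.
Let mlphi : mfun_rV lphi. Proof. exact: mfun_tens2 bb. Qed.
Let phiC x : `|phi x| <= M ^+ N * bx r x. Proof. exact: (tens_bound bb). Qed.
Let lphiC x : `|lphi x| <= (N%:R * M ^+ N) * bx r x. Proof. exact: (tens2_bound bb). Qed.

Lemma itg_phi u : locint u -> itg (fun x => u x * phi x).
Proof. by move=> lu; exact: locint_mul phiC. Qed.

Lemma itg_lphi u : locint u -> itg (fun x => u x * lphi x).
Proof. by move=> lu; exact: locint_mul lphiC. Qed.

(** Discrete integration by parts: translation invariance moves each shift to the other factor with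
    opposite sign, and the second difference is symmetric in [h]. *)
Lemma intR_dlap h f : locint f ->
  intR (fun x => f x * dlap h phi x) = intR (fun x => dlap h f x * phi x).
Proof.
move=> lf.
have I1 z : itg (fun x => f x * phi (x + z)).
  have := itg_conv (- z) lf mphi phiC.
  by congr itg; apply/funext => x; rewrite opprK.
have I2 z : itg (fun x => f (x + z) * phi x) by exact: itg_phi (locint_shift z lf).
have E z : intR (fun x => f x * phi (x + z)) = intR (fun x => f (x - z) * phi x).
  rewrite -[LHS](intR_shift (- z)); last exact: itg_mfun (I1 z).
  by congr intR; apply/funext => x; rewrite subrK.
have I0 : itg (fun x => f x * phi x) by exact: itg_phi.
transitivity (\sum_(i < N) (intR (fun x => f x * phi (x + h *: e_ i)) +
    intR (fun x => f x * phi (x - h *: e_ i)) - 2 * intR (fun x => f x * phi x))).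
  rewrite (_ : (fun x => _) = fun x => \sum_(i < N) (f x * phi (x + h *: e_ i) +
      f x * phi (x - h *: e_ i) - 2 * (f x * phi x))); last first.
    apply/funext => x; rewrite /dlap mulr_sumr; apply: eq_bigr => i _; rewrite /sdiff.
    by move: (f x) (phi _) (phi _) (phi _) => *; ring.
  rewrite intR_sum; last by move=> i; apply: itgB; [exact: itgD|exact: itgZ].
  apply: eq_bigr => i _; rewrite intRB; [|exact: itgD|exact: itgZ].
  by rewrite intRD// intRZ.
rewrite [RHS](_ : _ = intR (fun x => \sum_(i < N) (f (x + h *: e_ i) * phi x +
      f (x - h *: e_ i) * phi x - 2 * (f x * phi x)))); last first.
  congr intR; apply/funext => x; rewrite /dlap mulr_suml; apply: eq_bigr => i _; rewrite /sdiff.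
  by move: (phi x) (f _) (f _) (f _) => *; ring.
rewrite intR_sum; last by move=> i; apply: itgB; [exact: itgD|exact: itgZ].
apply: eq_bigr => i _; rewrite intRB; [|exact: itgD|exact: itgZ].
rewrite intRD// intRZ// !E opprK.
by rewrite [X in X - _]addrC.
Qed.

Lemma mfun_dlap h f : mfun_rV f -> mfun_rV (dlap h f).
Proof.
move=> mf; rewrite /mfun_rV /dlap; elim: (index_enum _) => [|i t IH].
  rewrite (_ : (fun x => _) = fun=> 0); first exact: measurable_cst.
  by apply/funext => y; rewrite big_nil.
rewrite (_ : (fun x => _) = fun y => sdiff h i f y + \sum_(j <- t) sdiff h j f y).
  apply: measurable_funD => //; apply: measurable_funB.
    by apply: measurable_funD; exact: mfun_shift.
  by apply: measurable_funM => //; exact: measurable_cst.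
by apply/funext => y; rewrite big_cons.
Qed.

(** Laplacians are replaced by second differences on both sides, at a cost [h ^+ 3] each; after
    division by [h ^+ 2] the errors [C1] and [C2] are linear in [h]. *)
Lemma kato_mol e u g : 0 < e -> locint u -> locint g -> weak_lap u g ->
  intR (fun x => djtr (mol e u x) * mol e g x * phi x) <=
  intR (fun x => jtr (mol e u x) * lphi x).
Proof.
move=> e0 lu lg wug.
have lU := locint_mol e0 lu; have lG := locint_mol e0 lg.
set U := mol e u in lU *; set G := mol e g in lG *.
have lJ := locint_jtr lU.
have mD : mfun_rV (fun x => djtr (U x)) by apply: (measurableT_comp measurable_djtr); exact: lU.1.
have [CU CU0 hU] := mol_taylor (`|r|) e0 lu.
have {}hU x h : (forall i, `|x ord0 i| <= r) -> `|h| <= 1 ->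
    `|dlap h U x - h ^+ 2 * G x| <= CU * `|h| ^+ 3.
  move=> xr h1; rewrite /G /mol -wug//; apply: hU => // i.
  by rewrite (le_trans (xr i))// ler_norm.
pose C1 := N%:R * M ^+ N.+1 * intR (fun x => jtr (U x) * bx (r + 1) x).
pose C2 := CU * (M ^+ N * intR (@bx R N r)).
rewrite -subr_le0; apply: (@ler_linear_eps _ (C1 + C2)) => h h0 h1.
have h2 : 0 < h ^+ 2 by rewrite exprn_gt0.
rewrite -(ler_pM2l h2) mulrBr.
have nh : `|h| = h by rewrite gtr0_norm.
have h1' : `|h| <= 1 by rewrite nh.
have tay x : `|dlap h phi x - h ^+ 2 * lphi x| <= N%:R * M ^+ N.+1 * h ^+ 3 * bx (r + 1) x.
  by have := tens_taylor bb x h1'; rewrite nh.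
have mdl := mfun_dlap h mphi.
have m3 : mfun_rV (fun x => dlap h phi x - h ^+ 2 * lphi x).
  apply: measurable_funB => //; apply: measurable_funM => //; exact: measurable_cst.
have I3 : itg (fun x => jtr (U x) * (dlap h phi x - h ^+ 2 * lphi x)).
  exact: locint_mul tay.
have IJl := itg_lphi lJ.
have IJd : itg (fun x => jtr (U x) * dlap h phi x).
  have := itgD I3 (itgZ (h ^+ 2) IJl).
  by congr itg; apply/funext => x; ring.
have A1 : intR (fun x => jtr (U x) * dlap h phi x) -
    h ^+ 2 * intR (fun x => jtr (U x) * lphi x) <= h ^+ 3 * C1.
  rewrite -intRZ// -intRB//; last exact: itgZ.
  rewrite /C1 mulrA -intRZ; last exact: lJ.2.
  apply: le_intR; [by apply: itgB => //; exact: itgZ|by apply: itgZ; exact: lJ.2|].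
  move=> x; rewrite (_ : _ - _ = jtr (U x) * (dlap h phi x - h ^+ 2 * lphi x)); last by ring.
  rewrite mulrCA ler_wpM2l ?jtr_ge0// (le_trans (ler_norm _))// (le_trans (tay x))//.
  by rewrite [h ^+ 3 * _]mulrC.
have IDG := itg_phi (locint_djtr lU lG).
have mdU := mfun_dlap h lU.1.
pose E x := djtr (U x) * (dlap h U x - h ^+ 2 * G x) * phi x.
have EC x : `|E x| <= CU * h ^+ 3 * M ^+ N * bx r x.
  rewrite /E; have := phiC x; case: (bxP r x) => [xr|_]; last first.
    by rewrite mulr0 normr_le0 => /eqP ->; rewrite !mulr0 normr0.
  rewrite !mulr1 => pM; rewrite !normrM ler_pM ?mulr_ge0//.
  have hx := hU x h xr h1'; rewrite nh in hx.
  rewrite (ger0_norm (djtr_ge0 _)) -[X in _ <= X]mul1r.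
  by apply: ler_pM => //; [exact: djtr_ge0|exact: djtr_le1].
have mE : mfun_rV E.
  apply: measurable_funM => //; apply: measurable_funM => //.
  apply: measurable_funB => //; apply: measurable_funM; [exact: measurable_cst|exact: lG.1].
have IE : itg E by apply: (le_itg mE EC); apply: itgZ; exact: itg_bx.
have ID : itg (fun x => djtr (U x) * dlap h U x * phi x).
  have := itgD IE (itgZ (h ^+ 2) IDG).
  by congr itg; apply/funext => x; rewrite /E; ring.
have A2 : h ^+ 2 * intR (fun x => djtr (U x) * G x * phi x) -
    intR (fun x => djtr (U x) * dlap h U x * phi x) <= h ^+ 3 * C2.
  rewrite -intRZ// -intRB//; last exact: itgZ.
  rewrite /C2 mulrA mulrA -intRZ; last exact: itg_bx.
  apply: le_intR; [by apply: itgB => //; exact: itgZ|by apply: itgZ; exact: itg_bx|].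
  move=> x; rewrite (_ : _ - _ = - E x); last by rewrite /E; ring.
  rewrite (le_trans (ler_norm _))// normrN (le_trans (EC x))//.
  by rewrite [h ^+ 3 * _]mulrC.
have IdJ : itg (fun x => dlap h (fun x => jtr (U x)) x * phi x).
  have I i : itg (fun x => sdiff h i (fun x => jtr (U x)) x * phi x).
    have := itg_phi (locintB (locintD (locint_shift (h *: e_ i) lJ)
      (locint_shift (- (h *: e_ i)) lJ)) (locintZ 2 lJ)).
    by congr itg.
  have := itg_sum (index_enum 'I_N) I.
  by congr itg; apply/funext => x; rewrite /dlap mulr_suml.
(* Convexity at the centre against the two neighbours gives a pointwise inequality, preserved by
   integration since [phi >= 0]. *)
have A3 : intR (fun x => djtr (U x) * dlap h U x * phi x) <=
    intR (fun x => jtr (U x) * dlap h phi x).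
  rewrite intR_dlap//; apply: le_intR => // x; rewrite ler_wpM2r//.
  rewrite /dlap mulr_sumr; apply: ler_sum => i _; rewrite /sdiff /=.
  move: (U x) (U (x + h *: e_ i)) (U (x - h *: e_ i)) => p q t.
  have := jtr_convex p q; have := jtr_convex p t; lra.
have -> : h ^+ 2 * ((C1 + C2) * h) = h ^+ 3 * C1 + h ^+ 3 * C2 by ring.
lra.
Qed.

End test.

End kato.

(** * Kato's inequality for locally integrable functions *)

Section keller_osserman.
Context {R : realType} {N : nat}.
Local Notation V := 'rV[R]_N.
Local Notation mu := (lebesgue_rV R N).
Implicit Types (f g u k : V -> R) (x y z : V) (r e d M C h s : R) (i : 'I_N).

(** The product of [djtr a - djtr a'] with an unbounded [g] is not controlled by [|a - a'|]; the
    bounded [s] is inserted for that reason. *)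
Lemma djtr_diff (a a' g g' s Ms : R) : `|s| <= Ms ->
  `|djtr a * g - djtr a' * g'| <= `|g' - g| + `|g - s| + 2 * Ms * `|a' - a|.
Proof.
move=> sM; have Ms0 : 0 <= Ms by exact: le_trans sM.
have a0 := djtr_ge0 a; have a1 := djtr_le1 a; have b0 := djtr_ge0 a'; have b1 := djtr_le1 a'.
have -> : djtr a * g - djtr a' * g' = djtr a' * (g - g') + (djtr a - djtr a') * (g - s) +
   (djtr a - djtr a') * s by ring.
rewrite (le_trans (ler_normD _ _))// lerD//.
  rewrite (le_trans (ler_normD _ _))// lerD// normrM.
    by rewrite (ger0_norm b0) distrC ler_piMl.
  by rewrite ler_piMl// ler_norml; lra.
rewrite normrM mulrAC ler_pM// (le_trans (djtr_lip _ _))//.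
by rewrite distrC.
Qed.

Lemma kato u g (b b2 : R -> R) r M : is_bump b b2 r M -> (forall t, 0 <= b t) ->
  locint u -> locint g -> weak_lap u g ->
  intR (fun x : V => djtr (u x) * g x * tens b x) <=
  intR (fun x : V => jtr (u x) * tens2 b b2 x).
Proof.
move=> bb b0 lu lg wug; rewrite -subr_le0.
have M0 : 0 <= M := le_trans ler01 (bump_M bb).
have MN0 : 0 <= M ^+ N by rewrite exprn_ge0.
apply: (@ler_linear_eps _ _ (4 * M ^+ N + N%:R * M ^+ N)) => h h0 _.
have [s [Ms [ms _ sM gs]]] := locint_approx r lg h0.
have Ms0 : 0 <= Ms by exact: le_trans (sM 0).
(* The error on [u] is multiplied by [2 * Ms] in [djtr_diff]; this tolerance keeps the product below
   [2 * h]. *)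
have h'0 : 0 < h / (1 + Ms) by rewrite divr_gt0// ltr_wpDr.
have [d1 d10 hd1] := mol_L1 r lu h'0; have [d2 d20 hd2] := mol_L1 r lg h0.
pose e := Num.min d1 d2; have e0 : 0 < e by rewrite lt_min d10.
have ed1 : e <= d1 by rewrite ge_min lexx.
have ed2 : e <= d2 by rewrite ge_min lexx orbT.
have {}hd1 := hd1 e e0 ed1; have {}hd2 := hd2 e e0 ed2.
have lU := locint_mol e0 lu; have lG := locint_mol e0 lg.
have K := kato_mol bb b0 e0 lu lg wug.
set U := mol e u in lU K hd1; set G := mol e g in lG K hd2.
have lJ := locint_jtr lu; have lJU := locint_jtr lU.
have ls : locint s := locint_bounded ms sM.
have I1 := itg_phi bb (locint_djtr lu lg); have I2 := itg_phi bb (locint_djtr lU lG).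
have I3 := itg_lphi bb lJ; have I4 := itg_lphi bb lJU.
have hU : intR (fun x => `|U x - u x| * bx r x) <= h.
  rewrite (le_trans hd1)// ler_pdivrMr ?ltr_wpDr// ler_peMr ?(ltW h0)//; lra.
have hU2 : 2 * Ms * intR (fun x => `|U x - u x| * bx r x) <= 2 * h.
  rewrite -mulrA ler_wpM2l// (le_trans (ler_wpM2l Ms0 hd1))//.
  by rewrite mulrCA ler_piMr ?(ltW h0)// ler_pdivrMr ?ltr_wpDr// mul1r; lra.
have IU : itg (fun x => `|U x - u x| * bx r x) by exact: itg_diff.
have IG : itg (fun x => `|G x - g x| * bx r x) by exact: itg_diff.
have Is : itg (fun x => `|g x - s x| * bx r x) by exact: itg_diff.
have E1 : intR (fun x => djtr (u x) * g x * tens b x) -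
    intR (fun x => djtr (U x) * G x * tens b x) <= M ^+ N * (h + h + 2 * h).
  rewrite -intRB// (le_trans (y := intR (fun x : V => M ^+ N *
      (`|G x - g x| * bx r x + `|g x - s x| * bx r x + 2 * Ms * (`|U x - u x| * bx r x)))))//.
    apply: le_intR.
    - exact: itgB.
    - by apply: itgZ; apply: itgD; [exact: itgD|exact: itgZ].
    move=> x; rewrite -mulrBl (le_trans (ler_norm _))// normrM.
    rewrite (_ : M ^+ N * _ = (`|G x - g x| + `|g x - s x| + 2 * Ms * `|U x - u x|) *
      (M ^+ N * bx r x)); last by move: (`|G x - g x|) (`|g x - s x|) (`|U x - u x|) => *; ring.
    exact: (ler_pM (normr_ge0 _) (normr_ge0 _)
      (djtr_diff (u x) (U x) (g x) (G x) (sM x)) (tens_bound bb x)).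
  rewrite intRZ; last by apply: itgD; [exact: itgD|exact: itgZ].
  rewrite ler_wpM2l// intRD; [|exact: itgD|exact: itgZ].
  by rewrite intRD// intRZ// !lerD.
have E2 : intR (fun x => jtr (U x) * tens2 b b2 x) -
    intR (fun x => jtr (u x) * tens2 b b2 x) <= N%:R * M ^+ N * h.
  rewrite -intRB// (le_trans (y := intR (fun x : V => N%:R * M ^+ N * (`|U x - u x| * bx r x))))//.
    apply: le_intR; [exact: itgB|exact: itgZ|].
    move=> x; rewrite -mulrBl (le_trans (ler_norm _))// normrM mulrCA.
    by rewrite ler_pM// ?jtr_lip// (tens2_bound bb).
  by rewrite intRZ// ler_wpM2l// mulr_ge0.
have -> : (4 * M ^+ N + N%:R * M ^+ N) * h = M ^+ N * (h + h + 2 * h) + N%:R * M ^+ N * h by ring.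
lra.
Qed.

End keller_osserman.

(** * Cutoffs at scale L with a Laplacian controlled by a power of themselves *)

Section cutoffs.
Context {R : realType} {N : nat}.
Local Notation V := 'rV[R]_N.
Implicit Types (x y z : V) (L K : R) (i : 'I_N).

Lemma is_derive_pow (f : R -> R) (df t : R) n : is_derive t (1 : R) f df ->
  is_derive t (1 : R) (fun s => f s ^+ n) (n%:R * f t ^+ n.-1 * df).
Proof.
move=> dt; rewrite (_ : (fun s => f s ^+ n) = f ^+ n); first exact: is_deriveX.
by apply/funext => s; rewrite exprfctE.
Qed.

Lemma CnX m n (f : R -> R) : Cn n f -> Cn n (fun t => f t ^+ m).
Proof.
move=> Cf; elim: m => [|m IH]; first exact: Cn_cst.
rewrite (_ : (fun t => _) = fun t => f t * f t ^+ m); first exact: CnM.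
by apply/funext => t; rewrite exprS.
Qed.

(* The sixth power makes [tens (cut L)] the cube of [psi L], with a Laplacian *)
(* of size at most [L ^- 2 * psi L], as Young's inequality below requires.    *)
Definition cut L t : R := bump (L^-1 * t) ^+ 6.
(** The second derivative of [bump ^+ 6]. *)
Definition cutq t : R := 6 * bump t ^+ 5 * bump2 t + 30 * bump t ^+ 4 * bump1 t ^+ 2.
Definition cut2 L t : R := L^-1 ^+ 2 * cutq (L^-1 * t).

Lemma cut_ge0 L t : 0 <= cut L t.
Proof. by rewrite exprn_ge0 ?bump_ge0. Qed.

Lemma cut_bump L : 0 < L -> exists M, is_bump (cut L) (cut2 L) (L + 2) M.
Proof.
move=> L0.
pose g1 t : R := 6 * bump t ^+ 5 * bump1 t.
have d1 t : is_derive t (1 : R) (fun t : R => bump t ^+ 6) (g1 t).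
  exact: is_derive_pow (is_derive_bump t).
have d2 t : is_derive t (1 : R) g1 (cutq t).
  have e1 := is_derive_pow 5 (is_derive_bump t).
  have e2 : is_derive t (1 : R) (fun s : R => 6 * bump s ^+ 5)
    (6 * (5%:R * bump t ^+ 4 * bump1 t)) := is_deriveZ _ e1.
  have e3 := @is_deriveM _ _ _ _ t 1 _ _ e2 (is_derive_bump1 t).
  refine (@is_derive_eq _ _ _ _ _ _ _ _ e3 _).
  by rewrite /GRing.scale/= /cutq; ring.
have E0 t : cut L t = bump (L^-1 * t + 0) ^+ 6 by rewrite addr0.
have d1' t : is_derive t (1 : R) (cut L) (L^-1 * g1 (L^-1 * t + 0)).
  rewrite (_ : cut L = fun t => bump (L^-1 * t + 0) ^+ 6); last exact/funext.
  exact: (is_derive_affine (f := fun t : R => bump t ^+ 6)).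
have d2' t : is_derive t (1 : R) (fun t => L^-1 * g1 (L^-1 * t + 0)) (cut2 L t).
  rewrite /cut2 -[in cutq _](addr0 (L^-1 * t)) expr2 -mulrA.
  apply: (@is_deriveZ _ _ _ (fun t => g1 (L^-1 * t + 0)) L^-1 t 1).
  exact: is_derive_affine.
have sc : smooth1 (cut L).
  rewrite (_ : cut L = fun t => bump (L^-1 * t + 0) ^+ 6); last exact/funext.
  by move=> n; apply: CnX; apply: Cn_affine; exact: smooth1_bump.
apply: (smooth1_is_bump sc d1' d2') => t Lt.
by rewrite /cut -/(be L t) be_out ?expr0n.
Qed.

Lemma cutq_bound : exists2 K, 0 <= K & forall t, `|cutq t| <= K * bump t ^+ 2.
Proof.
have [M bM] := @be_bump R 1 ltr01.
have c1 := is_derive_continuous (@is_derive_bump1 R).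
have [M1 M10 hM1] := compact_support_bounded c1
  (derive_support (@is_derive_bump R) (@bump_eq0 R)).
have M0 : 0 <= M by exact: le_trans (bump_M bM).
exists (6 * M + 30 * M1 ^+ 2) => [|t].
  by rewrite addr_ge0// mulr_ge0// ?exprn_ge0.
have b0 := bump_ge0 t; have b1 := bump_le1 t.
have h2 : `|bump2 t| <= M.
  by have := bump_bound2 bM t; rewrite /be2 invr1 expr1n !mul1r.
have h1 : bump1 t ^+ 2 <= M1 ^+ 2.
  by have := hM1 t; rewrite -[bump1 t ^+ 2]ger0_norm ?sqr_ge0// normrX ler_pXn2r ?nnegrE.
have -> : cutq t = (6 * bump t ^+ 3 * bump2 t + 30 * bump t ^+ 2 * bump1 t ^+ 2) * bump t ^+ 2.
  by rewrite /cutq; ring.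
rewrite normrM [`|bump t ^+ 2|]ger0_norm ?sqr_ge0// ler_wpM2r ?sqr_ge0//.
have p3 : 0 <= bump t ^+ 3 <= 1 by rewrite exprn_ge0//= exprn_ile1.
have p2 : 0 <= bump t ^+ 2 <= 1 by rewrite exprn_ge0//= exprn_ile1.
move: p3 p2 h1 => /andP[p3 p3'] /andP[p2 p2'] h1.
rewrite (le_trans (ler_normD _ _))// lerD//.
  move: (bump t ^+ 3) (bump2 t) p3 p3' h2 => p q p3 p3' h2.
  rewrite normrM (ger0_norm (mulr_ge0 _ p3))//; have := normr_ge0 q; nra.
move: (bump t ^+ 2) (bump1 t ^+ 2) p2 p2' h1 (sqr_ge0 (bump1 t)) => p q p2 p2' h1 q0.
by rewrite ger0_norm ?mulr_ge0//; nra.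
Qed.

Definition psi L x : R := \prod_i bump (L^-1 * x ord0 i) ^+ 2.

Lemma psi_ge0 L x : 0 <= psi L x.
Proof. by apply: prodr_ge0 => i _; rewrite sqr_ge0. Qed.

Lemma tens_cut L x : tens (cut L) x = psi L x ^+ 3.
Proof.
by rewrite /tens /tensf /psi -prodrXl; apply: eq_bigr => i _; rewrite -exprM.
Qed.

Lemma psi_bx L x : 0 < L -> psi L x <= bx L x.
Proof.
move=> L0; case: (bxP L x) => [_|/not_in_box[i Li]].
  apply: (@le_trans _ _ (\prod_(i < N) 1)); last by rewrite big1_eq.
  by apply: ler_prod => i _; rewrite sqr_ge0 exprn_ile1 ?bump_ge0 ?bump_le1.
rewrite /psi (bigD1 i)//= -/(be L (x ord0 i)) be_out//; last exact: ltW.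
by rewrite expr0n mul0r.
Qed.

(** The differentiated factor retains [bump ^+ 2] by [cutq_bound]; in the other factors four powers
    of [bump <= 1] are given away. *)
Lemma tens2_cut L K x : 0 < L -> 0 <= K ->
  (forall t : R, `|cutq t| <= K * bump t ^+ 2) ->
  `|tens2 (cut L) (cut2 L) x| <= N%:R * K / L ^+ 2 * psi L x.
Proof.
move=> L0 K0 qK; rewrite /tens2 (le_trans (ler_norm_sum _ _ _))//.
rewrite (le_trans (y := \sum_(i < N) (K / L ^+ 2 * psi L x)))//; last first.
  by rewrite sumr_const card_ord -[leLHS]mulr_natl !mulrA.
apply: ler_sum => i _; rewrite tensf_upd normrM [psi L x](bigD1 i)//= mulrA.
apply: ler_pM => //.
  have q0 : 0 <= L^-1 ^+ 2 by exact: sqr_ge0.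
  rewrite /cut2 [leLHS]normrM (ger0_norm q0) -exprVn [K * _]mulrC -[leRHS]mulrA.
  exact: ler_wpM2l.
rewrite normr_prod; apply: ler_prod => j _; rewrite normr_ge0/= ger0_norm ?cut_ge0//.
rewrite /cut (_ : 6%N = (2 + 4)%N)// exprD ler_piMr ?sqr_ge0//.
by rewrite exprn_ile1 ?bump_ge0 ?bump_le1.
Qed.

Definition cut_c : R := bump_c ^+ 6 ^+ N.

Lemma cut_c_gt0 : 0 < cut_c.
Proof. by rewrite !exprn_gt0 ?bump_c_gt0. Qed.

Lemma tens_cut_lower L L' x : 0 < L -> 2 * L <= L' -> cut_c * bx L x <= tens (cut L') x.
Proof.
move=> L0 LL; have L'0 : 0 < L' by lra.
case: (bxP L x) => [h|_]; last first.
  by rewrite mulr0; apply: prodr_ge0 => i _; exact: cut_ge0.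
rewrite mulr1 /tens /tensf /cut_c -[X in _ ^+ X]card_ord -prodr_const.
apply: ler_prod => i _; rewrite exprn_ge0 ?(ltW bump_c_gt0)//=.
rewrite ler_pXn2r ?nnegrE ?bump_ge0 ?(ltW bump_c_gt0)// bump_ge//.
rewrite normrM ger0_norm ?invr_ge0 ?(ltW L'0)//.
by rewrite ler_pdivrMl// (le_trans (h i))//; lra.
Qed.

End cutoffs.

(** * Subsolutions are bounded by 1 almost everywhere *)

Section liouville.
Context {R : realType} {N : nat}.
Local Notation V := 'rV[R]_N.
Local Notation mu := (lebesgue_rV R N).
Implicit Types (f g u : V -> R) (x y z : V).

(** Iterating the first bound [m] times before using the growth bound gains [4^-1 ^+ (k * m)]
    against a growth [2 ^+ (n * (k + m))]. With [m] fixed and large, the terms tend to 0 as [k]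
    grows, and almost monotonicity transfers this to [a j]. *)
Lemma geometric_decay (a : nat -> R) (A B C : R) (n : nat) : 0 <= A -> 0 <= B -> 0 <= C ->
  (forall k, a k <= A * (4^-1) ^+ k * a k.+1) -> (forall k, a k <= B * (2 ^+ n) ^+ k) ->
  (forall j k, (j < k)%N -> a j <= C * a k) -> forall j, a j <= 0.
Proof.
move=> A0 B0 C0 h1 h2 h3 j.
have q0 : 0 <= (4^-1 : R) by rewrite invr_ge0.
have claim m k : a k <= A ^+ m * (4^-1) ^+ k ^+ m * B * (2 ^+ n) ^+ (k + m).
  elim: m k => [|m IH] k; first by rewrite !expr0 !mul1r addn0.
  apply: (le_trans (h1 k)).
  rewrite (le_trans (ler_wpM2l _ (IH k.+1)))//; first by rewrite mulr_ge0 ?exprn_ge0.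
  have pk : (4^-1 : R) ^+ k.+1 ^+ m <= (4^-1) ^+ k ^+ m.
    apply: lerXn2r; rewrite ?nnegrE ?exprn_ge0// exprS ler_piMl ?exprn_ge0//.
    by rewrite invf_le1// ler1n.
  have q1 : 0 <= (2 ^+ n : R) ^+ (k + m.+1) by rewrite !exprn_ge0.
  rewrite addSnnS; move: (4^-1 ^+ k.+1 ^+ m) pk ((2 ^+ n) ^+ _) q1 => p' + q q1.
  have p0 : 0 <= (4^-1 : R) ^+ k by rewrite exprn_ge0.
  move: (4^-1 ^+ k) p0 => p p0 pk.
  rewrite (_ : A ^+ m.+1 * p ^+ m.+1 * B * q = A * p * (A ^+ m * p ^+ m * B * q)).
    by rewrite ler_wpM2l ?mulr_ge0// ler_wpM2r// ler_wpM2r// ler_wpM2l ?exprn_ge0.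
  by rewrite !exprS; ring.
(* Here [m = n.+1]: what depends on [k] is then at most [2^-1 ^+ k], and so at most [1 / k.+1]. *)
pose D := C * (A ^+ n.+1 * B * (2 ^+ n) ^+ n.+1).
have D0 : 0 <= D by rewrite !mulr_ge0 ?exprn_ge0.
have aD k : (j < k)%N -> a j <= D / k.+1%:R.
  move=> jk; rewrite (le_trans (h3 _ _ jk))// /D -mulrA ler_wpM2l//.
  rewrite (le_trans (claim n.+1 k))// exprD.
  rewrite [leLHS](_ : _ = A ^+ n.+1 * B * (2 ^+ n) ^+ n.+1 * ((4^-1) ^+ k ^+ n.+1 * (2 ^+ n) ^+ k)); last first.
    by move: (A ^+ n.+1) (4^-1 ^+ k ^+ n.+1) ((2 ^+ n) ^+ k) ((2 ^+ n) ^+ n.+1) => *; ring.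
  rewrite ler_wpM2l ?mulr_ge0 ?exprn_ge0//.
  have -> : (4^-1 : R) ^+ k ^+ n.+1 * (2 ^+ n) ^+ k = ((4^-1) * (2 / 4) ^+ n) ^+ k.
    rewrite -[_ ^+ k ^+ n.+1]exprM [(k * _)%N]mulnC exprM -exprMn; congr (_ ^+ k).
    by rewrite exprS -mulrA -exprMn [_^-1 * 2]mulrC.
  apply: (@le_trans _ _ (2^-1 ^+ k)).
    apply: lerXn2r; rewrite ?nnegrE ?mulr_ge0 ?exprn_ge0 ?divr_ge0//.
    rewrite (le_trans (y := 4^-1 * 1))//; last by rewrite mulr1; lra.
    by rewrite ler_wpM2l// exprn_ile1 ?divr_ge0//; lra.
  rewrite exprVn lef_pV2 ?posrE ?exprn_gt0// -natrX ler_nat.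
  exact: ltn_expl.
rewrite leNgt; apply/negP => aj0.
pose k := maxn j.+1 (Num.trunc (D / a j)).+1.
have := aD k (leq_maxl _ _); apply/negP; rewrite -ltNge ltr_pdivrMr ?ltr0n//.
rewrite mulrC -ltr_pdivrMr//.
apply: (lt_le_trans (truncnS_gt _)); rewrite ler_nat.
by rewrite (leq_trans (leq_maxr j.+1 _))// leqnSn.
Qed.

Let quarter_le (a b c d f : R) : 4 * a <= d * c * (f * b) -> a <= 4^-1 * d * f * c * b.
Proof. by move=> h; lra. Qed.

(** The cube of the larger of the two numbers already dominates. *)
Lemma young_cube (a d : R) : 0 <= a -> 0 <= d -> a * d ^+ 2 <= a ^+ 3 + d ^+ 3.
Proof.
move=> a0 d0; have [ad|/ltW da] := leP a d.
  rewrite (le_trans (y := d ^+ 3))// ?lerDr ?exprn_ge0//.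
  by rewrite [d ^+ 3]exprS ler_wpM2r ?sqr_ge0.
rewrite (le_trans (y := a ^+ 3))// ?lerDl ?exprn_ge0//.
by rewrite [a ^+ 3]exprS ler_wpM2l// ler_pXn2r ?nnegrE.
Qed.

Lemma ae_of_intR0 f : itg f -> (forall x, 0 <= f x) -> intR f <= 0 ->
  {ae mu, forall x, f x = 0}.
Proof.
move=> If f0 If0.
have If0' : intR f = 0 by apply/eqP; rewrite eq_le If0 intR_ge0.
have mf : measurable_fun setT (EFin \o f) by apply/measurable_EFinP; exact: itg_mfun If.
have := (ae_eq_integral_abs mu measurableT mf).1.
have -> : (\int[mu]_(x in setT) `|(EFin \o f) x|)%E = 0%E.
  rewrite -[RHS]/(0%R%:E) -If0' EFin_intR//.
  by apply: eq_integral => x _ /=; rewrite ger0_norm.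
move=> /(_ erefl); apply: filterS => x /(_ I)[].
by [].
Qed.

Lemma ae_forall_nat (P : nat -> V -> Prop) : (forall n, {ae mu, forall x, P n x}) ->
  {ae mu, forall x, forall n, P n x}.
Proof. by move=> H; exact: ae_foralln. Qed.

(** With [F L] the mass of the truncation [J] weighted by the cutoff of scale [L], the cubic term
    bounds [F L] by a power of [L] and the linear term bounds [F L] by [F (2 * L) / L ^+ 2], up to
    constants. On dyadic scales [geometric_decay] concludes. *)
Lemma subsolution_le1 u g : locint u -> locint g -> weak_lap u g ->
  (forall x, 1 < u x -> u x ^+ 3 - u x <= g x) -> {ae mu, forall x, u x <= 1}.
Proof.
move=> lu lg wug ug.
have [K K0 qK] := @cutq_bound R.
have lJ := locint_jtr lu; have lDg := locint_djtr lu lg.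
pose J x := jtr (u x); have J0 x : 0 <= J x by exact: jtr_ge0.
have src x : 4 * J x + J x ^+ 3 <= djtr (u x) * g x by exact: djtr_source (ug x).
pose phi L : V -> R := tens (cut L).
have phi0 L x : 0 <= phi L x by apply: prodr_ge0 => i _; exact: cut_ge0.
pose F L := intR (fun x => J x * phi L x).
(* Chosen with [N%:R * K <= D ^+ 2], so that the Laplacian of the cutoff carries the square
   [(D / L) ^+ 2] expected by [young_cube]. *)
pose D : R := N%:R * K + 1.
have D0 : 0 <= D by rewrite addr_ge0 ?mulr_ge0.
have DK : N%:R * K <= D ^+ 2.
  have : 0 <= N%:R * K by rewrite mulr_ge0.
  by rewrite /D; move: (N%:R * K) => c; nra.
have IJ L : 0 < L -> itg (fun x => J x * phi L x).
  by move=> L0; have [M bM] := cut_bump L0; exact: (itg_phi bM lJ).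
have mpsi L : 0 < L -> mfun_rV (@psi R N L).
  move=> L0; rewrite (_ : psi L = tensf (fun i t => be L t ^+ 2))//.
  apply: mfun_tensf => i.
  apply: measurable_funX; have [M bM] := be_bump L0; exact: bump_mfun bM.
have psiC L x : 0 < L -> `|psi L x| <= 1 * bx L x.
  by move=> L0; rewrite mul1r ger0_norm ?psi_ge0// psi_bx.
have Ipsi L : 0 < L -> itg (fun x => J x * psi L x).
  move=> L0; exact: (locint_mul lJ (mpsi L L0) (fun x => psiC L x L0)).
have base L : 0 < L ->
    intR (fun x => (4 * J x + J x ^+ 3) * phi L x) <=
    (D / L) ^+ 2 * intR (fun x => J x * psi L x) /\
    itg (fun x => (4 * J x + J x ^+ 3) * phi L x).
  move=> L0; have [M bM] := cut_bump L0.
  have IDg := itg_phi bM lDg.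
  have I4 : itg (fun x => (4 * J x + J x ^+ 3) * phi L x).
    apply: (le_itg _ _ IDg).
      apply: measurable_funM; last exact: mfun_tens bM.
      apply: measurable_funD; last by apply: measurable_funX; exact: lJ.1.
      by apply: measurable_funM; [exact: measurable_cst|exact: lJ.1].
    move=> x; rewrite ger0_norm ?mulr_ge0 ?addr_ge0 ?mulr_ge0 ?exprn_ge0//.
    by rewrite ler_wpM2r.
  split=> //.
  rewrite (le_trans (y := intR (fun x => djtr (u x) * g x * phi L x)))//.
    by apply: le_intR => // x; rewrite ler_wpM2r.
  rewrite (le_trans (kato bM (cut_ge0 L) lu lg wug))// -intRZ; last exact: Ipsi.
  apply: le_intR; [exact: (itg_lphi bM lJ)|by apply: itgZ; exact: Ipsi|].
  move=> x; rewrite mulrCA ler_wpM2l ?jtr_ge0// (le_trans (ler_norm _))//.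
  rewrite (le_trans (tens2_cut x L0 K0 qK))// ler_wpM2r ?psi_ge0//.
  by rewrite expr_div_n ler_wpM2r// invr_ge0 sqr_ge0.
have Fle L : 0 < L -> 4 * F L <= (D / L) ^+ 2 * intR (fun x => J x * psi L x).
  move=> L0; have [b1 b2] := base L L0; apply: le_trans b1.
  rewrite /F -intRZ; last exact: IJ.
  apply: le_intR => //; first by apply: itgZ; exact: IJ.
  by move=> x; rewrite mulrA ler_wpM2r// lerDl exprn_ge0.
(* Young's inequality for [J * psi L] and [D / L] on the cube: the cubic part is [J ^+ 3 * phi L],
   since [phi L] is the cube of [psi L], and is absorbed on the left. *)
have F1 L : 0 < L -> 4 * F L <= (D / L) ^+ 3 * (2 * L) ^+ N.
  move=> L0; have [b1 b2] := base L L0.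
  have I1 : itg (fun x => J x ^+ 3 * phi L x).
    have := itgB b2 (itgZ 4 (IJ L L0)).
    by congr itg; apply/funext => x; ring.
  have E : intR (fun x => (4 * J x + J x ^+ 3) * phi L x) =
      4 * F L + intR (fun x => J x ^+ 3 * phi L x).
    rewrite /F -intRZ; last exact: IJ.
    rewrite -intRD//; last by apply: itgZ; exact: IJ.
    by congr intR; apply/funext => x; ring.
  have dL0 : 0 <= D / L by rewrite divr_ge0// ltW.
  have : (D / L) ^+ 2 * intR (fun x => J x * psi L x) <=
      intR (fun x => J x ^+ 3 * phi L x) + (D / L) ^+ 3 * (2 * L) ^+ N.
    rewrite -(@intR_bx R N L (ltW L0)) -intRZ; last exact: Ipsi.
    rewrite -intRZ; last exact: itg_bx.
    rewrite -intRD//; last by apply: itgZ; exact: itg_bx.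
    apply: le_intR; [by apply: itgZ; exact: Ipsi|by apply: itgD => //; apply: itgZ; exact: itg_bx|].
    move=> x; have := psi_ge0 L x; have := psi_bx x L0; rewrite /phi tens_cut.
    case: (bxP L x) => _ p1 p0; last first.
      have -> : psi L x = 0 by apply/eqP; rewrite eq_le p1.
      by rewrite !mulr0 expr0n !mulr0 addr0.
    rewrite mulr1 -exprMn mulrC; apply: young_cube => //; exact: mulr_ge0.
  by rewrite E in b1; lra.
have c0 := @cut_c_gt0 R N.
have F2 L L' : 0 < L -> 2 * L <= L' ->
    intR (fun x => J x * bx L x) <= (@cut_c R N)^-1 * F L'.
  move=> L0 LL'; have L'0 : 0 < L' by lra.
  rewrite /F -intRZ; last exact: IJ.
  apply: le_intR; [exact: lJ.2|by apply: itgZ; exact: IJ|].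
  move=> x; rewrite mulrCA ler_wpM2l// ler_pdivlMl//.
  exact: tens_cut_lower.
have bxpsi L : 0 < L -> intR (fun x => J x * psi L x) <= intR (fun x => J x * bx L x).
  move=> L0; apply: le_intR; [exact: Ipsi|exact: lJ.2|].
  by move=> x; rewrite ler_wpM2l// psi_bx.
have bxphi L : 0 < L -> F L <= intR (fun x => J x * bx L x).
  move=> L0; apply: le_intR; [exact: IJ|exact: lJ.2|].
  move=> x; rewrite ler_wpM2l// /phi tens_cut.
  have := psi_ge0 L x; have := psi_bx x L0; have := bx_le1 L x.
  move=> b1 pb p0; rewrite exprS (le_trans _ pb)// ler_piMr//.
  by rewrite exprn_ile1// (le_trans pb).
have ci0 : 0 <= (@cut_c R N)^-1 by rewrite invr_ge0 ltW.
have a0 j : F (2 ^+ j) <= 0.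
  apply: (@geometric_decay (fun k => F (2 ^+ k)) (4^-1 * D ^+ 2 * (@cut_c R N)^-1)
    (D ^+ 3 * 2 ^+ N) (@cut_c R N)^-1 N).
  - by rewrite mulr_ge0// mulr_ge0 ?exprn_ge0// invr_ge0.
  - by rewrite mulr_ge0 ?exprn_ge0.
  - by [].
  - move=> k; have k0 : 0 < (2 : R) ^+ k by rewrite exprn_gt0.
    have h1 := Fle _ k0; have h2 := F2 _ (2 ^+ k.+1) k0; rewrite exprS in h2.
    have {}h2 := le_trans (bxpsi _ k0) (h2 (lexx _)).
    have E : (D / 2 ^+ k) ^+ 2 = D ^+ 2 * 4^-1 ^+ k.
      by rewrite expr_div_n -exprM mulnC exprM exprVn (_ : 2 ^+ 2 = 4 :> R)//; ring.
    have h3 : 4 * F (2 ^+ k) <= (D / 2 ^+ k) ^+ 2 * ((@cut_c R N)^-1 * F (2 * 2 ^+ k)).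
      by apply: (le_trans h1); rewrite ler_wpM2l ?sqr_ge0.
    move: h3; rewrite E [2 ^+ k.+1]exprS.
    exact: quarter_le.
  - move=> k; have k0 : 0 < (2 : R) ^+ k by rewrite exprn_gt0.
    have Fk0 : 0 <= F (2 ^+ k) by apply: intR_ge0 => x; rewrite mulr_ge0.
    apply: (@le_trans _ _ (4 * F (2 ^+ k))); first by rewrite ler_peMl// ler1n.
    apply: (le_trans (F1 _ k0)); rewrite [(2 * _) ^+ N]exprMn [2 ^+ k ^+ N]exprAC mulrA ler_wpM2r ?exprn_ge0//.
    rewrite ler_wpM2r ?exprn_ge0// expr_div_n ler_pdivrMr ?exprn_gt0//.
    by rewrite ler_peMr ?exprn_ge0// !exprn_ege1// ler1n.
  - move=> i k ik; have i0 : 0 < (2 : R) ^+ i by rewrite exprn_gt0.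
    rewrite (le_trans (bxphi _ i0))// F2// -exprS.
    by apply: ler_weXn2l => //; rewrite ler1n.
have bx0 k : {ae mu, forall x, J x * bx (2 ^+ k) x = 0}.
  apply: ae_of_intR0; [exact: lJ.2|by move=> x; rewrite mulr_ge0 ?bx_ge0|].
  have k0 : 0 < (2 : R) ^+ k by rewrite exprn_gt0.
  rewrite (le_trans (F2 _ (2 ^+ k.+1) k0 _))//; first by rewrite exprS.
  by rewrite mulr_ge0_le0// invr_ge0 ltW.
move/ae_forall_nat: bx0; apply: filterS => x Jx.
apply: jtr_eq0; pose t := \sum_i `|x ord0 i|.
(* Every point lies in one of the dyadic cubes, as [2 ^+ n > n]. *)
have := Jx (Num.trunc t).+1; rewrite bx1 ?mulr1// => i.
rewrite (le_trans (y := t))//; first by rewrite /t (bigD1 i)//= lerDl sumr_ge0.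
rewrite (le_trans (ltW (truncnS_gt t)))// -natrX ler_nat.
exact/ltnW/ltn_expl.
Qed.

End liouville.

(** * Interior maxima, second differences and reflections *)

Section maximum_principle.
Context {R : realType} {N : nat}.
Local Notation V := 'rV[R]_N.
Implicit Types (x y z : V) (i j : 'I_N) (F U G W : V -> R).

Lemma continuous_of_lip F :
  (forall x, exists C : R, forall z, (forall i, `|z ord0 i| <= 1) ->
    `|F (x + z) - F x| <= C * \sum_i `|z ord0 i|) -> continuous F.
Proof.
move=> H x; have [C hC] := H x.
apply/(@cvgrPdist_le _ _ _ _ (nbhs_filter x)) => e e0.
have C0 : 0 < `|C| * N%:R + 1 by rewrite ltr_wpDl// mulr_ge0.
pose d := Num.min 1 (e / (`|C| * N%:R + 1)).
have d0 : 0 < d by rewrite lt_min ltr01 divr_gt0.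
have d1 : d <= 1 by rewrite ge_min lexx.
have de : d <= e / (`|C| * N%:R + 1) by rewrite ge_min lexx orbT.
apply/nbhs_ballP; exists d => //= y xy.
have yx i : `|(y - x) ord0 i| <= d.
  by rewrite !mxE distrC ltW//; have [_ /(_ ord0 i)] := xy.
rewrite distrC -(subrK x y) [_ + x]addrC (le_trans (hC _ _))//.
  by move=> i; exact: le_trans (yx i) d1.
rewrite (le_trans (y := `|C| * (\sum_(i < N) d)))//.
  rewrite (le_trans (y := `|C| * \sum_i `|(y - x) ord0 i|))//.
    by rewrite ler_wpM2r ?ler_norm// sumr_ge0.
  by rewrite ler_wpM2l// ler_sum.
rewrite sumr_const card_ord -[d *+ N]mulr_natl mulrA.
rewrite (le_trans (ler_wpM2l _ de)) ?mulr_ge0//.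
rewrite mulrCA ger_pMr// ler_pdivrMr// mul1r lerDl//.
Qed.

Lemma fin_pos_lower (f : 'I_N -> R) : (forall i, 0 < f i) ->
  exists2 d : R, 0 < d & forall i, d <= f i.
Proof.
move=> f0; have s0 : 0 < \sum_i (f i)^-1 + 1.
  by rewrite ltr_wpDl// sumr_ge0// => i _; rewrite invr_ge0 ltW.
exists (\sum_i (f i)^-1 + 1)^-1; first by rewrite invr_gt0.
move=> i; rewrite invf_ple ?posrE// (bigD1 i)//= -addrA lerDl.
by rewrite addr_ge0// sumr_ge0// => j _; rewrite invr_ge0 ltW.
Qed.

(** The sign on the faces forces the maximum over the compact box inside, and there each second
    difference is nonpositive as long as both neighbours stay in the box. *)
Lemma max_interior F (a b : 'I_N -> R) x0 : continuous F ->
  (forall x, (forall i, a i <= x ord0 i <= b i) ->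
    (exists i, x ord0 i = a i \/ x ord0 i = b i) -> F x <= 0) ->
  (forall i, a i <= x0 ord0 i <= b i) -> 0 < F x0 ->
  exists x, [/\ forall i, a i < x ord0 i < b i, F x0 <= F x &
    exists2 d : R, 0 < d & forall h, `|h| <= d -> dlap h F x <= 0].
Proof.
move=> cF bd x0K Fx0.
pose K := [set x : V | forall i, `[a i, b i]%classic (x ord0 i)].
have KP x : K x <-> forall i, a i <= x ord0 i <= b i.
  by split=> h i; have := h i; rewrite /= in_itv.
have cK : compact K by apply: (@rV_compact _ N (fun i => `[a i, b i]%classic)) => i; exact: segment_compact.
have K0 : K !=set0 by exists x0; apply/KP.
have [x xK hx] := EVT_max_rV K0 cK (continuous_subspaceT cF).
have {}hx y : (forall i, a i <= y ord0 i <= b i) -> F y <= F x.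
  by move=> yK; apply: hx; rewrite inE; apply/KP.
have {}xK : forall i, a i <= x ord0 i <= b i by apply/KP; rewrite inE in xK.
have Fx : F x0 <= F x by exact: hx.
have Fxp : 0 < F x by exact: lt_le_trans Fx.
have xi i : a i < x ord0 i < b i.
  have /andP[ax xb] := xK i; rewrite !lt_neqAle ax xb !andbT; apply/andP; split; apply/eqP => e.
    by have := bd x xK (ex_intro _ i (or_introl (esym e))); rewrite leNgt Fxp.
  by have := bd x xK (ex_intro _ i (or_intror e)); rewrite leNgt Fxp.
exists x; split => //.
have [d d0 hd] := @fin_pos_lower (fun i => Num.min (x ord0 i - a i) (b i - x ord0 i))
  (fun i => ltac:(have /andP[? ?] := xi i; by rewrite lt_min !subr_gt0; apply/andP)).
exists d => // h hh.
have inK i t : `|t| <= d -> F (x + t *: e_ i) <= F x.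
  move=> td; apply: hx => j; rewrite coordE.
  have := hd j; rewrite le_min => /andP[h1 h2].
  have /andP[xa xb] := xK j.
  have : `|t * (j == i)%:R| <= d.
    by case: (j == i); rewrite ?mulr1// mulr0 normr0 ltW.
  by rewrite ler_norml => /andP[h3 h4]; apply/andP; split; lra.
apply: sumr_le0 => i _; rewrite /sdiff -scaleNr.
have h1 := inK i h hh; have h2 : F (x + (- h) *: e_ i) <= F x by apply: inK; rewrite normrN.
lra.
Qed.

(** The equation Laplacian U = G in pointwise discrete form. [C] may depend on the point, since [h]
    tends to 0 at a fixed maximum point. *)
Definition qlap U G := forall x, exists C : R, forall h, `|h| <= 1 ->
  `|dlap h U x - h ^+ 2 * G x| <= C * `|h| ^+ 3.

Lemma qlapN U G : qlap U G -> qlap (fun x => - U x) (fun x => - G x).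
Proof.
move=> q x; have [C hC] := q x; exists C => h h1.
have -> : dlap h (fun x => - U x) x = - dlap h U x.
  rewrite /dlap -sumrN; apply: eq_bigr => i _; rewrite /sdiff.
  by move: (U _) (U _) (U _) => *; ring.
by rewrite mulrN -opprD normrN; exact: hC.
Qed.

Definition refl i y : V := \row_j (if j == i then - y ord0 j else y ord0 j).

Lemma refl_shift i j y (h : R) :
  refl i (y + h *: e_ j) = refl i y + (if j == i then - h else h) *: e_ j.
Proof.
apply/rowP => k; rewrite !mxE eqxx /=.
have [ki|ki] := eqVneq k i.
  rewrite ki; have [ij|ij] := eqVneq i j; last by rewrite !mulr0 !addr0.
  by rewrite !mulr1 opprD.
by have [kj|kj] := eqVneq k j; rewrite ?mulr0// -kj (negbTE ki).
Qed.

(** Reflection exchanges the two neighbours in direction [i], which a second difference does not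
    see. *)
Lemma dlap_refl i h U x y :
  dlap h (fun y => U (x + refl i y)) y = dlap h U (x + refl i y).
Proof.
apply: eq_bigr => j _; rewrite /sdiff -scaleNr !refl_shift !addrA.
have [->|ji] := eqVneq j i; last by [].
by rewrite opprK [X in X - _ = _]addrC.
Qed.

Lemma continuous_refl U i x : continuous U -> continuous (fun y => U (x + refl i y)).
Proof.
move=> cU y; apply: (@continuous_comp _ _ _ (fun y => x + refl i y) U); last exact: cU.
move=> A /nbhs_ballP[e e0 eA]; apply/nbhs_ballP; exists e => //= z [_ yz].
apply: eA; split => // k l; have := yz k l; rewrite /ball/= !mxE.
rewrite opprD addrACA subrr add0r (ord1 k).
by case: eqP => [->|//]; rewrite opprK -normrN opprD opprK.
Qed.

End maximum_principle.

(** * Gradient bound by reflection and a barrier *)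

Section gradient_bound.
Context {R : realType} {N : nat}.
Local Notation V := 'rV[R]_N.
Implicit Types (x y z : V) (i j : 'I_N) (F U G W : V -> R) (h t d M K r : R).

Definition sumsq y : R := \sum_k y ord0 k ^+ 2.

Lemma sumsq_ge0 y : 0 <= sumsq y.
Proof. by apply: sumr_ge0 => k _; rewrite sqr_ge0. Qed.

Lemma sumsq_ge y i : y ord0 i ^+ 2 <= sumsq y.
Proof. by rewrite /sumsq (bigD1 i)//= lerDl sumr_ge0// => k _; rewrite sqr_ge0. Qed.

Lemma sumsq_shift y h j : sumsq (y + h *: e_ j) = sumsq y + 2 * h * y ord0 j + h ^+ 2.
Proof.
rewrite /sumsq (bigD1 j)//= [in RHS](bigD1 j)//= coordE eqxx mulr1.
rewrite (eq_bigr (fun k => y ord0 k ^+ 2)); first by ring.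
by move=> k /negbTE kj; rewrite coordE kj mulr0 addr0.
Qed.

Lemma sdiff_sumsq h j y : sdiff h j sumsq y = 2 * h ^+ 2.
Proof. by rewrite /sdiff -scaleNr !sumsq_shift; ring. Qed.

Lemma dlap_sumsq h y : dlap h sumsq y = 2 * N%:R * h ^+ 2.
Proof.
rewrite /dlap (eq_bigr (fun=> 2 * h ^+ 2)); last by move=> j _; exact: sdiff_sumsq.
by rewrite sumr_const card_ord -[LHS]mulr_natl; ring.
Qed.

Lemma continuous_coord (f : R -> R) i : continuous f -> continuous (fun y => f (y ord0 i)).
Proof.
move=> cf y; apply: (@continuous_comp _ _ _ (fun x : V => x ord0 i) f); last exact: cf.
exact: coord_continuous.
Qed.

Lemma continuousDf F G : continuous F -> continuous G -> continuous (fun y => F y + G y).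
Proof. by move=> cF cG y; apply: continuousD; [exact: cF|exact: cG]. Qed.

Lemma continuousBf F G : continuous F -> continuous G -> continuous (fun y => F y - G y).
Proof. by move=> cF cG y; apply: continuousB; [exact: cF|exact: cG]. Qed.

Lemma continuousZf r F : continuous F -> continuous (fun y => r * F y).
Proof. by move=> cF y; apply: continuousM; [exact: cst_continuous|exact: cF]. Qed.

Lemma continuous_shiftf x F : continuous F -> continuous (fun y => F (x + y)).
Proof.
move=> cF y; apply: (@continuous_comp _ _ _ (fun y => x + y) F); last exact: cF.
move=> A /nbhs_ballP[e e0 eA]; apply/nbhs_ballP; exists e => //= z [_ yz].
apply: eA; split => // k l; have := yz k l; rewrite /ball/= !mxE.
by rewrite opprD addrACA subrr add0r.
Qed.

Lemma continuous_sumsq : continuous sumsq.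
Proof.
have H (s : seq 'I_N) : continuous (fun y => \sum_(k <- s) y ord0 k ^+ 2).
  elim: s => [|k s IH].
    rewrite (_ : (fun y => _) = cst 0); first exact: cst_continuous.
    by apply/funext => y; rewrite big_nil.
  rewrite (_ : (fun y => _) = fun y => y ord0 k ^+ 2 + \sum_(l <- s) y ord0 l ^+ 2).
    apply: continuousDf => //; apply: (@continuous_coord (fun t => t ^+ 2)).
    exact: exprn_continuous.
  by apply/funext => y; rewrite big_cons.
exact: H.
Qed.

Lemma sdiff_linear h j (a b c : R) F1 F2 F3 y :
  sdiff h j (fun y => a * F1 y + b * F2 y + c * F3 y) y =
  a * sdiff h j F1 y + b * sdiff h j F2 y + c * sdiff h j F3 y.
Proof. by rewrite /sdiff; ring. Qed.

(* Maximum principle on a box with [0 < y_i < 1] for [w y], the difference of   *)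
(* [U] at [x + y] and at its mirror image in [y_i = 0], which vanishes on that *)
(* hyperplane, against a barrier [B] that is concave in [y_i].                  *)
Lemma odd_difference_bound U G M K : continuous U -> (forall x, `|U x| <= M) ->
  (forall x, `|G x| <= K) -> qlap U G ->
  forall x i t, 0 < t -> t < 1 ->
  U (x + t *: e_ i) - U (x - t *: e_ i) <= (2 * M + K) * t.
Proof.
move=> cU UM GK qU x i t t0 t1.
have M0 : 0 <= M := le_trans (normr_ge0 _) (UM 0).
have K0 : 0 <= K := le_trans (normr_ge0 _) (GK 0).
rewrite -subr_le0; apply: (@ler_linear_eps _ _ (N%:R + 2)) => d d0 d1.
(* With this value the Laplacian of the barrier is [- 2 * K - 2 * d], strictly below the lower bound
   [- 2 * K] for that of [w]. *)
pose K1 := K + d * N%:R + d.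
have K10 : 0 <= K1 by rewrite /K1 !addr_ge0 ?mulr_ge0// ltW.
pose w y := U (x + y) - U (x + refl i y).
pose B y := 2 * M * y ord0 i + K1 * (y ord0 i * (1 - y ord0 i)) + d * sumsq y.
pose F y := w y - B y.
have wM y : w y <= 2 * M.
  have := UM (x + y); have := UM (x + refl i y); rewrite !ler_norml /w; lra.
have cF : continuous F.
  apply: continuousBf.
    by apply: continuousBf; [exact: continuous_shiftf|exact: continuous_refl].
  apply: continuousDf; last by apply: continuousZf; exact: continuous_sumsq.
  apply: (@continuous_coord (fun s => 2 * M * s + K1 * (s * (1 - s)))).
  by move=> s; apply: differentiable_continuous.
(* On the lateral faces the penalty [d * sumsq y] alone reaches [2 * M], the bound for [w]. *)
pose rr := 2 * M / d + 1.
have rr1 : 1 <= rr by rewrite lerDr divr_ge0 ?mulr_ge0// ltW.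
have drr : 2 * M <= d * rr ^+ 2.
  apply: (@le_trans _ _ (d * rr)).
    by rewrite /rr mulrDr mulrCA divff ?gt_eqF// !mulr1 lerDl ltW.
  by rewrite ler_pM2l// expr2 ler_peMl// (le_trans ler01).
pose a j := if j == i then 0 else - rr; pose b j := if j == i then 1 else rr.
have te j : (0 + t *: e_ i : V) ord0 j = t * (j == i)%:R by rewrite coordE mxE add0r.
have sq0 : sumsq (0 : V) = 0 by rewrite /sumsq big1// => k _; rewrite mxE expr0n.
have Fte : F (0 + t *: e_ i) <= 0.
  rewrite leNgt; apply/negP => Fp.
  have [||y [yK _ [eta eta0 hy]]] := @max_interior _ _ F a b (0 + t *: e_ i) cF _ _ Fp.
  - move=> y yK [j yj]; have s0 := sumsq_ge0 y.
    have := yK i; rewrite /a /b eqxx => /andP[yi0 yi1].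
    have p0 : 0 <= y ord0 i * (1 - y ord0 i) by rewrite mulr_ge0// subr_ge0.
    have p1 : 0 <= K1 * (y ord0 i * (1 - y ord0 i)) by rewrite mulr_ge0.
    have p2 : 0 <= d * sumsq y by rewrite mulr_ge0// ltW.
    have p3 : 0 <= 2 * M * y ord0 i by rewrite !mulr_ge0.
    rewrite /F subr_le0 /B; move: yj; rewrite /a /b.
    have [->|ji] := eqVneq j i => -[yj|yj].
    + rewrite /w (_ : refl i y = y) ?subrr; first by lra.
      apply/rowP => k; rewrite mxE; case: eqP => // ->.
      by rewrite (_ : y 0 i = 0) ?oppr0//; exact: yj.
    + by rewrite (le_trans (wM y))// yj; rewrite yj in p1 p3; lra.
    + have := sumsq_ge y j; rewrite yj sqrrN => /(ler_wpM2l (ltW d0)) h1.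
      by rewrite (le_trans (wM y))//; lra.
    + have := sumsq_ge y j; rewrite yj => /(ler_wpM2l (ltW d0)) h1.
      by rewrite (le_trans (wM y))//; lra.
  - move=> j; rewrite te /a /b; case: eqP => _; rewrite ?mulr1 ?mulr0 ?(ltW t0) ?(ltW t1)//.
    by rewrite oppr_le0 (le_trans ler01 rr1).
  have [C1 hC1] := qU (x + y); have [C2 hC2] := qU (x + refl i y).
  have dB h : dlap h B y = - 2 * K1 * h ^+ 2 + d * (2 * N%:R * h ^+ 2).
    have E j : sdiff h j B y = (if j == i then - 2 * K1 * h ^+ 2 else 0) + d * (2 * h ^+ 2).
      rewrite /B sdiff_linear sdiff_sumsq; congr (_ + _).
      rewrite /sdiff -scaleNr !coordE.
      by have [_|_] := eqVneq j i; rewrite ?mulr1 ?mulr0; ring.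
    rewrite /dlap (eq_bigr _ (fun j _ => E j)) big_split/= -big_mkcond big_pred1_eq.
    by rewrite sumr_const card_ord -[X in _ + X]mulr_natl; ring.
  have dF h : dlap h F y = dlap h U (x + y) - dlap h U (x + refl i y) - dlap h B y.
    rewrite -(dlap_refl i) /dlap -!sumrB; apply: eq_bigr => j _.
    rewrite /sdiff /F /w /= ![x + (y + _)]addrA.
    by move: (U _) (U _) (U _) (U _) (U _) (U _) (B _) (B _) (B _) => *; ring.
  have : d <= 0.
    apply: (@ler_linear_eps _ _ (`|C1| + `|C2| + d / eta)) => h h0 h1.
    have nh : `|h| = h by rewrite gtr0_norm.
    have h1' : `|h| <= 1 by rewrite nh.
    have de0 : 0 <= d / eta by rewrite divr_ge0// ltW.
    (* The sign at the maximum is known only for steps up to [eta]; beyond it, [d <= d / eta * h] is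
       immediate. *)
    have [he|eh] := leP h eta; last first.
      rewrite mulrDl (le_trans (y := d / eta * h))//.
        by rewrite mulrAC ler_pdivlMr// ler_pM2l// ltW.
      by rewrite lerDr mulr_ge0 ?addr_ge0// ltW.
    have := hy h; rewrite nh => /(_ he); rewrite dF dB.
    have := hC1 h h1'; have := hC2 h h1'; rewrite nh.
    have h20 : 0 < h ^+ 2 by rewrite exprn_gt0.
    have := GK (x + y); have := GK (x + refl i y).
    rewrite !ler_norml => /andP[_ g2] /andP[g1 _] /andP[_ e2] /andP[e1 _] e3.
    have {}g2 := ler_wpM2l (ltW h20) g2; have {}g1 := ler_wpM2l (ltW h20) g1.
    have c1 : C1 * h ^+ 3 <= `|C1| * h ^+ 3 by rewrite ler_wpM2r ?ler_norm ?exprn_ge0// ltW.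
    have c2 : C2 * h ^+ 3 <= `|C2| * h ^+ 3 by rewrite ler_wpM2r ?ler_norm ?exprn_ge0// ltW.
    rewrite -(ler_pM2l h20) (_ : h ^+ 2 * (_ * h) = `|C1| * h ^+ 3 + `|C2| * h ^+ 3 +
      d / eta * h ^+ 3); last by move: `|C1| `|C2| (d / eta) => *; ring.
    have : 0 <= d / eta * h ^+ 3 by rewrite mulr_ge0 ?exprn_ge0// ltW.
    have : 0 <= h ^+ 2 * d by rewrite mulr_ge0 ?sqr_ge0// ltW.
    have : 0 <= `|C1| * h ^+ 3 by rewrite mulr_ge0 ?exprn_ge0// ltW.
    have : 0 <= `|C2| * h ^+ 3 by rewrite mulr_ge0 ?exprn_ge0// ltW.
    move: (dlap h U _) (dlap h U _) (h ^+ 3) e1 e2 e3 c1 c2 => p q h3.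
    move: (G _) (G _) (`|C1|) (`|C2|) g1 g2 (d / eta) => gg1 gg2 cc1 cc2.
    rewrite /K1; move: (h ^+ 2) => h2; clear; move=> *; lra.
  by rewrite leNgt d0.
have wE : w (0 + t *: e_ i) = U (x + t *: e_ i) - U (x - t *: e_ i).
  rewrite /w refl_shift eqxx add0r (_ : refl i 0 = 0) ?add0r ?scaleNr//.
  by apply/rowP => k; rewrite !mxE oppr0; case: ifP.
rewrite -wE; move: Fte; rewrite /F /B te eqxx mulr1 sumsq_shift sq0 mxE mulr0 add0r addr0.
rewrite /K1; move: (w _) => W h1.
have n0 : 0 <= N%:R :> R by [].
have : t ^+ 2 <= 1 by rewrite exprn_ile1// ltW.
have : 0 <= t ^+ 2 by rewrite sqr_ge0.
have : d * N%:R * t <= d * N%:R by rewrite ler_piMr ?mulr_ge0// ltW.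
have : d * t <= d by rewrite ler_piMr// ltW.
have : 0 <= K1 * t ^+ 2 by rewrite mulr_ge0 ?sqr_ge0.
have : d * t ^+ 2 <= d by rewrite ler_piMr ?exprn_ile1// ltW.
rewrite /K1; nra.
Qed.

End gradient_bound.

(** * Lipschitz representatives of bounded solutions *)

Section lipschitz_representative.
Context {R : realType} {N : nat}.
Local Notation V := 'rV[R]_N.
Local Notation mu := (lebesgue_rV R N).
Implicit Types (x y z : V) (i j : 'I_N) (u g f U : V -> R) (h t d e M K r L : R).

Lemma continuous_mol e u : 0 < e -> locint u -> continuous (mol e u).
Proof.
move=> e0 lu; apply: continuous_of_lip => x.
have [C C0 hC] := mol_lip (\sum_i `|x ord0 i|) e0 lu.
exists C => z z1; apply: hC => // i.
by rewrite (bigD1 i)//= lerDl sumr_ge0.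
Qed.

Lemma qlap_mol e u g : 0 < e -> locint u -> weak_lap u g -> qlap (mol e u) (mol e g).
Proof.
move=> e0 lu wug x; have [C C0 hC] := mol_taylor (\sum_i `|x ord0 i|) e0 lu.
exists C => h h1; rewrite /mol -wug//; apply: hC => // i.
by rewrite (bigD1 i)//= lerDl sumr_ge0.
Qed.

Lemma mol_coord_lip e u g M K : 0 < e -> mfun_rV u -> mfun_rV g ->
  (forall x, `|u x| <= M) -> (forall x, `|g x| <= K) -> weak_lap u g ->
  forall x i h, `|mol e u (x + h *: e_ i) - mol e u x| <= (2 * M + K) * `|h|.
Proof.
move=> e0 mu_ mg uM gK wug.
have lu := locint_bounded mu_ uM; have lg := locint_bounded mg gK.
have M0 : 0 <= M := le_trans (normr_ge0 _) (uM 0).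
have K0 : 0 <= K := le_trans (normr_ge0 _) (gK 0).
have cU := continuous_mol e0 lu; have qU := qlap_mol e0 lu wug.
have UM x : `|mol e u x| <= M := mol_le x e0 mu_ uM.
have GK x : `|mol e g x| <= K := mol_le x e0 mg gK.
set U := mol e u in cU qU UM *; set G := mol e g in qU GK *.
clearbody U G.
have cU' : continuous (fun x => - U x) by move=> x; apply: continuousN; exact: cU.
have UM' x : `|- U x| <= M by rewrite normrN.
have GK' x : `|- G x| <= K by rewrite normrN.
(* For [h >= 2] the sup bound suffices; otherwise the two points are mirror images about their
   midpoint, at distance [h / 2 < 1]. *)
have pos x i h : 0 < h -> `|U (x + h *: e_ i) - U x| <= (2 * M + K) * h.
  move=> h0; have [h2|h2] := leP 2 h.
    rewrite (le_trans (ler_normB _ _))// (le_trans (lerD (UM _) (UM _)))//.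
    have := ler_wpM2l M0 h2; have := mulr_ge0 K0 (ltW h0); nra.
  have t0 : 0 < h / 2 by rewrite divr_gt0.
  have t1 : h / 2 < 1 by rewrite ltr_pdivrMr// mul1r.
  have h1 := odd_difference_bound cU UM GK qU (x + (h / 2) *: e_ i) i t0 t1.
  have h3 := odd_difference_bound cU' UM' GK' (qlapN qU) (x + (h / 2) *: e_ i) i t0 t1.
  rewrite addrK -addrA -scalerDl -splitr in h1 h3.
  have hh : (2 * M + K) * (h / 2) <= (2 * M + K) * h.
    apply: ler_wpM2l; first by rewrite addr_ge0 ?mulr_ge0.
    by rewrite ler_pdivrMr// ler_peMr ?(ltW h0)// ler1n.
  have h4 := le_trans h1 hh; have h5 := le_trans h3 hh.
  rewrite ler_norml h4 andbT lerNl opprB.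
  by move: h5 => /=; rewrite opprK [- _ + _]addrC.
move=> x i h; have [h0|h0|->] := ltgtP h 0; last first.
- by rewrite scale0r addr0 subrr normr0 mulr0.
- by rewrite (gtr0_norm h0); exact: pos.
rewrite (ltr0_norm h0); have := pos (x + h *: e_ i) i (- h).
by rewrite oppr_gt0 => /(_ h0); rewrite scaleNr addrK distrC.
Qed.

(** The l1 norm is the one for which coordinatewise bounds add up without loss. *)
Definition lip1 L f := forall x z, `|f (x + z) - f x| <= L * \sum_i `|z ord0 i|.

Lemma lip1_coord L f : (forall x i h, `|f (x + h *: e_ i) - f x| <= L * `|h|) -> lip1 L f.
Proof.
move=> H x z.
have E : z = \sum_(i < N) z ord0 i *: e_ i by exact: row_sum_delta.
have claim (s : seq 'I_N) :
    `|f (x + \sum_(i <- s) z ord0 i *: e_ i) - f x| <= L * \sum_(i <- s) `|z ord0 i|.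
  elim: s => [|i s IH]; first by rewrite !big_nil addr0 subrr normr0 mulr0.
  rewrite !big_cons [_ *: _ + _]addrC addrA mulrDr.
  rewrite -(subrKA (f (x + \sum_(j <- s) z ord0 j *: e_ j))).
  by rewrite (le_trans (ler_normD _ _))// lerD.
by rewrite {1}E.
Qed.

Lemma lip1_continuous L f : lip1 L f -> continuous f.
Proof. by move=> lf; apply: continuous_of_lip => x; exists L. Qed.

Lemma lip1B L L' f g : lip1 L f -> lip1 L' g -> lip1 (L + L') (fun x => f x - g x).
Proof.
move=> lf lg x z; rewrite mulrDl opprB addrACA [_ - f x]addrC.
rewrite (_ : _ + _ = (f (x + z) - f x) - (g (x + z) - g x)); last by ring.
by rewrite (le_trans (ler_normB _ _))// lerD.
Qed.

(** Averaging over the cube of half-side [d] around [x], where [f] varies by at most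
    [L * (N%:R * d)]. This converts smallness in L1 into smallness at a point. *)
Lemma lip1_point L f x d : 0 <= L -> lip1 L f -> mfun_rV f -> 0 < d -> 
  `|f x| <= L * (N%:R * d) + (2 * d) ^- N * intR (fun y => `|f y| * bx d (y - x)).
Proof.
move=> L0 lf mf d0.
have cd : 0 < (2 * d) ^+ N by rewrite exprn_gt0// mulr_gt0.
have fb y : bx d (y - x) != 0 -> `|f y - f x| <= L * (N%:R * d).
  case: (bxP d (y - x)) => [yx _|]; last by rewrite eqxx.
  have := lf x (y - x); rewrite [x + _]addrC subrK => h; apply: (le_trans h).
  rewrite ler_wpM2l// (le_trans (y := \sum_(i < N) d))//; first exact: ler_sum.
  by rewrite sumr_const card_ord -[d *+ N]mulr_natl.
have I1 : itg (fun y : V => bx d (y - x)) by apply: itg_shift; exact: itg_bx.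
have I2 : itg (fun y => `|f y| * bx d (y - x)).
  apply: (le_itg (g := fun y => (`|f x| + L * (N%:R * d)) * bx d (y - x))); last exact: itgZ.
    by apply: measurable_funM; [exact: measurableT_comp|exact: itg_mfun I1].
  move=> y; rewrite normrM normr_id [`|bx _ _|]ger0_norm ?bx_ge0//.
  have [->|by0] := eqVneq (bx d (y - x)) 0; first by rewrite !mulr0.
  rewrite ler_wpM2r ?bx_ge0// -[f y](subrK (f x)) [leRHS]addrC.
  by rewrite (le_trans (ler_normD _ _))// lerD// fb.
rewrite -lerBlDl -(ler_pM2l cd) [leRHS]mulrA divff ?gt_eqF// mul1r.
rewrite -(@intR_bx R N d (ltW d0)) -[X in X * _](@intR_shift R N (- x)); last exact: mfun_bx.
rewrite mulrC -intRZ//; apply: le_intR => //; first exact: itgZ.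
move=> y; have [->|by0] := eqVneq (bx d (y - x)) 0; first by rewrite !mulr0.
rewrite ler_wpM2r ?bx_ge0// lerBlDl.
by rewrite -[f x](subrK (f y)) (le_trans (ler_normD _ _))// lerD// distrC fb.
Qed.

Lemma lip1_ae_eq L L' f g : 0 <= L -> 0 <= L' -> lip1 L f -> lip1 L' g ->
  mfun_rV f -> mfun_rV g -> {ae mu, forall x, f x = g x} -> f = g.
Proof.
move=> L0 L'0 lf lg mf mg fg; apply/funext => x.
have lfg := lip1B lf lg; have mfg : mfun_rV (fun y => f y - g y) by exact: measurable_funB.
apply/eqP; rewrite -subr_eq0 -normr_le0.
apply: (@ler_linear_eps _ _ ((L + L') * N%:R)) => d d0 _.
have := lip1_point x (addr_ge0 L0 L'0) lfg mfg d0.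
rewrite (_ : intR _ = 0) ?mulr0 ?addr0 ?mulrA//.
rewrite -[RHS](@intR0 R N) /intR /Rintegral; congr fine.
apply: ae_eq_integral => //.
- apply/measurable_EFinP; apply: measurable_funM; first exact: measurableT_comp.
  by apply: mfun_shift; exact: mfun_bx.
- by apply: filterS fg => y -> _; rewrite subrr normr0 mul0r.
Qed.

(** Mollifications at scale [1 / n.+1] share one Lipschitz constant and converge in local L1, so
    [lip1_point] makes them Cauchy at every point; the limit inherits the constant. *)
Lemma lipschitz_representative u g M K : mfun_rV u -> mfun_rV g ->
  (forall x, `|u x| <= M) -> (forall x, `|g x| <= K) -> weak_lap u g ->
  exists U, [/\ mfun_rV U, forall x, `|U x| <= M, lip1 (2 * M + K) U &
    {ae mu, forall x, u x = U x}].
Proof.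
move=> mu_ mg uM gK wug.
have lu := locint_bounded mu_ uM; have lg := locint_bounded mg gK.
have M0 : 0 <= M := le_trans (normr_ge0 _) (uM 0).
have K0 : 0 <= K := le_trans (normr_ge0 _) (gK 0).
pose en n : R := n.+1%:R^-1; have en0 n : 0 < en n by rewrite invr_gt0.
pose Un n := mol (en n) u.
have mUn n : mfun_rV (Un n) by exact: mfun_mol.
have UnM n x : `|Un n x| <= M by exact: mol_le.
pose L := 2 * M + K; have L0 : 0 <= L by rewrite addr_ge0 ?mulr_ge0.
have lUn n : lip1 L (Un n) by apply: lip1_coord => x i h; exact: mol_coord_lip gK wug _ _ _.
have lcUn n : locint (Un n) := locint_bounded (mUn n) (UnM n).
have conv1 r eta : 0 < eta -> exists n0 : nat, forall n, (n0 <= n)%N ->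
    intR (fun x => `|Un n x - u x| * bx r x) <= eta.
  move=> eta0; have [d d0 hd] := mol_L1 r lu eta0.
  exists (Num.trunc d^-1) => n hn; apply: hd => //.
  rewrite /en invf_ple ?posrE// (le_trans (ltW (truncnS_gt _)))//.
  by rewrite ler_nat.
have cvgUn x : cvg (Un n x @[n --> \oo]).
  apply: cauchy_cvg; apply: cauchy_exP => e e0.
  (* The oscillation term of [lip1_point], for a difference with constant [L + L], is then at most
     [e / 4]. *)
  pose d := e / (8 * (L * N%:R + 1)).
  have d0 : 0 < d by rewrite divr_gt0// mulr_gt0// ltr_wpDl// mulr_ge0.
  have cd : 0 < (2 * d) ^+ N by rewrite exprn_gt0// mulr_gt0.
  pose s := d + \sum_i `|x ord0 i|.
  have [n0 hn0] := conv1 s (e / 8 * (2 * d) ^+ N) (mulr_gt0 (divr_gt0 e0 (ltr0n R 8)) cd).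
  exists (Un n0 x); exists n0 => // n /= n0n; rewrite /ball/=.
  have Ib k : itg (fun y => `|Un k y - u y| * bx s y) by exact: itg_diff.
  have lUU := lip1B (lUn n0) (lUn n).
  have mUU : mfun_rV (fun y => Un n0 y - Un n y).
    by apply: measurable_funB; exact: mUn.
  have := lip1_point x (addr_ge0 L0 L0) lUU mUU d0.
  have hI : intR (fun y => `|Un n0 y - Un n y| * bx d (y - x)) <= e / 4 * (2 * d) ^+ N.
    rewrite (_ : e / 4 = e / 8 + e / 8); last by field.
    rewrite mulrDl (le_trans _ (lerD (hn0 n0 (leqnn _)) (hn0 n n0n)))// -intRD//.
    apply: le_intR; last 1 first.
    - move=> y; rewrite -mulrDl.
      apply: ler_pM; rewrite ?bx_ge0//.
        by rewrite -(subrKA (u y)) [`|Un n y - _|]distrC ler_normD.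
      rewrite -{2}(subrK x y); apply: bx_shift => i.
      by rewrite (bigD1 i)//= lerDl sumr_ge0.
    - have kb (y : V) : `|bx d y| <= 1 * bx d y by rewrite mul1r ger0_norm ?bx_ge0.
      exact: (itg_conv x (locint_norm (locintB (lcUn n0) (lcUn n))) (@mfun_bx R N d) kb).
    - exact: itgD.
  move=> h; apply: (le_lt_trans h).
  have -> : (L + L) * (N%:R * d) = (L * N%:R) / (L * N%:R + 1) * (e / 4).
    by rewrite /d; field; rewrite gt_eqF// ltr_wpDl// mulr_ge0.
  have h1 : (L * N%:R) / (L * N%:R + 1) * (e / 4) <= e / 4.
    rewrite ler_piMl ?divr_ge0 ?(ltW e0)// ler_pdivrMr ?mul1r ?lerDl//.
    by rewrite ltr_wpDl// mulr_ge0.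
  have h2 : (2 * d) ^- N * intR (fun y => `|Un n0 y - Un n y| * bx d (y - x)) <= e / 4.
    by rewrite ler_pdivrMl// mulrC.
  lra.
pose U x : R := limn (Un ^~ x).
have UnU x : Un n x @[n --> \oo] --> U x by exact: cvgUn.
have mU : mfun_rV U by apply: (measurable_fun_cvg mUn) => x _; exact: UnU.
have UM x : `|U x| <= M.
  have cn : `|Un n x| @[n --> \oo] --> `|U x| by apply: cvg_norm; exact: UnU.
  rewrite -(cvg_lim _ cn)//; apply: limr_le; first by apply/cvg_ex; eexists; exact: cn.
  by apply: nearW => n.
exists U; split => //.
  move=> x z.
  have cn : `|Un n (x + z) - Un n x| @[n --> \oo] --> `|U (x + z) - U x|.
    by apply: cvg_norm; apply: cvgB; exact: UnU.
  rewrite -(cvg_lim _ cn)//; apply: limr_le; first by apply/cvg_ex; eexists; exact: cn.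
  by apply: nearW => n; exact: lUn.
have loU := locint_bounded mU UM.
have Z r : intR (fun x => `|u x - U x| * bx r x) <= 0.
  have [|x||n x|_ cI] := @intR_cvg R N (fun n x => `|u x - Un n x| * bx r x)
      (fun x => `|u x - U x| * bx r x) (fun x => (M + M) * bx r x).
  - by move=> n; apply: itg_mfun; exact: itg_diff.
  - apply: cvgMr_tmp; apply: cvg_norm; apply: cvgB; first exact: cvg_cst.
    exact: UnU.
  - by apply: itgZ; exact: itg_bx.
  - rewrite normrM normr_id [`|bx r x|]ger0_norm ?bx_ge0// ler_wpM2r ?bx_ge0//.
    by rewrite (le_trans (ler_normB _ _))// lerD.
  apply/ler_addgt0Pl => e e0; rewrite addr0.
  rewrite -(cvg_lim _ cI)//; apply: limr_le; first by apply/cvg_ex; eexists; exact: cI.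
  have [n0 hn0] := conv1 r e e0; exists n0 => // n /= n0n.
  rewrite (le_trans _ (hn0 n n0n))// le_eqVlt; apply/orP; left; apply/eqP.
  by congr intR; apply/funext => x; rewrite distrC.
have aez k : {ae mu, forall x, `|u x - U x| * bx (2 ^+ k) x = 0}.
  apply: ae_of_intR0 => //; first exact: itg_diff.
  by move=> x; rewrite mulr_ge0 ?bx_ge0.
move/ae_forall_nat: aez; apply: filterS => x Jx.
pose t := \sum_i `|x ord0 i|.
have := Jx (Num.trunc t).+1; rewrite bx1 ?mulr1 => [/eqP|i].
  by rewrite normr_eq0 subr_eq0 => /eqP.
rewrite (le_trans (y := t))//; first by rewrite /t (bigD1 i)//= lerDl sumr_ge0.
rewrite (le_trans (ltW (truncnS_gt t)))// -natrX ler_nat.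
exact/ltnW/ltn_expl.
Qed.

End lipschitz_representative.

(** * Bounds on iterated difference quotients, and smoothness *)

Section difference_quotients.
Context {R : realType} {N : nat}.
Local Notation V := 'rV[R]_N.
Local Notation mu := (lebesgue_rV R N).
Implicit Types (x y z : V) (i j : 'I_N) (u v g f U : V -> R) (h t d e C L : R) (k : nat).

Definition quo h i u : V -> R := fun x => h^-1 * (u (x + h *: e_ i) - u x).

(* Membership in [Dk k C] amounts to bounds of all derivatives up to order [k], *)
(* and is stable under pointwise limits and products.                           *)
Fixpoint Dk k C u : Prop := (forall x, `|u x| <= C) /\
  if k is k'.+1 then forall i h, h != 0 -> Dk k' C (quo h i u) else True.

Lemma Dk_bound k C u : Dk k C u -> forall x, `|u x| <= C.
Proof. by case: k => [|k] []. Qed.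

Lemma Dk_le k C C' u : C <= C' -> Dk k C u -> Dk k C' u.
Proof.
move=> CC'; elim: k u => [|k IH] u [uC uk].
  by split => // x; exact: le_trans (uC x) CC'.
split => [x|i h h0]; first exact: le_trans (uC x) CC'.
exact/IH/uk.
Qed.

Lemma Dk_down k C u : Dk k.+1 C u -> Dk k C u.
Proof.
elim: k u => [|k IH] u [uC uk]; split => // i h h0.
by apply: IH; exact: uk.
Qed.

Lemma Dk_shift k C u z : Dk k C u -> Dk k C (fun x => u (x + z)).
Proof.
elim: k u => [|k IH] u [uC uk]; split => // i h h0.
rewrite (_ : quo h i _ = fun x => quo h i u (x + z)); first exact/IH/uk.
by apply/funext => x; rewrite /quo addrAC.
Qed.

Lemma Dk_add k C C' u v : Dk k C u -> Dk k C' v -> Dk k (C + C') (fun x => u x + v x).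
Proof.
elim: k u v => [|k IH] u v [uC uk] [vC vk].
  by split => // x; rewrite (le_trans (ler_normD _ _))// lerD.
split => [x|i h h0]; first by rewrite (le_trans (ler_normD _ _))// lerD.
rewrite (_ : quo h i _ = fun x => quo h i u x + quo h i v x).
  by apply: IH; [exact: uk|exact: vk].
by apply/funext => x; rewrite /quo; move: (u _) (u _) (v _) (v _) => *; ring.
Qed.

(** Discrete Leibniz rule: each order produces two products, hence the power of 2. *)
Lemma Dk_mul k C C' u v : Dk k C u -> Dk k C' v ->
  Dk k (2 ^+ k * (C * C')) (fun x => u x * v x).
Proof.
elim: k u v => [|k IH] u v Du Dv.
  by split => // x; rewrite expr0 mul1r normrM ler_pM// ?(Dk_bound Du)// (Dk_bound Dv).
have C0 : 0 <= C := le_trans (normr_ge0 _) (Dk_bound Du 0).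
have C'0 : 0 <= C' := le_trans (normr_ge0 _) (Dk_bound Dv 0).
split => [x|i h h0].
  rewrite (le_trans (y := 1 * (C * C')))//.
    by rewrite mul1r normrM ler_pM// ?(Dk_bound Du)// (Dk_bound Dv).
  by rewrite ler_wpM2r ?mulr_ge0// exprn_ege1// ler1n.
rewrite (_ : quo h i _ = fun x => quo h i u x * v (x + h *: e_ i) + u x * quo h i v x).
  rewrite exprS -mulrA [2 * _]mulr_natl mulr2n.
  apply: Dk_add; apply: IH.
  - by case: Du => _; exact.
  - exact/Dk_shift/Dk_down.
  - exact: Dk_down.
  - by case: Dv => _; exact.
by apply/funext => x; rewrite /quo; move: (u _) (u _) (v _) (v _) => *; ring.
Qed.

Lemma Dk_cst k (a : R) : Dk k `|a| (fun=> a).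
Proof.
have D0 l : Dk l `|a| (fun=> 0).
  elim: l => [|l IH]; first by split => // x; rewrite normr0.
  split => [x|i h h0]; first by rewrite normr0.
  by rewrite (_ : quo h i _ = fun=> 0)//; apply/funext => x; rewrite /quo subrr mulr0.
case: k => [|k]; split => // i h h0.
by rewrite (_ : quo h i _ = fun=> 0)//; apply/funext => x; rewrite /quo subrr mulr0.
Qed.

Lemma Dk_lim k C (F : nat -> V -> R) u : (forall n, Dk k C (F n)) ->
  (forall x, F n x @[n --> \oo] --> u x) -> Dk k C u.
Proof.
have bd (G : nat -> V -> R) w : (forall n x, `|G n x| <= C) ->
    (forall x, G n x @[n --> \oo] --> w x) -> forall x, `|w x| <= C.
  move=> GC Gw x.
  have cn : `|G n x| @[n --> \oo] --> `|w x| by apply: cvg_norm; exact: Gw.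
  rewrite -(cvg_lim _ cn)//; apply: limr_le; first by apply/cvg_ex; eexists; exact: cn.
  by apply: nearW => n.
elim: k F u => [|k IH] F u DF Fu.
  by split => //; apply: bd Fu => n; exact: Dk_bound (DF n).
split => [|i h h0]; first by apply: bd Fu => n; exact: Dk_bound (DF n).
apply: (IH (fun n => quo h i (F n))) => [n|x].
  by case: (DF n) => _; exact.
by apply: cvgMl_tmp; apply: cvgB; exact: Fu.
Qed.

Lemma Dk_lip C u : Dk 1 C u -> lip1 C u.
Proof.
move=> [_ uk]; apply: lip1_coord => x i h.
have [->|h0] := eqVneq h 0; first by rewrite scale0r addr0 subrr normr0 mulr0.
have [/(_ x) + _] := uk i h h0.
by rewrite /quo normrM normfV ler_pdivrMl ?normr_gt0// mulrC.
Qed.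

Lemma mfun_quo h i u : mfun_rV u -> mfun_rV (quo h i u).
Proof.
move=> mu_; apply: measurable_funM; first exact: measurable_cst.
by apply: measurable_funB => //; exact: mfun_shift.
Qed.

Lemma conv_quo (k : V -> R) h i u x C r : locint u -> mfun_rV k ->
  (forall y, `|k y| <= C * bx r y) -> conv k (quo h i u) x = quo h i (conv k u) x.
Proof.
move=> lu mk kC.
have I1 z : itg (fun y => u y * k (y - z)) by exact: itg_conv kC.
have I2 z : itg (fun y => u (y + z) * k (y - x)).
  by have := itg_conv x (locint_shift z lu) mk kC.
have E z : intR (fun y => u (y + z) * k (y - x)) = conv k u (x + z).
  rewrite /conv -[RHS](intR_shift z); last exact: itg_mfun (I1 _).
  by congr intR; apply/funext => y; rewrite opprD [- x - z]addrC addrA addrK.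
rewrite /quo -E -[conv k u x]/(intR (fun y => u y * k (y - x))).
have I3 := I1 x.
rewrite -intRB// -intRZ; last exact: itgB.
rewrite /conv; congr intR; apply/funext => y.
by move: (u _) (u _) (k _) => *; ring.
Qed.

Lemma weak_lap_quo h i u g : locint u -> locint g -> weak_lap u g ->
  weak_lap (quo h i u) (quo h i g).
Proof.
move=> lu lg wug e x e0.
have [C C0 rC] := rho_bound (N := N) e0; have [M bM] := be_bump e0.
rewrite (conv_quo h i x lg (mfun_rho e0) rC).
rewrite (conv_quo h i x lu (mfun_tens2 bM) (tens2_bound bM)).
by rewrite /quo -/(rho2 e) !wug.
Qed.

Lemma conv_ae (k : V -> R) u v x : mfun_rV u -> mfun_rV v -> mfun_rV k ->
  {ae mu, forall x, u x = v x} -> conv k u x = conv k v x.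
Proof.
move=> mu_ mv mk uv; rewrite /conv /intR /Rintegral; congr fine.
apply: ae_eq_integral => //.
- by apply/measurable_EFinP; apply: measurable_funM => //; exact: mfun_shift.
- by apply/measurable_EFinP; apply: measurable_funM => //; exact: mfun_shift.
- by apply: filterS uv => y -> _.
Qed.

Lemma weak_lap_ae u v g f : mfun_rV u -> mfun_rV v -> mfun_rV g -> mfun_rV f ->
  {ae mu, forall x, u x = v x} -> {ae mu, forall x, g x = f x} ->
  weak_lap u g -> weak_lap v f.
Proof.
move=> mu_ mv mg mf uv gf wug e x e0; have [M bM] := be_bump e0.
rewrite -(conv_ae x mu_ mv (mfun_tens2 bM) uv) -(conv_ae x mg mf (mfun_rho e0) gf).
exact: wug.
Qed.

(* A difference quotient of [u] solves the equation with the quotient of [g] as *)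
(* right-hand side, so that the Lipschitz estimate applies to it in turn.       *)
Lemma elliptic_gain k C C' u g : mfun_rV u -> mfun_rV g ->
  (exists2 L, 0 <= L & lip1 L u) -> weak_lap u g ->
  Dk k C u -> Dk k C' g -> Dk k.+1 (2 * C + C') u.
Proof.
elim: k u g => [|k IH] u g mu_ mg [L L0 lu] wug Du Dg.
  have uC := Dk_bound Du; have gC := Dk_bound Dg.
  have C0 : 0 <= C := le_trans (normr_ge0 _) (uC 0).
  have C'0 : 0 <= C' := le_trans (normr_ge0 _) (gC 0).
  have CC0 : 0 <= 2 * C + C' by rewrite addr_ge0 ?mulr_ge0.
  have [U [mU _ lU uU]] := lipschitz_representative mu_ mg uC gC wug.
  (* The assumed Lipschitz continuity turns equality almost everywhere into equality; its constant
     [L] does not enter the bound obtained. *)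
  have E : u = U := lip1_ae_eq L0 CC0 lu lU mu_ mU uU.
  rewrite -E in lU; split => [x|i h h0].
    by rewrite (le_trans (uC x))// mulr2n; lra.
  split => // x; rewrite /quo normrM normfV ler_pdivrMl ?normr_gt0// mulrC.
  apply: (le_trans (lU _ _)); rewrite ler_wpM2l// (bigD1 i)//= !mxE !eqxx/= mulr1.
  rewrite big1 ?addr0// => j ji; rewrite !mxE (negbTE ji) andbF mulr0 normr0//.
have uC := Dk_bound Du; have gC := Dk_bound Dg.
have C0 : 0 <= C := le_trans (normr_ge0 _) (uC 0).
have C'0 : 0 <= C' := le_trans (normr_ge0 _) (gC 0).
split => [x|i h h0]; first by rewrite (le_trans (uC x))//; lra.
apply: (IH (quo h i u) (quo h i g)).
- exact: mfun_quo.
- exact: mfun_quo.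
- exists (`|h^-1| * (L + L)); first by rewrite mulr_ge0 ?addr_ge0.
  move=> x z; rewrite /quo -mulrBr normrM -mulrA ler_wpM2l//.
  have h1 := lu (x + h *: e_ i) z; have h2 := lu x z.
  rewrite [x + h *: _ + z]addrAC in h1; rewrite mulrDl.
  apply: (le_trans _ (lerD h1 h2)).
  move: (u (x + z + h *: e_ i)) (u (x + z)) (u (x + h *: e_ i)) (u x) => p q r s.
  by rewrite (_ : p - q - (r - s) = (p - r) - (q - s)) ?ler_normB//; ring.
- apply: weak_lap_quo => //; [exact: locint_bounded uC|exact: locint_bounded gC].
- by case: Du => _; exact.
- by case: Dg => _; exact.
Qed.

(** The increment [p] is additive up to [C * |a| * |b|], so [p (n * a)] is [n * p a] up to
    [C * (n * a) ^+ 2]. Writing a step [h] as a multiple of a much smaller [a] plus a remainder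
    compares the two quotients and makes them Cauchy. *)
Lemma second_difference_cauchy (f : R -> R) C : 0 <= C ->
  (forall s t, `|f (s + t) - f s| <= C * `|t|) ->
  (forall a b, `|f (a + b) - f a - f b + f 0| <= C * `|a| * `|b|) ->
  cvg (h^-1 * (f h - f 0) @[h --> 0^']).
Proof.
move=> C0 lf sf.
pose p h := f h - f 0; pose q h := h^-1 * p h.
have pl h : `|p h| <= C * `|h| by have := lf 0 h; rewrite add0r.
have pp a b : `|p (a + b) - p a - p b| <= C * `|a| * `|b|.
  apply: le_trans (sf a b); rewrite le_eqVlt; apply/orP; left; apply/eqP.
  by congr (`|_|); rewrite /p; ring.
have pn a n : `|p (n%:R * a) - n%:R * p a| <= C * (n%:R * `|a|) ^+ 2.
  elim: n => [|n IH].
    by rewrite !mul0r subr0 /p subrr normr0 expr0n mulr0.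
  have n0 : 0 <= n%:R :> R by [].
  have -> : p (n.+1%:R * a) - n.+1%:R * p a =
     (p (n%:R * a + a) - p (n%:R * a) - p a) + (p (n%:R * a) - n%:R * p a).
    by rewrite -addn1 natrD !mulrDl !mul1r; ring.
  rewrite (le_trans (ler_normD _ _))// (le_trans (lerD (pp _ _) IH))//.
  rewrite normrM (ger0_norm n0) -!mulrA -mulrDr ler_wpM2l//.
  rewrite -[n.+1]addn1 natrD; move: (n%:R) n0 (normr_ge0 a) => m m0; move: `|a| => b b0.
  nra.
have qpos a h : 0 < a -> 0 < h -> a <= h -> `|q h - q a| <= C * h + C * a + 2 * C * (a / h).
  move=> a0 h0 ah; pose n := Num.trunc (h / a).
  have /andP[n1 n2] := @truncn_itv R (h / a) (divr_ge0 (ltW h0) (ltW a0)).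
  pose r := h - n%:R * a.
  have na : n%:R * a <= h by rewrite -ler_pdivlMr.
  have r0 : 0 <= r by rewrite subr_ge0.
  have ra : r <= a.
    have : h < n.+1%:R * a by rewrite -ltr_pdivrMr.
    by rewrite -addn1 natrD mulrDl mul1r /r; lra.
  have na0 : 0 <= n%:R * a by rewrite mulr_ge0// ltW.
  have hE : h = n%:R * a + r by rewrite /r; ring.
  have k1 := pp (n%:R * a) r; rewrite -hE in k1.
  have k2 := pn a n; have k3 := pl r; have k4 := pl a.
  rewrite (ger0_norm na0) (ger0_norm r0) in k1; rewrite (gtr0_norm a0) in k2 k4.
  rewrite (ger0_norm r0) in k3.
  have k5 : `|r * q a| <= C * a.
    have qa : `|q a| <= C by rewrite /q normrM normfV (gtr0_norm a0) ler_pdivrMl// mulrC.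
    by rewrite normrM (ger0_norm r0) mulrC ler_pM.
  have E : h * (q h - q a) = (p h - p (n%:R * a) - p r) + (p (n%:R * a) - n%:R * p a) + p r - r * q a.
    by rewrite /r /q; field; rewrite !gt_eqF.
  have k6 : `|h * (q h - q a)| <= C * h * a + C * h ^+ 2 + C * a + C * a.
    rewrite E (le_trans (ler_normB _ _))// lerD// (le_trans (ler_normD _ _))// lerD//.
      rewrite (le_trans (ler_normD _ _))// lerD//.
        apply: (le_trans k1); apply: ler_pM => //; first exact: mulr_ge0.
        exact: ler_wpM2l.
      by apply: (le_trans k2); apply: ler_wpM2l => //; apply: lerXn2r; rewrite ?nnegrE// ltW.
    by rewrite (le_trans k3)// ler_wpM2l.
  rewrite -(ler_pM2l h0); rewrite normrM (gtr0_norm h0) in k6.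
  apply: (le_trans k6); rewrite le_eqVlt; apply/orP; left; apply/eqP.
  by field; rewrite gt_eqF.
have qneg a : 0 < a -> `|q (- a) - q a| <= C * a.
  move=> a0; have := pp a (- a); rewrite subrr {1}/p subrr normrN (gtr0_norm a0).
  have -> : q (- a) - q a = a^-1 * (0 - p a - p (- a)).
    by rewrite /q; field; rewrite gt_eqF.
  by move=> h; rewrite normrM normfV (gtr0_norm a0) ler_pdivrMl// mulrA [a * C]mulrC.
apply: cauchy_cvg; apply: cauchy_exP => e e0.
pose h := Num.min 1 (e / (16 * (C + 1))).
have h0 : 0 < h by rewrite lt_min ltr01 divr_gt0// mulr_gt0// ltr_wpDl.
have h1 : h <= 1 by rewrite ge_min lexx.
have he : C * h <= e / 16.
  apply: (@le_trans _ _ ((C + 1) * (e / (16 * (C + 1))))).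
    by rewrite ler_pM// ?(ltW h0) ?lerDl// ge_min lexx orbT.
  by rewrite le_eqVlt; apply/orP; left; apply/eqP; field; rewrite gt_eqF// ltr_wpDl.
have hh : 0 < h ^+ 2 by rewrite exprn_gt0.
have hh1 : h ^+ 2 <= h by rewrite expr2 ler_piMl// ltW.
exists (q h); rewrite /= !near_simpl; near=> a; rewrite /ball/= -/(p a) -/(q a).
have a0 : a != 0 by near: a; exact: nbhs_dnbhs_neq.
(* This makes the term [|a| / h] of [qpos] at most [h]; in total the error is at most [5 * C * h],
   below [e]. *)
have ah : `|a| < h ^+ 2 by near: a; exact: dnbhs0_lt.
have aa0 : 0 < `|a| by rewrite normr_gt0.
have k1 := qpos `|a| h aa0 h0 (le_trans (ltW ah) hh1).
have k2 : `|q `|a| - q a| <= C * `|a|.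
  have [ap|an] := leP 0 a; first by rewrite (ger0_norm ap) subrr normr0 mulr_ge0.
  have := qneg (- a); rewrite oppr_gt0 opprK => /(_ an).
  by rewrite (ltr0_norm an) distrC.
have k3 : C * `|a| <= C * h by rewrite ler_wpM2l// (le_trans (ltW ah)).
have k4 : C * (`|a| / h) <= C * h.
  by rewrite ler_wpM2l// ler_pdivrMr// -expr2 ltW.
rewrite -(subrKA (q `|a|)) (le_lt_trans (ler_normD _ _))//.
lra.
Unshelve. all: by end_near.
Qed.

(** The Lipschitz bound for the quotient with step [a], multiplied by [a], is the mixed second
    difference bound required above. *)
Lemma Dk_derivable C u x i : Dk 2 C u -> derivable u x (e_ i).
Proof.
move=> Du; have C0 : 0 <= C := le_trans (normr_ge0 _) (Dk_bound Du 0).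
have lu := Dk_lip (Dk_down Du).
have lq h : h != 0 -> lip1 C (quo h i u) by move=> h0; apply: Dk_lip; case: Du => _; exact.
pose f t := u (x + t *: e_ i).
have se (t : R) : \sum_j `|(t *: e_ i : V) ord0 j| = `|t|.
  rewrite (bigD1 i)//= !mxE !eqxx/= mulr1 big1 ?addr0// => j ji.
  by rewrite !mxE (negbTE ji) andbF mulr0 normr0.
have lf s t : `|f (s + t) - f s| <= C * `|t|.
  by have := lu (x + s *: e_ i) (t *: e_ i); rewrite se -addrA -scalerDl.
have := @second_difference_cauchy f C C0 lf.
have -> : (fun h => h^-1 * (f h - f 0)) = (fun h => h^-1 *: ((u \o shift x) (h *: e_ i) - u x)).
  by apply/funext => h /=; rewrite /f scale0r addr0 [_ *: e_ i + x]addrC.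
apply=> a b; have [->|a0] := eqVneq a 0.
  by rewrite add0r normr0 mulr0 mul0r (_ : _ + _ = 0) ?normr0//; ring.
have := lq a a0 x (b *: e_ i); rewrite se /quo -mulrBr normrM normfV.
rewrite ler_pdivrMl ?normr_gt0// mulrA [`|a| * C]mulrC; apply: le_trans.
rewrite le_eqVlt; apply/orP; left; apply/eqP; congr (`|_|).
rewrite /f scale0r addr0 -[x + b *: _ + _]addrA -scalerDl [b + a]addrC.
by move: (u _) (u _) (u _) (u _) => *; ring.
Qed.

Definition all_Dk u := forall k, exists C, Dk k C u.

(** The derivative is the pointwise limit of quotients with step [1 / n.+1], which satisfy one bound
    of order [k], and [Dk] passes to such limits. *)
Lemma all_Dk_derive u i : all_Dk u -> all_Dk (fun x => 'D_(e_ i) u x).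
Proof.
move=> Su k; have [C DC] := Su k.+1; have [C2 DC2] := Su 2%N.
exists C; apply: (@Dk_lim _ _ (fun n => quo n.+1%:R^-1 i u)) => [n|x].
  by case: DC => _; apply; rewrite invr_eq0 pnatr_eq0.
have cv : derivable u x (e_ i) by exact: Dk_derivable DC2.
have hs : (forall n, @harmonic R n != 0) /\ @harmonic R n @[n --> \oo] --> (0 : R).
  by split; [move=> n; rewrite invr_eq0 pnatr_eq0|exact: cvg_harmonic].
have := (cvgr_dnbhsP (fun h => h^-1 *: ((u \o shift x) (h *: e_ i) - u x)) 0
  ('D_(e_ i) u x)).1 cv _ hs.
rewrite (_ : (fun n => _) = fun n => quo n.+1%:R^-1 i u x)//.
by apply/funext => n; rewrite /quo /= [_ *: e_ i + x]addrC.
Qed.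

Lemma smooth_of_all_Dk u : all_Dk u -> smooth u.
Proof.
move=> Su s.
have Ss : all_Dk (iter_partial s u).
  elim: s => [|i s IH] //=; exact: all_Dk_derive.
have [C1 D1] := Ss 1%N; have [C2 D2] := Ss 2%N; split.
  exact: lip1_continuous (Dk_lip D1).
by move=> i x; exact: Dk_derivable D2.
Qed.

End difference_quotients.

(** * The coupled system: bounds, bootstrap and the sum of squares *)

Section system.
Context {R : realType} {N : nat}.
Local Notation V := 'rV[R]_N.
Local Notation mu := (lebesgue_rV R N).
Implicit Types (x y z : V) (i j : 'I_N) (u v g f U W : V -> R) (h t d e C L r : R) (k : nat).
Variables (Lam : R).

(* The system reads [Laplacian u = cub u v], [Laplacian v = cub v u]. *)
Definition cub u v : V -> R := fun x => u x ^+ 3 - u x + Lam * (u x * v x ^+ 2).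

Lemma mfun_cub u v : mfun_rV u -> mfun_rV v -> mfun_rV (cub u v).
Proof.
move=> mu_ mv; apply: measurable_funD.
  by apply: measurable_funB => //; exact: measurable_funX.
apply: measurable_funM; first exact: measurable_cst.
by apply: measurable_funM => //; exact: measurable_funX.
Qed.

Lemma L3loc_locint u : L3loc u -> locint u /\ locint (fun x => `|u x| ^+ 3).
Proof.
move=> [mu_ Iu].
have m3 : mfun_rV (fun x => `|u x| ^+ 3) by apply: measurable_funX; exact: measurableT_comp.
have l3 : locint (fun x => `|u x| ^+ 3).
  split => // r; have := Iu _ (@compact_box R N r).
  move/(integrable_mkcond (fun x => (`|u x| ^+ 3)%:E) (measurable_box r)) => I3.
  move: I3; congr (mu.-integrable setT _); apply/funext => x.
  rewrite /patch /=; case: (bxP r x) => _; by rewrite ?mulr1 ?mulr0.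
split=> //; apply: (le_locint mu_ _ (locintD (locint_bounded (f := fun=> 1) (M := 1) _ _) l3)).
- move=> x; have := normr_ge0 (u x); move: `|u x| => a a0.
  have [a1|a1] := leP a 1; first by rewrite (le_trans a1)// lerDl exprn_ge0.
  rewrite (le_trans (y := a ^+ 3))// ?lerDr//.
  by rewrite exprS ler_peMr// exprn_ege1// ltW.
- exact: measurable_cst.
- by move=> x; rewrite normr1.
Qed.

(** The coupling term is dominated through [young_cube] by the two cubes, which are locally
    integrable. *)
Lemma locint_cub u v : L3loc u -> L3loc v -> locint (cub u v).
Proof.
move=> lu lv; have [lu1 lu3] := L3loc_locint lu; have [_ lv3] := L3loc_locint lv.
apply: (le_locint (mfun_cub lu.1 lv.1) _ (locintD (locintD lu3 (locint_norm lu1))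
  (locintZ `|Lam| (locintD lu3 lv3)))) => x.
rewrite /cub (le_trans (ler_normD _ _))// lerD//.
  by rewrite (le_trans (ler_normB _ _))// normrX.
rewrite normrM ler_wpM2l// normrM normrX.
exact: young_cube.
Qed.

Lemma conv_opp (k : V -> R) u x C r : locint u -> mfun_rV k ->
  (forall y, `|k y| <= C * bx r y) -> conv k (fun y => - u y) x = - conv k u x.
Proof.
move=> lu mk kC; have I1 := itg_conv x lu mk kC.
rewrite /conv -mulN1r -intRZ//; congr intR; apply/funext => y.
by rewrite mulNr mulN1r.
Qed.

Lemma weak_lapN u g : locint u -> locint g -> weak_lap u g ->
  weak_lap (fun x => - u x) (fun x => - g x).
Proof.
move=> lu lg wug e x e0.
have [C C0 rC] := rho_bound (N := N) e0; have [M bM] := be_bump e0.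
rewrite (conv_opp x lg (mfun_rho e0) rC).
by rewrite (conv_opp x lu (mfun_tens2 bM) (tens2_bound bM)) -/(rho2 e) wug.
Qed.

Lemma locintN u : locint u -> locint (fun x => - u x).
Proof. by move=> lu; have := locintZ (-1) lu; congr locint; apply/funext => x; rewrite mulN1r. Qed.

Lemma system_bound u v : 0 < Lam -> locint u -> locint (cub u v) ->
  weak_lap u (cub u v) -> {ae mu, forall x, `|u x| <= 1}.
Proof.
move=> L0 lu lg wu.
have a1 : {ae mu, forall x, u x <= 1}.
  apply: (subsolution_le1 lu lg wu) => x u1; rewrite /cub lerDl.
  apply: mulr_ge0 (ltW L0) (mulr_ge0 _ (sqr_ge0 _)).
  exact: le_trans ler01 (ltW u1).
have a2 : {ae mu, forall x, - u x <= 1}.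
  apply: (subsolution_le1 (locintN lu) (locintN lg) (weak_lapN lu lg wu)) => x u1.
  have -> : - cub u v x = (- u x) ^+ 3 - (- u x) + Lam * (- u x * v x ^+ 2).
    by rewrite /cub; ring.
  rewrite lerDl; apply: mulr_ge0 (ltW L0) (mulr_ge0 _ (sqr_ge0 _)).
  exact: le_trans ler01 (ltW u1).
apply: filterS2 a1 a2 => x u1 u2.
by rewrite ler_norml; lra.
Qed.

(** Turns a bound almost everywhere into one valid at every point, without changing the class. *)
Definition clip t : R := Num.max (- 1) (Num.min 1 t).

Lemma clip_le1 t : `|clip t| <= 1.
Proof.
by rewrite ler_norml /clip le_max lexx ge_max ge_min lexx/= andbT; lra.
Qed.

Lemma clip_id t : `|t| <= 1 -> clip t = t.
Proof.
rewrite ler_norml /clip => /andP[t1 t2].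
by rewrite (min_idPr t2) (max_idPr t1).
Qed.

Lemma mfun_clip u : mfun_rV u -> mfun_rV (fun x => clip (u x)).
Proof.
move=> mu_; apply: measurable_maxr; first exact: measurable_cst.
by apply: measurable_minr => //; exact: measurable_cst.
Qed.

Lemma cub_bound u v x : `|u x| <= 1 -> `|v x| <= 1 -> `|cub u v x| <= 2 + `|Lam|.
Proof.
move=> u1 v1; rewrite /cub (le_trans (ler_normD _ _))// lerD//.
  rewrite (le_trans (ler_normB _ _))// normrX lerD//.
  by rewrite exprn_ile1.
by rewrite normrM ler_piMr// normrM normrX mulr_ile1 ?exprn_ge0// exprn_ile1.
Qed.

Lemma Dk_cub k C u v : Dk k C u -> Dk k C v -> exists C', Dk k C' (cub u v).
Proof.
move=> Du Dv.
have := Dk_add (Dk_add (Dk_mul Du (Dk_mul Du Du)) (Dk_mul (Dk_cst k (-1)) Du))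
  (Dk_mul (Dk_cst k Lam) (Dk_mul Du (Dk_mul Dv Dv))).
set C' := (X in Dk _ X _) => D; exists C'; move: D; congr Dk.
by apply/funext => x; rewrite /cub; ring.
Qed.

Lemma ae_cub u v U W : {ae mu, forall x, u x = U x} -> {ae mu, forall x, v x = W x} ->
  {ae mu, forall x, cub u v x = cub U W x}.
Proof. by move=> a1 a2; apply: filterS2 a1 a2 => x; rewrite /cub => -> ->. Qed.

(** Bootstrap on the pair: bounds of order [k] pass to the polynomial right-hand sides, and
    [elliptic_gain] returns order [k.+1]. *)
Lemma all_Dk_system U W L : 0 <= L -> mfun_rV U -> mfun_rV W ->
  (forall x, `|U x| <= 1) -> (forall x, `|W x| <= 1) -> lip1 L U -> lip1 L W ->
  weak_lap U (cub U W) -> weak_lap W (cub W U) -> all_Dk U /\ all_Dk W.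
Proof.
move=> L0 mU mW U1 W1 lU lW wU wW.
suff H k : exists C, Dk k C U /\ Dk k C W.
  by split=> k; have [C []] := H k; exists C.
elim: k => [|k [C [DU DW]]]; first by exists 1.
have [C1 D1] := Dk_cub DU DW; have [C2 D2] := Dk_cub DW DU.
have e1 := elliptic_gain mU (mfun_cub mU mW) (ex_intro2 _ _ L L0 lU) wU DU D1.
have e2 := elliptic_gain mW (mfun_cub mW mU) (ex_intro2 _ _ L L0 lW) wW DW D2.
exists (Num.max (2 * C + C1) (2 * C + C2)); split.
  by apply: Dk_le e1; rewrite le_max lexx.
by apply: Dk_le e2; rewrite le_max lexx orbT.
Qed.

Lemma system_representative u v : 0 < Lam -> L3loc u -> L3loc v ->
  weak_lap u (cub u v) -> weak_lap v (cub v u) ->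
  exists U W, [/\ all_Dk U, all_Dk W, mfun_rV U /\ mfun_rV W,
    (forall x, `|U x| <= 1) /\ (forall x, `|W x| <= 1) &
    [/\ weak_lap U (cub U W), weak_lap W (cub W U),
      {ae mu, forall x, u x = U x} & {ae mu, forall x, v x = W x}]].
Proof.
move=> L0 Lu Lv wu wv.
have [lu _] := L3loc_locint Lu; have [lv _] := L3loc_locint Lv.
have lg := locint_cub Lu Lv; have lh := locint_cub Lv Lu.
have bu := system_bound L0 lu lg wu; have bv := system_bound L0 lv lh wv.
pose uc x := clip (u x); pose vc x := clip (v x).
have mu_ := lu.1; have mv := lv.1.
have mc : mfun_rV uc by exact: mfun_clip. have mvc : mfun_rV vc by exact: mfun_clip.
have au : {ae mu, forall x, u x = uc x} by apply: filterS bu => x ux; rewrite /uc clip_id.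
have av : {ae mu, forall x, v x = vc x} by apply: filterS bv => x vx; rewrite /vc clip_id.
have wuc : weak_lap uc (cub uc vc).
  by apply: (weak_lap_ae mu_ mc _ _ au (ae_cub au av) wu); exact: mfun_cub.
have wvc : weak_lap vc (cub vc uc).
  by apply: (weak_lap_ae mv mvc _ _ av (ae_cub av au) wv); exact: mfun_cub.
have uc1 x : `|uc x| <= 1 by exact: clip_le1.
have vc1 x : `|vc x| <= 1 by exact: clip_le1.
have [U [mU U1 lU aU]] := lipschitz_representative mc (mfun_cub mc mvc) uc1
  (fun x => cub_bound (uc1 x) (vc1 x)) wuc.
have [W [mW W1 lW aW]] := lipschitz_representative mvc (mfun_cub mvc mc) vc1
  (fun x => cub_bound (vc1 x) (uc1 x)) wvc.
have wU : weak_lap U (cub U W).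
  by apply: (weak_lap_ae mc mU _ _ aU (ae_cub aU aW) wuc); exact: mfun_cub.
have wW : weak_lap W (cub W U).
  by apply: (weak_lap_ae mvc mW _ _ aW (ae_cub aW aU) wvc); exact: mfun_cub.
have LL0 : 0 <= 2 * 1 + (2 + `|Lam|) by rewrite !addr_ge0.
have [sU sW] := all_Dk_system LL0 mU mW U1 W1 lU lW wU wW.
exists U, W; split => //; split => //.
  by apply: filterS2 au aU => x -> ->.
by apply: filterS2 av aW => x -> ->.
Qed.

Lemma mol_near L e u x : 0 <= L -> 0 < e -> lip1 L u -> locint u ->
  `|mol e u x - u x| <= L * (N%:R * e).
Proof.
move=> L0 e0 lu ll; have m0 := mass_gt0 (N := N) e0.
have [C C0 rC] := rho_bound (N := N) e0; have mr := mfun_rho (N := N) e0.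
have I1 := itg_conv x ll mr rC.
have I2 : itg (fun y => rho e (y - x)) by apply: itg_shift; exact: itg_rho.
have E : mol e u x - u x = (@mass R N e)^-1 * intR (fun y => u y * rho e (y - x) - u x * rho e (y - x)).
  rewrite intRB//; last exact: itgZ.
  rewrite intRZ// (@intR_shift R N (- x) (rho e))// -/(mass e) mulrBr -/(conv (rho e) u x).
  by rewrite mulrCA mulVf ?gt_eqF// mulr1.
rewrite E normrM normfV (gtr0_norm m0) ler_pdivrMl//.
rewrite (le_trans (le_norm_intR _))//; first by apply: itgB => //; exact: itgZ.
rewrite mulrC -[X in _ * X](@intR_shift R N (- x) (rho e))// -intRZ//.
apply: le_intR; [by apply: itg_norm; apply: itgB => //; exact: itgZ|exact: itgZ|].
move=> y; rewrite -mulrBl normrM (ger0_norm (rho_ge0 _ _)).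
have [->|ry] := eqVneq (rho e (y - x)) 0; first by rewrite !mulr0.
rewrite ler_wpM2r ?rho_ge0//.
have := lu x (y - x); rewrite [x + _]addrC subrK => h; apply: (le_trans h).
rewrite ler_wpM2l// (le_trans (y := \sum_(i < N) e))//.
  by apply: ler_sum => i _; exact: rho_out ry i.
by rewrite sumr_const card_ord -[e *+ N]mulr_natl.
Qed.

Lemma ler_linear_near (a C eta : R) : 0 < eta ->
  (forall h, 0 < h -> h <= eta -> a <= C * h) -> a <= 0.
Proof.
move=> eta0 H; apply: (@ler_linear_eps _ _ (C * eta)) => h h0 h1.
by rewrite -mulrA; apply: H; [exact: mulr_gt0|rewrite ler_piMr// ltW].
Qed.

Lemma sdiff_sqr h i U y : 2 * U y * sdiff h i U y <= sdiff h i (fun y => U y ^+ 2) y.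
Proof.
rewrite /sdiff; move: (U _) (U _) (U y) => a b c.
have := sqr_ge0 (a - c); have := sqr_ge0 (b - c); nra.
Qed.

(** The maximum principle is run on mollifications, for which [qlap] is available; they differ from
    [U] and [W] by O(e) uniformly, as all functions involved are Lipschitz. *)
Lemma sum_sqr_bound U W (kap : R) : 0 < kap -> all_Dk U -> all_Dk W ->
  mfun_rV U -> mfun_rV W -> (forall x, `|U x| <= 1) -> (forall x, `|W x| <= 1) ->
  weak_lap U (cub U W) -> weak_lap W (cub W U) ->
  (forall x, kap * (U x ^+ 2 + W x ^+ 2) ^+ 2 - (U x ^+ 2 + W x ^+ 2) <=
    U x * cub U W x + W x * cub W U x) ->
  forall x, U x ^+ 2 + W x ^+ 2 <= kap^-1.
Proof.
move=> k0 sU sW mU mW U1 W1 wU wW src x0.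
set G := cub U W in wU src; set H := cub W U in wW src.
have [CU DU] := sU 1%N; have [CW DW] := sW 1%N.
pose C := Num.max CU CW.
have {}DU : Dk 1 C U by apply: Dk_le DU; rewrite le_max lexx.
have {}DW : Dk 1 C W by apply: Dk_le DW; rewrite le_max lexx orbT.
have [CG DG] := Dk_cub DU DW; have [CH DH] := Dk_cub DW DU.
pose L := Num.max C (Num.max CG CH).
have {}DU : Dk 1 L U by apply: Dk_le DU; rewrite le_max lexx.
have {}DW : Dk 1 L W by apply: Dk_le DW; rewrite le_max lexx.
have {}DG : Dk 1 L G by apply: Dk_le DG; rewrite !le_max lexx orbT.
have {}DH : Dk 1 L H by apply: Dk_le DH; rewrite !le_max lexx !orbT.
have L0 : 0 <= L := le_trans (normr_ge0 _) (Dk_bound DU 0).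
have mG : mfun_rV G by exact: mfun_cub. have mH : mfun_rV H by exact: mfun_cub.
have GL := Dk_bound DG; have HL := Dk_bound DH.
have lU := locint_bounded mU U1; have lW := locint_bounded mW W1.
have lG := locint_bounded mG GL; have lH := locint_bounded mH HL.
pose s x := U x ^+ 2 + W x ^+ 2.
have n0 : 0 <= N%:R :> R by [].
pose Q := L * N%:R; have Q0 : 0 <= Q by rewrite mulr_ge0.
rewrite -subr_le0.
(* The same [e] is the mollification scale and the weight of the penalty. The first summand covers
   an excess already of order [e], the second comes from the maximum principle. *)
apply: (@ler_linear_eps _ _ (2 * (8 * Q + 1) + 2 * (N%:R + 2 * (Q + L * Q)))) => e e0 e1.
pose Ue := mol e U; pose We := mol e W; pose Ge := mol e G; pose He := mol e H.
have nU x : `|Ue x - U x| <= Q * e by rewrite -mulrA; exact: mol_near (Dk_lip DU) lU.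
have nW x : `|We x - W x| <= Q * e by rewrite -mulrA; exact: mol_near (Dk_lip DW) lW.
have nG x : `|Ge x - G x| <= Q * e by rewrite -mulrA; exact: mol_near (Dk_lip DG) lG.
have nH x : `|He x - H x| <= Q * e by rewrite -mulrA; exact: mol_near (Dk_lip DH) lH.
have Ue1 x : `|Ue x| <= 1 := mol_le x e0 mU U1.
have We1 x : `|We x| <= 1 := mol_le x e0 mW W1.
have qU : qlap Ue Ge := qlap_mol e0 lU wU.
have qW : qlap We He := qlap_mol e0 lW wW.
have cU : continuous Ue := continuous_mol e0 lU.
have cW : continuous We := continuous_mol e0 lW.
clearbody Ue We Ge He.
pose se x := Ue x ^+ 2 + We x ^+ 2.
have sqd (a b : R) : `|a| <= 1 -> `|b| <= 1 -> `|a - b| <= Q * e -> `|a ^+ 2 - b ^+ 2| <= 2 * (Q * e).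
  move=> a1 b1 ab; rewrite subr_sqr normrM mulrC ler_pM//.
  by rewrite (le_trans (ler_normD _ _))//; lra.
have ns x : `|se x - s x| <= 4 * (Q * e).
  have := sqd _ _ (Ue1 x) (U1 x) (nU x); have := sqd _ _ (We1 x) (W1 x) (nW x).
  by rewrite /se /s !ler_norml; lra.
have Qe0 : 0 <= Q * e by rewrite mulr_ge0// ltW.
have sqle (a : R) : `|a| <= 1 -> 0 <= a ^+ 2 <= 1.
  by move=> a1; rewrite sqr_ge0/= -[a ^+ 2]ger0_norm ?sqr_ge0// normrX exprn_ile1.
have se2 x : 0 <= se x <= 2.
  by have := sqle _ (Ue1 x); have := sqle _ (We1 x); rewrite /se; lra.
have ik0 : 0 < kap^-1 by rewrite invr_gt0.
have [small|big] := leP (s x0 - kap^-1) (2 * ((8 * Q + 1) * e)).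
  apply: (le_trans small); rewrite [leRHS]mulrDl [leLHS]mulrA lerDl.
  by rewrite !mulr_ge0 ?(ltW e0) ?addr_ge0 ?mulr_ge0 ?addr_ge0 ?mulr_ge0.
(* Makes [F 0 = e] positive while [c] stays nonnegative by [big]; with [se <= 2 <= e * rr ^+ 2] this
   gives [F <= 0] on the faces. *)
pose c := se x0 - e.
have c_ge : s x0 - 4 * (Q * e) - e <= c by have := ns x0; rewrite ler_norml /c; lra.
have cp : 0 <= c.
  have : 0 <= 8 * Q * e by rewrite !mulr_ge0// ltW.
  by move: big c_ge; clear -Qe0 ik0 e0; lra.
pose F y := se (x0 + y) - c - e * sumsq y.
pose rr := 2 / e + 1.
have rr1 : 1 <= rr by rewrite lerDr divr_ge0// ltW.
have drr : 2 <= e * rr ^+ 2.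
  apply: (@le_trans _ _ (e * rr)).
    by rewrite /rr mulrDr mulrCA divff ?gt_eqF// !mulr1 lerDl ltW.
  by rewrite ler_pM2l// expr2 ler_peMl// (le_trans ler01).
have cF : continuous F.
  apply: continuousBf; last by apply: continuousZf; exact: continuous_sumsq.
  apply: continuousBf; last exact: cst_continuous.
  apply: (@continuous_shiftf _ _ x0 se); apply: continuousDf => y.
    by apply: (@continuous_comp _ _ _ Ue (fun t => t ^+ 2)); [exact: cU|exact: exprn_continuous].
  by apply: (@continuous_comp _ _ _ We (fun t => t ^+ 2)); [exact: cW|exact: exprn_continuous].
have sq0 : sumsq (0 : V) = 0 by rewrite /sumsq big1// => k _; rewrite mxE expr0n.
have F0 : 0 < F 0 by rewrite /F addr0 sq0 mulr0 subr0 /c; lra.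
have [||y [_ Fy [eta eta0 hy]]] := @max_interior _ _ F (fun=> - rr) (fun=> rr) 0 cF _ _ F0.
- move=> y _ [j yj]; have := sumsq_ge y j.
  have -> : y ord0 j ^+ 2 = rr ^+ 2 by case: yj => ->; rewrite ?sqrrN.
  move=> /(ler_wpM2l (ltW e0)) h1; have := se2 (x0 + y); rewrite /F; lra.
- by move=> j; rewrite mxE oppr_le0 andbb (le_trans ler01).
pose z := x0 + y.
have sz : c <= se z.
  have : 0 < F y by exact: lt_le_trans Fy.
  have : 0 <= e * sumsq y by rewrite mulr_ge0 ?sumsq_ge0// ltW.
  by rewrite /F -/z; lra.
have [C1 hC1] := qU z; have [C2 hC2] := qW z.
have key : Ue z * Ge z + We z * He z - e * N%:R <= 0.
  apply: (@ler_linear_near _ (`|C1| + `|C2|) (Num.min 1 eta)); first by rewrite lt_min ltr01.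
  move=> h h0; rewrite le_min => /andP[h1 he].
  have nh : `|h| = h by rewrite gtr0_norm.
  have := hy h; rewrite nh => /(_ he).
  have dF : dlap h F y = dlap h se z - e * dlap h sumsq y.
    rewrite /dlap mulr_sumr -sumrB; apply: eq_bigr => j _.
    rewrite /sdiff /F ![x0 + (y + _)]addrA -/z.
    by move: (se _) (se _) (se _) (sumsq _) (sumsq _) (sumsq _) => *; ring.
  rewrite dF dlap_sumsq => hF.
  have hs : 2 * Ue z * dlap h Ue z + 2 * We z * dlap h We z <= dlap h se z.
    rewrite /dlap !mulr_sumr -big_split/=; apply: ler_sum => j _.
    have := sdiff_sqr h j Ue z; have := sdiff_sqr h j We z.
    rewrite /se {3 4}/sdiff {3}/sdiff /sdiff; lra.
  have t1 := hC1 h; have t2 := hC2 h; rewrite nh in t1 t2.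
  have {}t1 := t1 h1; have {}t2 := t2 h1.
  have b1 : Ue z * (h ^+ 2 * Ge z) - `|C1| * h ^+ 3 <= Ue z * dlap h Ue z.
    rewrite lerBlDr -lerBlDl -mulrBr (le_trans (ler_norm _))// normrM distrC.
    by rewrite -[leRHS]mul1r ler_pM// (le_trans t1)// ler_wpM2r ?ler_norm ?exprn_ge0 ?(ltW h0)//.
  have b2 : We z * (h ^+ 2 * He z) - `|C2| * h ^+ 3 <= We z * dlap h We z.
    rewrite lerBlDr -lerBlDl -mulrBr (le_trans (ler_norm _))// normrM distrC.
    by rewrite -[leRHS]mul1r ler_pM// (le_trans t2)// ler_wpM2r ?ler_norm ?exprn_ge0 ?(ltW h0)//.
  have h20 : 0 < h ^+ 2 by rewrite exprn_gt0.
  suff : h ^+ 2 * (Ue z * Ge z + We z * He z - e * N%:R) <=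
      h ^+ 2 * ((`|C1| + `|C2|) * h) by rewrite ler_pM2l.
  have -> : h ^+ 2 * ((`|C1| + `|C2|) * h) = `|C1| * h ^+ 3 + `|C2| * h ^+ 3.
    by move: `|C1| `|C2| => *; ring.
  have -> : h ^+ 2 * (Ue z * Ge z + We z * He z - e * N%:R) =
     Ue z * (h ^+ 2 * Ge z) + We z * (h ^+ 2 * He z) - e * (N%:R * h ^+ 2).
    by move: (Ue z) (Ge z) (We z) (He z) => *; ring.
  move: hF hs b1 b2; clear.
  move: (dlap h se z) (dlap h Ue z) (dlap h We z) (Ue z) (We z) => p1 p2 p3 p4 p5.
  move: (h ^+ 2) (h ^+ 3) (Ge z) (He z) `|C1| `|C2| => p6 p7 p8 p9 p10 p11.
  lra.
have prod (a b g1 g2 : R) : `|a| <= 1 -> `|b - a| <= Q * e -> `|a| <= 1 -> `|b| <= 1 ->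
    `|g1| <= L -> `|g2 - g1| <= Q * e -> a * g1 <= b * g2 + (Q + L * Q) * e.
  move=> a1 ba _ b1 g1L g21; rewrite -lerBlDl.
  have -> : a * g1 - b * g2 = (a - b) * g1 + b * (g1 - g2) by ring.
  rewrite (le_trans (ler_norm _))// (le_trans (ler_normD _ _))// !normrM.
  rewrite mulrDl addrC -mulrA; apply: lerD.
    by rewrite -[leRHS]mul1r ler_pM// distrC.
  by rewrite mulrC ler_pM// distrC.
have p1 := prod _ _ _ _ (U1 z) (nU z) (U1 z) (Ue1 z) (GL z) (nG z).
have p2 := prod _ _ _ _ (W1 z) (nW z) (W1 z) (We1 z) (HL z) (nH z).
have srcz := src z; rewrite -/(s z) in srcz.
have sz2 : s x0 - 8 * (Q * e) - e <= s z.
  by have := ns z; rewrite ler_norml; lra.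
have sz3 : kap^-1 + (s x0 - kap^-1) / 2 <= s z by move: big sz2; clear; lra.
have sg : 0 <= s x0 - kap^-1.
  have : 0 <= 2 * ((8 * Q + 1) * e) by rewrite !mulr_ge0 ?addr_ge0 ?mulr_ge0// ltW.
  by move: big; clear; lra.
(* The quadratic vanishes at [kap^-1] and has slope at least 1 beyond it; [s z] keeps at least half
   of the excess at [x0]. *)
have lower : (s x0 - kap^-1) / 2 <= kap * s z ^+ 2 - s z.
  have -> : kap * s z ^+ 2 - s z = s z * (kap * (s z - kap^-1)).
    by rewrite mulrBr divff ?gt_eqF//; ring.
  have e1' : kap^-1 <= s z by move: sz3 sg; clear; lra.
  have e2' : (s x0 - kap^-1) / 2 <= s z - kap^-1 by move: sz3; clear; lra.
  have e3 : 0 <= (s x0 - kap^-1) / 2 by rewrite divr_ge0.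
  rewrite (le_trans (y := kap^-1 * (kap * (s z - kap^-1))))//.
    by rewrite mulrA mulVf ?gt_eqF// mul1r.
  by rewrite ler_wpM2r// mulr_ge0 ?(ltW k0)// subr_ge0.
have : 0 <= 2 * (8 * Q + 1) * e by rewrite !mulr_ge0 ?addr_ge0 ?mulr_ge0// ltW.
move: lower srcz p1 p2 key; rewrite -/(s x0); clear.
move: (U z * G z) (W z * H z) (Ue z * Ge z) (We z * He z) => a1 a2 a3 a4.
move: (kap * s z ^+ 2) (s z) (s x0) kap^-1 => a5 a6 a7 a8; move: (Q + L * Q) => a9.
lra.
Qed.

End system.

(** * From distributional solutions to the three conclusions *)

Lemma weak_lap_system (R : realType) (N : nat) (Lam : R) (u v : 'rV[R]_N -> R) :
  L3loc u -> L3loc v -> distributional_solution Lam u v ->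
  weak_lap u (cub Lam u v) /\ weak_lap v (cub Lam v u).
Proof.
move=> Lu Lv [eu ev]; have [lu lv] := (locint_cub Lam Lu Lv, locint_cub Lam Lv Lu).
have Eu : (fun x => u x - u x ^+ 3 - Lam * u x * v x ^+ 2) = (fun x => - cub Lam u v x).
  by apply/funext => x; rewrite /cub; ring.
have Ev : (fun x => v x - v x ^+ 3 - Lam * u x ^+ 2 * v x) = (fun x => - cub Lam v u x).
  by apply/funext => x; rewrite /cub; ring.
rewrite Eu in eu; rewrite Ev in ev; split.
  rewrite (_ : cub _ _ _ = fun x => - - cub Lam u v x); last by apply/funext => x; rewrite opprK.
  exact: weak_lap_of_neg_laplacian (locintN lu) eu.
rewrite (_ : cub _ _ _ = fun x => - - cub Lam v u x); last by apply/funext => x; rewrite opprK.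
exact: weak_lap_of_neg_laplacian (locintN lv) ev.
Qed.

Theorem theorem1p3 (R : realType) (N : nat) (hN : (1 <= N)%N) (Lambda : R)
    (u v : 'rV[R]_N -> R) (hu : L3loc u) (hv : L3loc v)
    (huv : distributional_solution Lambda u v) :
  (0 < Lambda ->
    exists U V : 'rV[R]_N -> R,
      smooth_representative u U /\ smooth_representative v V /\
      (forall x, `|U x| <= 1) /\ (forall x, `|V x| <= 1)) /\
  (1 <= Lambda ->
    exists U V : 'rV[R]_N -> R,
      smooth_representative u U /\ smooth_representative v V /\
      (forall x, U x ^+ 2 + V x ^+ 2 <= 1)) /\
  (0 < Lambda -> Lambda < 1 ->
    exists U V : 'rV[R]_N -> R,
      smooth_representative u U /\ smooth_representative v V /\
      (forall x, U x ^+ 2 + V x ^+ 2 <= 2 / (Lambda + 1))).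
Proof.
have [wu wv] := weak_lap_system hu hv huv.
have rep (L0 : 0 < Lambda) := system_representative L0 hu hv wu wv.
split; [move=> L0|split=> [L1|L0 L1]].
- have [U [W [sU sW _ [U1 W1] [_ _ aU aW]]]] := rep L0.
  exists U, W; split; first by split => //; exact: smooth_of_all_Dk.
  by split=> //; split => //; exact: smooth_of_all_Dk.
- have [U [W [sU sW [mU mW] [U1 W1] [wU wW aU aW]]]] := rep (lt_le_trans ltr01 L1).
  exists U, W; split; first by split => //; exact: smooth_of_all_Dk.
  split; first by split => //; exact: smooth_of_all_Dk.
  move=> x; rewrite -invr1.
  apply: (sum_sqr_bound ltr01 sU sW mU mW U1 W1 wU wW) => {}x.
  rewrite -subr_ge0 /cub; move: (U x) (W x) => a b.
  (* With [kap = 1] the source exceeds s^2 - s by a multiple of (a b)^2, nonnegative exactly because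
     [Lambda >= 1]. *)
  have -> : a * (a ^+ 3 - a + Lambda * (a * b ^+ 2)) +
      b * (b ^+ 3 - b + Lambda * (b * a ^+ 2)) -
      (1 * (a ^+ 2 + b ^+ 2) ^+ 2 - (a ^+ 2 + b ^+ 2)) =
      2 * (Lambda - 1) * (a * b) ^+ 2 by ring.
  by rewrite mulr_ge0 ?sqr_ge0// mulr_ge0// subr_ge0.
- have [U [W [sU sW [mU mW] [U1 W1] [wU wW aU aW]]]] := rep L0.
  exists U, W; split; first by split => //; exact: smooth_of_all_Dk.
  split; first by split => //; exact: smooth_of_all_Dk.
  have k0 : 0 < (Lambda + 1) / 2 by rewrite divr_gt0// addr_gt0.
  move=> x; rewrite -invf_div.
  apply: (sum_sqr_bound k0 sU sW mU mW U1 W1 wU wW) => {}x.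
  rewrite -subr_ge0 /cub; move: (U x) (W x) => a b.
  (* With [kap = (Lambda + 1) / 2] the excess is a multiple of (a^2 - b^2)^2; it vanishes when a^2 =
     b^2, so no larger [kap] would do. *)
  have -> : a * (a ^+ 3 - a + Lambda * (a * b ^+ 2)) +
      b * (b ^+ 3 - b + Lambda * (b * a ^+ 2)) -
      ((Lambda + 1) / 2 * (a ^+ 2 + b ^+ 2) ^+ 2 - (a ^+ 2 + b ^+ 2)) =
      (1 - Lambda) / 2 * (a ^+ 2 - b ^+ 2) ^+ 2 by field.
  by rewrite mulr_ge0 ?sqr_ge0// divr_ge0// subr_ge0 ltW.
Qed.
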